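(* Let $\mathbb L\in\{\mathbb R,\mathbb C\}$, $\mathbb K\in\{\mathbb R,\mathbb L\}$, $s\in\{\infty,\omega\}$, and $r\in\mathbb N_0\cup\{\infty\}$. Let $G$ be a $C^s_{\mathbb K}$-Lie group and $M$ be a $G$-manifold of class $C^r_{\mathbb K}$ with action $\alpha$. Let $(E_i)_{i\in I}$ be a family of equivariant $\mathbb L$-vector bundles $\pi_i\colon E_i\to M$ of class $C^r_{\mathbb K}$ with typical fibre $F_i$ and $G$-action $\beta_i\colon G\times E_i\to E_i$. Assume that (a) or (b) is satisfied: (a) $G$ and $M$ are finite dimensional; or (b) $I$ is countable and each $F_i$ as well as the modeling spaces of $G$ and $M$ are $k_\omega$-spaces. Moreover, assume: (c) For each $x\in M$, there exists an open neighbourhood $U$ of $x$ in $M$ such that, for each $i\in I$, the vector bundle $E_i$ admits a local trivialization $\psi_i\colon\pi_i^{-1}(U)\to U\times F_i$. Then $\bigoplus_{i\in I}E_i:=\bigcup_{x\in M}\bigoplus_{i\in I}(E_i)_x$ (disjoint union, projecting to $M$ via $\bigoplus_{i\in I}(E_i)_x\ni v\mapsto x$), with the bundle structure and $G$-action specified as follows, is an equivariant $\mathbb L$-vector bundle of class $C^r_{\mathbb K}$ over $M$: it carries the unique $\mathbb L$-vector bundle structure of class $C^r_{\mathbb K}$ with typical fibre $\bigoplus_{i\in I}F_i$ such that $$\bigoplus_{i\in I}(E_i)_x\ni(v_i)_{i\in I}\mapsto\bigl(x,(\mathrm{pr}_{F_i}(\psi_i(v_i)))_{i\in I}\bigr)\in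 U\times\bigoplus_{i\in I}F_i\quad(x\in U)$$ is a local trivialization for each family $(\psi_i)_{i\in I}$ of local trivializations over a common open set $U$ as in (c), and the action is $\beta(g,(v_i)_{i\in I}):=(\beta_i(g,v_i))_{i\in I}$.
   Context: All locally convex spaces are Hausdorff; manifolds and Lie groups are modeled on (possibly infinite-dimensional) locally convex $\mathbb K$-spaces. Complex spaces are regarded as real ones when $\mathbb K=\mathbb R$. $\bigoplus_{i\in I}F_i$ carries the locally convex direct sum topology. $C^r_{\mathbb K}$-maps (Keller's $C^r_c$-theory): for $r\in\mathbb N_0\cup\{\infty\}$, a map $f\colon U\to H$ from an open subset $U$ of a locally convex $\mathbb K$-space $X$ to a locally convex $\mathbb K$-space $H$ is $C^r_{\mathbb K}$ if it is continuous and for all $j\in\mathbb N$ with $j\le r$ the iterated directional derivatives $d^jf(x,y_1,\ldots,y_j)=(D_{y_j}\cdots D_{y_1}f)(x)$ (over $\mathbb K$) exist and define a continuous map $U\times X^j\to H$. $C^\omega_{\mathbb C}$ means complex analytic (equivalent to $C^\infty_{\mathbb C}$); $C^\omega_{\mathbb R}$ means: extends to a complex analytic map to $H_{\mathbb C}$ on an open neighbourhood of $U$ in $X_{\mathbb C}$. Manifolds and Lie groups are defined as usual. An $\mathbb L$-vector bundle of class $C^r_{\mathbb K}$ over $M$ with typical fibre a locally convex $\mathbb L$-vector space $F$ is a $C^r_{\mathbb K}$-manifold $E$ with a surjective $C^r_{\mathbb K}$-map $\pi\colon E\to M$ and an $\mathbb L$-vector space structure on each fibre $E_x=\pi^{-1}(\{x\})$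 such that each $x\in M$ has an open neighbourhood $U\subseteq M$ with a $C^r_{\mathbb K}$-diffeomorphism $\psi\colon\pi^{-1}(U)\to U\times F$ (a local trivialization) satisfying $\psi(E_y)=\{y\}\times F$ and $\mathrm{pr}_F\circ\psi|_{E_y}\colon E_y\to F$ $\mathbb L$-linear for all $y\in U$ ($\mathrm{pr}_F$ is the projection to $F$). A $G$-manifold of class $C^r_{\mathbb K}$ is a $C^r_{\mathbb K}$-manifold $M$ with a $C^r_{\mathbb K}$-action $\alpha\colon G\times M\to M$. An equivariant $\mathbb L$-vector bundle of class $C^r_{\mathbb K}$ over $(M,\alpha)$ is an $\mathbb L$-vector bundle $\pi\colon E\to M$ of class $C^r_{\mathbb K}$ with a $C^r_{\mathbb K}$-action $\beta\colon G\times E\to E$ such that $\beta(g,E_x)\subseteq E_{\alpha(g,x)}$ and $\beta(g,\cdot)|_{E_x}\colon E_x\to E_{\alpha(g,x)}$ is $\mathbb L$-linear for all $(g,x)\in G\times M$. A $k_\omega$-space is a Hausdorff space $X=\bigcup_{n\in\mathbb N}K_n$ with compact sets $K_1\subseteq K_2\subseteq\cdots$ such that each compact subset of $X$ is contained in some $K_n$ (hemicompact), and which is a $k$-space: a subset $A\subseteq X$ is closed if and only if $A\cap K$ is closed in $K$ for each compact $K\subseteq X$. *)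

(* Defs.v *)
From HB Require Import structures.
From mathcomp Require Import all_boot all_order all_algebra.
From mathcomp Require Import all_classical all_reals.
From mathcomp Require Import interval_inference topology convex normedtype.
From mathcomp.real_closed Require Import complex.
Set Implicit Arguments.
Unset Strict Implicit.
Unset Printing Implicit Defensive.
Import Order.TTheory GRing.Theory Num.Theory.
Import numFieldNormedType.Exports.
Local Open Scope classical_set_scope.
Local Open Scope ring_scope.

(* The possible pairs (K, L) with L = R or C and K = R or L. *)
Variant scalars := RR | RC | CC.

Definition baseK (R : realType) (KL : scalars) : numFieldType :=
  match KL with RR | RC => R | CC => R[i] end.

Definition baseL (R : realType) (KL : scalars) : numFieldType :=
  match KL with RR => R | RC | CC => R[i] end.

Definition scal_emb (R : realType) (KL : scalars) : baseK R KL -> baseL R KL :=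
  match KL with
  | RR => fun a : R => a
  | RC => fun a : R => a%:C%C
  | CC => fun a : R[i] => a
  end.

Lemma convex_setP (K : numDomainType) (V : lmodType K) (A : set V) :
  (convex_set A : Prop) <->
  forall (x y : V) (a : K), 0 <= a -> a <= 1 -> A x -> A y ->
    A (a *: x + (1 - a) *: y).
Proof.
split=> [cA x y a a0 a1 Ax Ay|cA x y a /set_mem Ax /set_mem Ay].
  pose p := Itv01 a0 a1.
  by have := cA x y p (mem_set Ax) (mem_set Ay); rewrite inE.
by apply/mem_set; apply: (cA x y a%:num).
Qed.

Section ScalEmb.
Variables (R : realType) (KL : scalars).
Local Notation emb := (@scal_emb R KL).

Lemma scal_embD : {morph emb : a b / a + b}.
Proof. by case: KL => //= a b; rewrite rmorphD. Qed.

Lemma scal_embM : {morph emb : a b / a * b}.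
Proof. by case: KL => //= a b; rewrite rmorphM. Qed.

Lemma scal_emb1 : emb 1 = 1.
Proof. by case: KL. Qed.

Lemma scal_emb_ge0 a : 0 <= a -> 0 <= emb a.
Proof. by case: KL a => //= a; rewrite lecR. Qed.

Lemma scal_emb_continuous :
  continuous (emb : (baseK R KL)^o -> (baseL R KL)^o).
Proof.
case: KL => /=; [by move=> x; exact: cvg_id| |by move=> x; exact: cvg_id].
move=> x; apply/cvgrPdist_lt => e e0 /=.
have e0' : 0 < complex.Re e by move: e0; rewrite ltcE /= => /andP[].
have eE : e = (complex.Re e)%:C%C.
  case: e e0 {e0'} => a b; rewrite ltcE /= => /andP[/eqP-> _].
  by [].
have /cvgrPdist_lt/(_ _ e0') := @cvg_id _ (nbhs (x : R^o)).
apply: filterS => y /= xy.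
by rewrite -rmorphB /= eE normc_def /= expr0n addr0 sqrtr_sqr ltcR.
Qed.

End ScalEmb.

(* The L-space [V] regarded as a K-space. *)
Definition restr (R : realType) (KL : scalars) (V : Type) : Type := V.

Section Restr.
Variables (R : realType) (KL : scalars) (V : tvsType (baseL R KL)).
Local Notation K := (baseK R KL).
Local Notation W := (restr R KL V).
Local Notation emb := (@scal_emb R KL).

HB.instance Definition _ := Uniform.copy W V.
HB.instance Definition _ := GRing.Zmodule.copy W V.

Let rscale (a : K) (v : W) : W := emb a *: (v : V).

Let rscaleA a b v : rscale a (rscale b v) = rscale (a * b) v.
Proof. by rewrite /rscale scalerA scal_embM. Qed.

Let rscale1 : left_id 1 rscale.
Proof. by move=> v; rewrite /rscale scal_emb1 scale1r. Qed.

Let rscaleDr : right_distributive rscale +%R.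
Proof. by move=> a u v; rewrite /rscale scalerDr. Qed.

Let rscaleDl v : {morph rscale^~ v : a b / a + b}.
Proof. by move=> a b; rewrite /rscale scal_embD scalerDl. Qed.

HB.instance Definition _ := GRing.Zmodule_isLmodule.Build K W
  rscaleA rscale1 rscaleDr rscaleDl.

Let radd_continuous : continuous (fun x : W * W => x.1 + x.2).
Proof. exact: (@add_continuous V). Qed.

Let rscale_continuous : continuous (fun z : K^o * W => z.1 *: z.2).
Proof.
move=> [a v]; apply: (@continuous2_cvg _ _ _ _ _ _
  (fun z : K^o * W => (emb z.1 : (baseL R KL)^o)) (fun z : K^o * W => (z.2 : V))
  (fun b (v : V) => b *: v) (emb a) v).
- exact: (@scale_continuous _ V (emb a, v)).
- apply: cvg_comp; [exact: cvg_fst|exact: scal_emb_continuous].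
- exact: cvg_snd.
Qed.

Let rlocally_convex :
  exists2 B : set_system W, (forall b, b \in B -> convex_set b) & basis B.
Proof.
have [B Bconv Bbasis] := @locally_convex _ V.
exists B => // b bB; apply/convex_setP => x y a a0 a1 bx by_.
have /convex_setP/(_ x y (emb a)) := Bconv b bB.
have emb1a : emb (1 - a) = 1 - emb a.
  apply/eqP; rewrite eq_sym subr_eq -scal_embD subrK; apply/eqP.
  by rewrite scal_emb1.
rewrite -emb1a; apply => //; first exact: scal_emb_ge0.
by rewrite -subr_ge0 -emb1a; apply: scal_emb_ge0; rewrite subr_ge0.
Qed.

HB.instance Definition _ :=
  PreTopologicalNmodule_isTopologicalNmodule.Build W radd_continuous.
HB.instance Definition _ :=
  TopologicalNmodule_isTopologicalLmodule.Build K W rscale_continuous.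
HB.instance Definition _ := Uniform_isTvs.Build K W rlocally_convex.

End Restr.

Record dsum (K : pzRingType) (I : Type) (V : I -> lmodType K) := DSum {
  dval :> forall i, V i;
  dval_finite : finite_set [set i | dval i != 0]
}.

Section DsumLmod.
Variables (K : pzRingType) (I : Type) (V : I -> lmodType K).
Implicit Types u v w : dsum V.

Lemma dsum_eq u v : (forall i, u i = v i) -> u = v.
Proof.
case: u v => [u hu] [v hv] /= uv.
have uvE : u = v by apply: functional_extensionality_dep.
by case: _ / uvE hv => hv; congr DSum; exact: Prop_irrelevance.
Qed.

HB.instance Definition _ := gen_eqMixin (dsum V).
HB.instance Definition _ := gen_choiceMixin (dsum V).

Let zero_finite : finite_set [set i | (0 : V i) != 0].
Proof.
by rewrite (_ : [set _ | _] = set0)// -subset0 => i /=; rewrite eqxx.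
Qed.

Let add_finite u v : finite_set [set i | u i + v i != 0].
Proof.
apply: (@sub_finite_set _ _ ([set i | u i != 0] `|` [set i | v i != 0])).
  move=> i /=; have [->|u0 _] := eqVneq (u i) 0; last by left.
  by rewrite add0r; right.
by rewrite finite_setU; split; exact: dval_finite.
Qed.

Let opp_finite u : finite_set [set i | - u i != 0].
Proof.
by apply: sub_finite_set (dval_finite u) => i /=; rewrite oppr_eq0.
Qed.

Let scale_finite (a : K) u : finite_set [set i | a *: u i != 0].
Proof.
apply: sub_finite_set (dval_finite u) => i /=.
by apply: contra => /eqP->; rewrite scaler0.
Qed.

Let dzero := DSum zero_finite.
Let dadd u v := DSum (add_finite u v).
Let dopp u := DSum (opp_finite u).
Let dscale a u := DSum (scale_finite a u).

Let daddA : associative dadd.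
Proof. by move=> u v w; apply: dsum_eq => i /=; rewrite addrA. Qed.

Let daddC : commutative dadd.
Proof. by move=> u v; apply: dsum_eq => i /=; rewrite addrC. Qed.

Let dadd0 : left_id dzero dadd.
Proof. by move=> u; apply: dsum_eq => i /=; rewrite add0r. Qed.

Let daddN : left_inverse dzero dopp dadd.
Proof. by move=> u; apply: dsum_eq => i /=; rewrite addNr. Qed.

HB.instance Definition _ :=
  GRing.isZmodule.Build (dsum V) daddA daddC dadd0 daddN.

Let dscaleA a b v : dscale a (dscale b v) = dscale (a * b) v.
Proof. by apply: dsum_eq => i /=; rewrite scalerA. Qed.

Let dscale1 : left_id 1 dscale.
Proof. by move=> v; apply: dsum_eq => i /=; rewrite scale1r. Qed.

Let dscaleDr : right_distributive dscale +%R.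
Proof. by move=> a u v; apply: dsum_eq => i /=; rewrite scalerDr. Qed.

Let dscaleDl v : {morph dscale^~ v : a b / a + b}.
Proof. by move=> a b; apply: dsum_eq => i /=; rewrite scalerDl. Qed.

HB.instance Definition _ := GRing.Zmodule_isLmodule.Build K (dsum V)
  dscaleA dscale1 dscaleDr dscaleDl.

Lemma dsum0E i : (0 : dsum V) i = 0. Proof. by []. Qed.
Lemma dsumDE u v i : (u + v) i = u i + v i. Proof. by []. Qed.
Lemma dsumNE u i : (- u) i = - u i. Proof. by []. Qed.
Lemma dsumZE a u i : (a *: u) i = a *: u i. Proof. by []. Qed.

(* [mk_dsum f] is junk (namely 0) when [f] does not have finite support. *)
Definition mk_dsum (f : forall i, V i) : dsum V :=
  match pselect (finite_set [set i | f i != 0]) with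
  | left h => DSum h
  | right _ => 0
  end.

Lemma mk_dsumE (f : forall i, V i) i :
  finite_set [set i | f i != 0] -> mk_dsum f i = f i.
Proof. by rewrite /mk_dsum; case: pselect. Qed.

End DsumLmod.

Section DsumMap.
Variables (K : pzRingType) (I : Type) (V W : I -> lmodType K).
Variable f : forall i, {linear V i -> W i}.

Let map_finite (v : dsum V) : finite_set [set i | f i (v i) != 0].
Proof.
apply: sub_finite_set (dval_finite v) => i /=.
by apply: contra => /eqP->; rewrite linear0.
Qed.

Definition dsum_map (v : dsum V) : dsum W := DSum (map_finite v).

Let dsum_map_linear : linear dsum_map.
Proof. by move=> a u v; apply: dsum_eq => i /=; rewrite linearP. Qed.

HB.instance Definition _ :=
  GRing.isLinear.Build K (dsum V) (dsum W) *:%R dsum_map dsum_map_linear.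

End DsumMap.

Section DsumInj.
Variables (K : pzRingType) (I : eqType) (V : I -> lmodType K).

Let inj_finite i (x : V i) :
  finite_set [set j | dfwith (fun j => 0 : V j) i x j != 0].
Proof.
apply: sub_finite_set (finite_set1 i) => j /=.
by have [->//|ij] := eqVneq j i; rewrite dfwithout ?eqxx // eq_sym.
Qed.

Definition dsum_inj i (x : V i) : dsum V := DSum (inj_finite x).

Arguments dsum_inj i x : clear implicits.

Lemma dsum_injE i (x : V i) : dsum_inj i x i = x.
Proof. by rewrite /= dfwithin. Qed.

Lemma dsum_inj_neq i j (x : V i) : i != j -> dsum_inj i x j = 0.
Proof. by move=> ij; rewrite /= dfwithout. Qed.

Lemma dsum_injP a i : {morph dsum_inj i : x y / a *: x + y}.
Proof.
move=> x y; apply: dsum_eq => j; rewrite dsumDE dsumZE.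
have [<-|ij] := eqVneq i j; first by rewrite !dsum_injE.
by rewrite !dsum_inj_neq// scaler0 addr0.
Qed.

Lemma dsum_inj0 i : dsum_inj i 0 = 0.
Proof.
by have := dsum_injP (-1) (0 : V i) 0; rewrite scaler0 addr0 scaleN1r addNr.
Qed.

Lemma dsum_injZ i a (x : V i) : dsum_inj i (a *: x) = a *: dsum_inj i x.
Proof. by rewrite -[LHS](congr1 (dsum_inj i) (addr0 _)) dsum_injP dsum_inj0 addr0. Qed.

Lemma dsum_ind (P : dsum V -> Prop) : P 0 ->
  (forall i (x : V i) v, P v -> P (dsum_inj i x + v)) -> forall v, P v.
Proof.
move=> P0 PS v.
have /finite_seqP[s sE] := dval_finite v.
have vs i : i \notin s -> v i = 0.
  move=> si; apply/eqP; apply/negP => /negP vi.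
  have : [set i | v i != 0] i by [].
  by rewrite sE /= (negPf si).
elim: s {sE} v vs => [|i s IH] v vs.
  by rewrite (_ : v = 0)//; apply: dsum_eq => j; rewrite vs.
rewrite -(subrK (dsum_inj i (v i)) v) addrC; apply: (PS); apply: IH => j js.
rewrite dsumDE dsumNE; have [<-|ij] := eqVneq i j; first by rewrite dsum_injE subrr.
by rewrite dsum_inj_neq// subr0 vs// inE negb_or eq_sym ij.
Qed.

End DsumInj.

Arguments dsum_inj {K I} V i x.
Arguments dsum_inj0 {K I} V i.
Arguments dsum_injZ {K I} V i a x.

Definition abs_convex (K : numDomainType) (V : lmodType K) (W : set V) :=
  W 0 /\ forall (x y : V) (a b : K), `|a| + `|b| <= 1 -> W x -> W y ->
    W (a *: x + b *: y).

(* The locally convex direct sum topology: the finest locally convex topology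
   making all the inclusions continuous. *)
Section DsumTvs.
Variables (K : numFieldType) (I : eqType) (F : I -> tvsType K).
Local Notation D := (dsum F).
Local Notation inj := (@dsum_inj K I (fun i => F i)).

Definition dsum_nbhs0 (W : set D) :=
  abs_convex W /\ forall i, nbhs (0 : F i) (inj i @^-1` W).

Definition dsum_nbhs (x : D) : set_system D :=
  [set A | exists2 W, dsum_nbhs0 W & forall w, W w -> A (x + w)].

HB.instance Definition _ := hasNbhs.Build D dsum_nbhs.

Lemma dsum_nbhs0_setT : dsum_nbhs0 setT.
Proof. by split=> // i; exact: filterT. Qed.

Lemma dsum_nbhs0_setI W1 W2 :
  dsum_nbhs0 W1 -> dsum_nbhs0 W2 -> dsum_nbhs0 (W1 `&` W2).
Proof.
move=> [[W10 W1c] W1n] [[W20 W2c] W2n]; split; last first.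
  by move=> i; exact: filterI.
by split=> // x y a b ab [x1 x2] [y1 y2]; split; [exact: W1c|exact: W2c].
Qed.

Lemma dsum_nbhs0Z (c : K) W : dsum_nbhs0 W -> dsum_nbhs0 [set w | W (c *: w)].
Proof.
move=> [[W0 Wc] Wn]; split; first split; rewrite /= ?scaler0//.
  by move=> x y a b ab Wx Wy /=; rewrite scalerDr !scalerA ![c * _]mulrC -!scalerA; exact: Wc.
move=> i.
have cc : continuous (fun x : F i => c *: x).
  move=> x; apply: (@continuous2_cvg _ _ _ _ _ _ (fun x : F i => (c : K^o))
    id (fun b (v : F i) => b *: v) c x).
  - exact: (@scale_continuous _ (F i) (c, x)).
  - exact: cvg_cst.
  - exact: cvg_id.
have := cc 0 (inj i @^-1` W); rewrite scaler0 => /(_ (Wn i)) cW.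
have sub : (fun x : F i => W (inj i (c *: x))) `<=`
    inj i @^-1` [set w | W (c *: w)].
  move=> x /=.
  by rewrite (dsum_injZ (fun i => F i) i c x).
exact: filterS sub cW.
Qed.

Lemma dsum_nbhs0_half W x y :
  dsum_nbhs0 W -> W (2 *: x) -> W (2 *: y) -> W (x + y).
Proof.
move=> [[_ Wc] _] Wx Wy.
have h : `|2^-1 : K| + `|2^-1 : K| <= 1.
  rewrite ger0_norm ?invr_ge0 ?ler0n//.
  by rewrite [leRHS]splitr !mul1r.
have := Wc _ _ _ _ h Wx Wy; rewrite !scalerA mulVf ?pnatr_eq0// !scale1r.
by [].
Qed.

Lemma dsum_nbhs0_absorb W v : dsum_nbhs0 W ->
  exists2 e : K, 0 < e & forall a, `|a| < e -> W (a *: v).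
Proof.
move=> hW;
elim/(@dsum_ind _ _ F): v W hW => [|i x v IH] W hW.
  by exists 1 => // a _; rewrite scaler0; case: hW => -[].
have hW2 := dsum_nbhs0Z 2 hW.
have [e e0 eW] := IH _ hW2.
have := @scale_continuous _ (F i) (0, x) (inj i @^-1` _).
rewrite /= scale0r => /(_ _ (hW2.2 i)) [[A B] [/= A0 Bx] AB].
have [d d0 dA] : exists2 d : K, 0 < d & forall a, `|a| < d -> A a.
  move: A0; rewrite -nbhs_ballE => -[d /= d0 dA]; exists d => // a ad.
  by apply: dA; rewrite -ball_normE /= sub0r normrN.
have main a : `|a| < d -> `|a| < e -> W (a *: (inj i x + v)).
  move=> ad ae; rewrite scalerDr; apply: dsum_nbhs0_half => //; last exact: eW.
  have := AB (a, x) (conj (dA a ad) (nbhs_singleton Bx)).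
  by rewrite /= (dsum_injZ (fun i => F i) i a x).
have [de|ed] := real_leP (gtr0_real d0) (gtr0_real e0).
  by exists d => // a ad; apply: main => //; exact: lt_le_trans de.
by exists e => // a ae; apply: main => //; exact: lt_trans ed.
Qed.

Let dnbhs_filter (x : D) : ProperFilter (nbhs x).
Proof.
apply: Build_ProperFilter_ex.
  by move=> A [W [[W0 _] _] WA]; exists (x + 0); exact: WA.
split.
- by exists setT; [exact: dsum_nbhs0_setT|].
- move=> A B [W1 hW1 W1A] [W2 hW2 W2B].
  exists (W1 `&` W2); first exact: dsum_nbhs0_setI.
  by move=> w [w1 w2]; split; [exact: W1A|exact: W2B].
- by move=> A B AB [W hW WA]; exists W => // w /WA /AB.
Qed.

Let dnbhs_singleton (x : D) (A : set D) : nbhs x A -> A x.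
Proof. by move=> [W [[W0 _] _] WA]; rewrite -[x]addr0; exact: WA. Qed.

Let dnbhs_nbhs (x : D) (A : set D) : nbhs x A -> nbhs x (nbhs^~ A).
Proof.
move=> [W hW WA]; have hW2 := dsum_nbhs0Z 2 hW.
exists [set w | W (2 *: w)] => // w Ww; exists [set w | W (2 *: w)] => // v Wv.
by rewrite -addrA; apply: WA; exact: dsum_nbhs0_half.
Qed.

HB.instance Definition _ :=
  Nbhs_isNbhsTopological.Build D dnbhs_filter dnbhs_singleton dnbhs_nbhs.

Let dadd_continuous : continuous (fun x : D * D => x.1 + x.2).
Proof.
move=> [x y] A [W hW WA]; have hW2 := dsum_nbhs0Z 2 hW.
exists ([set x + w | w in [set w | W (2 *: w)]],
        [set y + w | w in [set w | W (2 *: w)]]) => /=.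
  by split; exists [set w | W (2 *: w)] => // w Ww; exists w.
move=> [_ _] [/= [u Wu <-] [v Wv <-]]; rewrite addrACA; apply: WA.
exact: dsum_nbhs0_half.
Qed.

Let dscale_continuous : continuous (fun z : K^o * D => z.1 *: z.2).
Proof.
move=> [a x] A [W hW WA] /=; have hW2 := dsum_nbhs0Z 2 hW.
have hW3 := dsum_nbhs0Z (`|a| + 1) hW2.
have [e e0 eW] := dsum_nbhs0_absorb x hW2.
have [d [d0 de d1]] : exists d : K, [/\ 0 < d, d <= e & d <= 1].
  have [e1|e1] := real_leP (gtr0_real e0) (real1 K); first by exists e.
  by exists 1; split=> //; exact: ltW.
exists (ball a d, [set x + w | w in [set w | W (2 *: ((`|a| + 1) *: w))]]) => /=.
  split; first exact: nbhsx_ballx.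
  by exists [set w | W (2 *: ((`|a| + 1) *: w))] => // w Ww; exists w.
move=> [b _] [/= ab [w Ww <-]].
have {}ab : `|b - a| < d by rewrite distrC; move: ab; rewrite -ball_normE.
have -> : b *: (x + w) = a *: x + ((b - a) *: x + b *: w).
  by rewrite scalerBl scalerDr addrA [a *: x + _]addrC subrK.
apply: WA; apply: dsum_nbhs0_half => //.
  by apply: eW; exact: lt_le_trans de.
have c0 : 0 < `|a| + 1 by rewrite ltr_wpDl.
have [[W0 Wc] _] := hW.
have bc : `|b / (`|a| + 1)| + `|0 : K| <= 1.
  rewrite normr0 addr0 normrM normfV (gtr0_norm c0) ler_pdivrMr// mul1r.
  rewrite -[b](subrK a) addrC (le_trans (ler_normD _ _))// lerD2l.
  by apply: ltW; exact: lt_le_trans ab d1.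
have := Wc _ _ _ _ bc Ww W0; rewrite scaler0 addr0; congr W.
rewrite !scalerA; congr (_ *: _).
by rewrite mulrCA divfK ?gt_eqF// mulrC.
Qed.

Let dlocally_convex :
  exists2 B : set_system D, (forall b, b \in B -> convex_set b) & basis B.
Proof.
exists [set b | open b /\ (convex_set b : Prop)].
  by move=> b; rewrite inE => -[].
split; first by move=> b [].
move=> x A [W [[W0 Wc] Wn] WA].
pose C := [set x + w | w in W].
have Cc : forall (u v : D) (a : K), 0 <= a -> a <= 1 -> C u -> C v ->
    C (a *: u + (1 - a) *: v).
  move=> _ _ a a0 a1 [u Wu <-] [v Wv <-].
  exists (a *: u + (1 - a) *: v).
    by apply: Wc => //; rewrite !ger0_norm ?subr_ge0// addrC subrK.
  by rewrite !scalerDr addrACA -scalerDl [a + _]addrC subrK scale1r.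
exists C° => /=.
  split; last first.
    by exists W => // w Ww; exists w.
  split; first exact: open_interior.
  apply/convex_setP => u v a a0 a1 [W1 hW1 W1C] [W2 hW2 W2C].
  exists (W1 `&` W2); first exact: dsum_nbhs0_setI.
  move=> w [w1 w2].
  have -> : a *: u + (1 - a) *: v + w = a *: (u + w) + (1 - a) *: (v + w).
    by rewrite !scalerDr addrACA -scalerDl [a + (1 - a)]addrC subrK scale1r.
  by apply: Cc => //; [exact: W1C|exact: W2C].
by apply: subset_trans (@interior_subset _ _) _ => _ [w Ww <-]; exact: WA.
Qed.

(* This factory only provides the uniform structure. *)
HB.instance Definition _ := PreTopologicalLmod_isTvs.Build K D
  dadd_continuous dscale_continuous dlocally_convex.
HB.instance Definition _ :=
  PreTopologicalNmodule_isTopologicalNmodule.Build D dadd_continuous.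
HB.instance Definition _ :=
  TopologicalNmodule_isTopologicalLmodule.Build K D dscale_continuous.
HB.instance Definition _ := Uniform_isTvs.Build K D dlocally_convex.

End DsumTvs.

Section DirectionalDerivatives.
Variables (K : numFieldType) (X H : tvsType K).
Implicit Types (f : X -> H) (U : set X).

Definition is_dirder f (x v : X) (l : H) : Prop :=
  h^-1 *: (f (h *: v + x) - f x) @[h --> (0 : K^o)^'] --> l.

(* [dirder v f x] is (D_v f)(x); it is junk when that derivative does not
   exist. *)
Definition dirder (v : X) f (x : X) : H := xget 0 [set l | is_dirder f x v l].

(* [iter_dirder f [:: y_1; ...; y_j]] is D_{y_j} ... D_{y_1} f. *)
Fixpoint iter_dirder f (s : seq X) : X -> H :=
  if s is y :: s' then iter_dirder (dirder y f) s' else f.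

(* The values of [f] outside of the open set [U] are irrelevant. *)
Definition is_Cfin (n : nat) U f : Prop :=
  (forall x, U x -> {for x, continuous f}) /\
  forall j, (0 < j <= n)%N ->
    (forall x (s : seq X) v, U x -> (size s).+1 = j ->
      exists l, is_dirder (iter_dirder f s) x v l) /\
    (forall x (y : 'rV[X]_j), U x ->
      {for (x, y), continuous (fun p : X * 'rV[X]_j =>
        iter_dirder f [seq p.2 0 k | k <- enum 'I_j] p.1)}).

End DirectionalDerivatives.

Section ComplexAnalytic.
Variables (K : numFieldType) (X H : preTopologicalLmodType K).

Definition multilinear n (b : ('I_n -> X) -> H) : Prop :=
  forall (xs : 'I_n -> X) (i : 'I_n) (a : K) (u v : X),
    let upd (w : X) : 'I_n -> X := fun k => if k == i then w else xs k in
    b (upd (a *: u + v)) = a *: b (upd u) + b (upd v).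

Definition homog_poly n (p : X -> H) : Prop :=
  exists2 b : ('I_n -> X) -> H, multilinear b & forall x, p x = b (fun=> x).

(* Complex analyticity when [K] is the field of complex numbers: local
   expansions f (x + y) = sum_n p_n y into continuous homogeneous polynomials. *)
Definition power_series_analytic (U : set X) (f : X -> H) : Prop :=
  (forall x, U x -> {for x, continuous f}) /\
  forall x, U x -> exists (W : set X) (p : nat -> X -> H),
    [/\ nbhs 0 W, (forall y, W y -> U (x + y)),
        (forall n, homog_poly n (p n) /\ continuous (p n)) &
        forall y, W y -> (\sum_(k < n) p k y) @[n --> \oo] --> f (x + y)].

End ComplexAnalytic.

(* The complexification X_C; the real space X sits in it as X x {0}. *)
Definition complexify (X : Type) : Type := (X * X)%type.

Section Complexify.
Variables (R : realType) (X : tvsType R).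
Local Notation XC := (complexify X).

HB.instance Definition _ := Topological.copy XC (X * X)%type.
HB.instance Definition _ := GRing.Zmodule.copy XC (X * X)%type.

Let cscale (c : R[i]) (z : XC) : XC :=
  (complex.Re c *: z.1 - complex.Im c *: z.2,
   complex.Im c *: z.1 + complex.Re c *: z.2).

Let cscaleA a b v : cscale a (cscale b v) = cscale (a * b) v.
Proof.
case: a b v => [a1 a2] [b1 b2] [x y]; rewrite /cscale /=; congr pair.
  rewrite !(scalerBr, scalerDr, scalerBl, scalerDl) !scalerA !opprD.
  by rewrite addrACA.
rewrite !(scalerBr, scalerDr, scalerBl, scalerDl) !scalerA addrACA.
by congr (_ + _); rewrite addrC.
Qed.

Let cscale1 : left_id 1 cscale.
Proof.
by move=> [x y]; rewrite /cscale /= !scale1r !scale0r subr0 add0r.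
Qed.

Let cscaleDr : right_distributive cscale +%R.
Proof.
move=> a [x y] [x' y']; rewrite /cscale /=; congr pair => /=.
  by rewrite !scalerDr opprD addrACA.
by rewrite !scalerDr addrACA.
Qed.

Let cscaleDl v : {morph cscale^~ v : a b / a + b}.
Proof.
case: v => x y [a1 a2] [b1 b2]; rewrite /cscale /=; congr pair => /=.
  by rewrite !scalerDl opprD addrACA.
by rewrite !scalerDl addrACA.
Qed.

HB.instance Definition _ := GRing.Zmodule_isLmodule.Build R[i] XC
  cscaleA cscale1 cscaleDr cscaleDl.

End Complexify.

Definition real_analytic (R : realType) (X H : tvsType R)
    (U : set X) (f : X -> H) : Prop :=
  exists (V : set (complexify X)) (g : complexify X -> complexify H),
    [/\ open V, (forall x, U x -> V (x, 0)),
        @power_series_analytic R[i] (complexify X) (complexify H) V g &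
        forall x, U x -> g (x, 0) = (f x, 0)].

Definition is_analytic (R : realType) (KL : scalars) :
    forall X H : tvsType (baseK R KL), set X -> (X -> H) -> Prop :=
  match KL with
  | RR | RC => @real_analytic R
  | CC => fun X H => @power_series_analytic R[i] X H
  end.

Variant smoothness := Cfin of nat | Cinfty | Comega.

Definition is_C (R : realType) (KL : scalars) (r : smoothness)
    (X H : tvsType (baseK R KL)) (U : set X) (f : X -> H) : Prop :=
  match r with
  | Cfin n => is_Cfin n U f
  | Cinfty => forall n, is_Cfin n U f
  | Comega => is_analytic U f
  end.

(* [chart_inv] is only relevant on the image of [chart_dom]. *)
Record chart (T X : Type) := Chart {
  chart_dom : set T;
  chart_fun :> T -> X;
  chart_inv : X -> T
}.

Definition chart_img (T X : Type) (c : chart T X) : set X :=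
  c @` chart_dom c.

Definition is_chart (T X : topologicalType) (c : chart T X) : Prop :=
  [/\ open (chart_dom c), open (chart_img c),
      (forall x, chart_dom c x -> chart_inv c (c x) = x),
      (forall x, chart_dom c x -> {for x, continuous c}) &
      (forall y, chart_img c y -> {for y, continuous (chart_inv c)})].

Definition prod_chart (T1 X1 T2 X2 : Type) (c1 : chart T1 X1) (c2 : chart T2 X2)
  : chart (T1 * T2) (X1 * X2) :=
  {| chart_dom := chart_dom c1 `*` chart_dom c2;
     chart_fun := fun p => (c1 p.1, c2 p.2);
     chart_inv := fun q => (chart_inv c1 q.1, chart_inv c2 q.2) |}.

Definition prod_atlas (T1 X1 T2 X2 : Type)
    (A1 : set (chart T1 X1)) (A2 : set (chart T2 X2))
  : set (chart (T1 * T2) (X1 * X2)) :=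
  [set prod_chart c1 c2 | c1 in A1 & c2 in A2].

Definition model_atlas (X : Type) : set (chart X X) :=
  [set {| chart_dom := setT; chart_fun := id; chart_inv := id |}].

Section Manifolds.
Variables (R : realType) (KL : scalars).
Local Notation K := (baseK R KL).

(* Atlases are not required to be maximal: a manifold structure is an
   equivalence class of atlases, two atlases being equivalent when the identity
   is a diffeomorphism. *)
Definition is_manifold (r : smoothness) (X : tvsType K) (T : topologicalType)
    (A : set (chart T X)) : Prop :=
  [/\ hausdorff_space X, hausdorff_space T,
      (forall c, A c -> is_chart c),
      (forall x, exists2 c, A c & chart_dom c x) &
      (forall c d, A c -> A d ->
        is_C r (c @` (chart_dom c `&` chart_dom d)) (d \o chart_inv c))].

Definition is_Cmap (r : smoothness) (X1 X2 : tvsType K) (T1 T2 : topologicalType)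
    (A1 : set (chart T1 X1)) (A2 : set (chart T2 X2))
    (O : set T1) (f : T1 -> T2) : Prop :=
  (forall x, O x -> {for x, continuous f}) /\
  forall c d, A1 c -> A2 d ->
    is_C r (c @` (chart_dom c `&` O `&` f @^-1` chart_dom d))
           (d \o f \o chart_inv c).

Definition is_diffeo (r : smoothness) (X1 X2 : tvsType K)
    (T1 T2 : topologicalType) (A1 : set (chart T1 X1)) (A2 : set (chart T2 X2))
    (O1 : set T1) (O2 : set T2) (f : T1 -> T2) : Prop :=
  exists g : T2 -> T1,
    [/\ (forall x, O1 x -> O2 (f x) /\ g (f x) = x),
        (forall y, O2 y -> O1 (g y) /\ f (g y) = y),
        is_Cmap r A1 A2 O1 f & is_Cmap r A2 A1 O2 g].

End Manifolds.

Definition finite_dimensional (K : pzRingType) (X : lmodType K) : Prop :=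
  exists n (b : 'I_n -> X), forall x,
    exists a : 'I_n -> K, x = \sum_(k < n) a k *: b k.

Definition k_omega (X : topologicalType) : Prop :=
  hausdorff_space X /\
  (exists C : nat -> set X,
    [/\ (forall n, compact (C n)), (forall n, C n `<=` C n.+1),
        \bigcup_n C n = setT &
        (forall B : set X, compact B -> exists n, B `<=` C n)]) /\
  (forall A : set X,
    closed A <->
    forall B : set X, compact B ->
      exists2 Z : set X, closed Z & A `&` B = Z `&` B).

#[short(type="preTopologicalGroupType")]
HB.structure Definition PreTopologicalGroup := {G of Topological G & Group G}.

Definition is_lie_group (R : realType) (KL : scalars) (s : smoothness)
    (Y : tvsType (baseK R KL)) (G : preTopologicalGroupType)
    (A : set (chart G Y)) : Prop :=
  [/\ is_manifold s A,
      is_Cmap s (prod_atlas A A) A setT (fun p : G * G => (p.1 * p.2)%g) &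
      is_Cmap s A A setT (fun g : G => (g^-1)%g)].

Definition is_action (G : groupType) (T : Type) (a : G -> T -> T) : Prop :=
  (forall x, a 1%g x = x) /\ (forall g h x, a (g * h)%g x = a g (a h x)).

Definition is_Gmanifold (R : realType) (KL : scalars) (r : smoothness)
    (Y X : tvsType (baseK R KL)) (G : preTopologicalGroupType)
    (M : topologicalType) (AG : set (chart G Y)) (AM : set (chart M X))
    (alpha : G -> M -> M) : Prop :=
  [/\ is_manifold r AM, is_action alpha &
      is_Cmap r (prod_atlas AG AM) AM setT (fun p : G * M => alpha p.1 p.2)].

(* A bundle is given by its family of fibres; the total space is their disjoint
   union, with projection [projT1]. *)
Definition total_space (K : pzRingType) (M : Type) (E : M -> lmodType K) : Type :=
  {x : M & E x}.

Section Bundles.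
Variables (R : realType) (KL : scalars).
Local Notation K := (baseK R KL).
Local Notation L := (baseL R KL).

Record total_structure (M : Type) (E : M -> lmodType L) := TotalStructure {
  ts_topology : Topological (total_space E);
  ts_model : tvsType K;
  ts_atlas : set (chart (total_space E) ts_model)
}.

Definition ts_space (M : Type) (E : M -> lmodType L) (S : total_structure E)
  : topologicalType := Topological.Pack (ts_topology S).

Section Bundle.
Variables (r : smoothness) (X : tvsType K) (M : topologicalType).
Variables (AM : set (chart M X)) (F : tvsType L).
Variables (E : M -> lmodType L) (S : total_structure E).

Definition local_triv (U : set M) (psi : total_space E -> M * F) : Prop :=
  [/\ open U,
      @is_diffeo R KL r (ts_model S) (X * restr R KL F)%type
        (ts_space S) (M * restr R KL F)%type
        (@ts_atlas _ _ S) (prod_atlas AM (@model_atlas (restr R KL F)))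
        [set e | U (projT1 e)] (U `*` setT) psi,
      (forall y, U y ->
        psi @` [set e | projT1 e = y] = [set y] `*` [set: F]) &
      (forall y, U y -> linear (fun v : E y => (psi (existT _ y v)).2))].

Definition is_vbundle : Prop :=
  [/\ hausdorff_space F,
      @is_manifold R KL r (ts_model S) (ts_space S) (@ts_atlas _ _ S),
      (forall x, exists e : total_space E, projT1 e = x),
      @is_Cmap R KL r (ts_model S) X (ts_space S) M (@ts_atlas _ _ S) AM
        setT (@projT1 _ _) &
      (forall x, exists U psi, U x /\ local_triv U psi)].

Variables (Y : tvsType K) (G : preTopologicalGroupType).
Variables (AG : set (chart G Y)) (alpha : G -> M -> M).

(* The typing of [beta] expresses that [beta g] maps the fibre over [x] linearly
   into the fibre over [alpha g x]. *)
Definition total_action (beta : forall g x, {linear E x -> E (alpha g x)})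
    (g : G) (e : total_space E) : total_space E :=
  existT _ (alpha g (projT1 e)) (beta g (projT1 e) (projT2 e)).

Definition is_equivariant_vbundle
    (beta : forall g x, {linear E x -> E (alpha g x)}) : Prop :=
  [/\ is_vbundle, is_action (total_action beta) &
      @is_Cmap R KL r (Y * ts_model S)%type (ts_model S)
        (G * ts_space S)%type (ts_space S)
        (prod_atlas AG (@ts_atlas _ _ S)) (@ts_atlas _ _ S) setT
        (fun p => total_action beta p.1 p.2)].

End Bundle.

Definition same_structure (r : smoothness) (M : Type) (E : M -> lmodType L)
    (S S' : total_structure E) : Prop :=
  @is_diffeo R KL r (ts_model S) (ts_model S') (ts_space S) (ts_space S')
    (@ts_atlas _ _ S) (@ts_atlas _ _ S') setT setT id.

Section SumBundle.
Variables (I : eqType) (M : topologicalType) (E : I -> M -> lmodType L).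

Definition sum_fibre (x : M) : lmodType L := dsum (fun i => E i x).

(* Finite supports are only guaranteed, by linearity on the fibres, over the
   open set on which all the [psi i] are local trivializations. *)
Definition sum_triv (F : I -> tvsType L) (psi : forall i, total_space (E i) -> M * F i)
    (e : total_space sum_fibre) : M * dsum F :=
  (projT1 e,
   mk_dsum (fun i => (psi i (existT _ (projT1 e) (projT2 e i))).2)).

Definition sum_compatible (r : smoothness) (X : tvsType K)
    (AM : set (chart M X)) (F : I -> tvsType L)
    (S : forall i, total_structure (E i)) (T : total_structure sum_fibre)
  : Prop :=
  forall (U : set M) (psi : forall i, total_space (E i) -> M * F i), open U ->
    (forall i, local_triv r AM (S i) U (psi i)) ->
    local_triv r AM T U (sum_triv psi).

Definition sum_action (G : Type) (alpha : G -> M -> M)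
    (beta : forall i g x, {linear E i x -> E i (alpha g x)})
    (g : G) (x : M) : {linear sum_fibre x -> sum_fibre (alpha g x)} :=
  dsum_map (fun i => beta i g x).

End SumBundle.

End Bundles.

(* Main.v *)
(* In local trivializations, the transition maps and the action of the direct sum
   are maps (z, (v_i)_i) |-> (f_i(z, v_i))_i, with f_i of class C^r and linear in
   v_i, and z in an open subset of the modelling space of M or of G x M; the point
   is that such a map is C^r on the direct sum. Its tangent map has the same shape,
   over Z x Z and with fibres F_i x F_i, so by induction only continuity matters.
   As f(z, .) is linear, the w with f(z, w) in W for all z in P form an absolutely
   convex set whenever W is absolutely convex; hence continuity at (z_0, 0) only
   requires one neighbourhood P of z_0 and, for each i, a 0-neighbourhood V_i with
   f_i(P x V_i) contained in the i-th section of W. In finite dimension P can be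
   taken compact. In the k_omega case, P and the V_i are unions of increasing
   sequences of compact sets, built simultaneously with the tube lemma.

   Charts of G are never changed, so that no comparison between C^omega and
   C^infty is needed for G. *)
Require Import Defs.
From HB Require Import structures.
From mathcomp Require Import all_boot all_order all_algebra.
From mathcomp Require Import all_classical all_reals.
From mathcomp Require Import interval_inference topology convex normedtype.
From mathcomp.real_closed Require Import complex.
Set Implicit Arguments.
Unset Strict Implicit.
Unset Printing Implicit Defensive.
Import Order.TTheory GRing.Theory Num.Theory.
Import numFieldNormedType.Exports.
Local Open Scope classical_set_scope.
Local Open Scope ring_scope.

(** * Tubes around compact sets *)

(** The class [is_Cfin] speaks of iterated directional derivatives, whereas the induction over
    tangent maps runs over [Ctan]. The harder half of their equivalence expands every iterated
    derivative of the map sending (x, y) to (D_y f)(x) into iterated derivatives of [f]. It rests on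
    linearity of derivatives in the direction taken first, hence on a mean value theorem, obtained
    from completeness of the real line and convexity instead of continuous functionals. In the
    k_omega case the tubes over a common P become a single tube over the disjoint union of the F_i,
    around the set of base points, which is closed but in general not compact. The same tube
    construction shows that the product topology of two such spaces is again determined by an
    exhausting sequence of compact sets, as the passage to Z x Z and F_i x F_i demands. Two scalar
    fields occur at once: derivatives are taken over K, but tangent maps must stay L-linear on the
    fibres; this already holds for the difference quotients. *)

Lemma compact_tube (X Y : topologicalType) (A : set X) (B : set Y)
    (O : set (X * Y)) :
  compact A -> compact B -> open O -> A `*` B `<=` O ->
  exists A' B', [/\ open A', open B', A `<=` A', B `<=` B' & A' `*` B' `<=` O].
Proof.
move=> /compact_near_coveringP cA /compact_near_coveringP cB oO ABO.
(* For empty [B] the neighbourhoods of [B] would form an improper filter, so this case is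
   separated. *)
have [->|/set0P[b0 Bb0]] := eqVneq B set0.
  by exists setT, set0; split=> //; [exact: openT|exact: open0|case=> x y []].
pose Bs := [set V : set Y | B `<=` V°].
have FBs : ProperFilter Bs.
  by apply: (@Build_ProperFilter _ Bs); move/(_ b0 Bb0)/interior_subset.
(* The tube over a single point [a]: compactness of [B] is used with the small neighbourhoods of [a]
   as auxiliary filter. *)
have step1 a : A a -> filter_prod (nbhs a) Bs O.
  move=> Aa; have := cB _ (powerset_filter_from (nbhs a))
    (fun P y => nbhs y [set y' | P `<=` [set a' | O (a', y')]]).
  case.
    move=> y By; have Oay : nbhs (a, y) O by apply: open_nbhs_nbhs; split=> //;
      exact: ABO.
    case: Oay => -[P Q] /= [Pa Qy] PQO.
    near=> y' P' => /=.
    have Qy' : nbhs y' Q by near: y'; exact: nbhs_interior.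
    have P'P : P' `<=` P by near: P'; exact: small_set_sub.
    by apply: filterS Qy' => y'' Qy'' a' P'a'; apply: PQO; split => //=; exact: P'P.
  move=> Ps [/= Psa _ [P PsP]] /(_ _ PsP) BP.
  exists (P, [set y' | P `<=` [set a' | O (a', y')]]) => /=.
    by split; [exact: Psa|].
  by move=> [a' y'] [/= Pa' /(_ _ Pa')].
(* Now [a] runs over [A], with the small neighbourhoods of [B] as auxiliary filter. *)
have := cA _ (powerset_filter_from Bs)
    (fun V a => nbhs a [set a' | V `<=` [set y | O (a', y)]]).
case.
  move=> a Aa; have [[P Q] [/= Pa BsQ] PQO] := step1 _ Aa.
  near=> a' V => /=.
  have Pa' : nbhs a' P by near: a'; exact: nbhs_interior.
  have VQ : V `<=` Q by near: V; exact: small_set_sub.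
  by apply: filterS Pa' => a'' Pa'' y Vy; apply: (PQO (a'', y)); split => //=;
    exact: VQ.
move=> Vs [/= VsB _ [V VsV]] /(_ _ VsV) AV.
exists ([set a' | V `<=` [set y | O (a', y)]]°), V°; split => //.
- exact: open_interior.
- exact: open_interior.
- exact: VsB.
- by move=> [a y] [/= /interior_subset aV /interior_subset]; exact: aV.
Unshelve. all: by end_near. Qed.

Lemma hausdorff_separate (X : topologicalType) (x y : X) :
  hausdorff_space X -> x <> y ->
  exists A B, [/\ open A, open B, A x, B y & forall z, A z -> B z -> False].
Proof.
rewrite open_hausdorff => hX /eqP xy.
have [[A B] /= [/set_mem Ax /set_mem By]] := hX _ _ xy.
move=> [oA oB /eqP AB0]; exists A, B; split => // z Az Bz.
by have : (A `&` B) z by []; rewrite AB0.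
Qed.

Lemma hausdorff_sep (X : topologicalType) :
  (forall x y : X, x <> y -> exists A B, [/\ nbhs x A, nbhs y B &
     forall z, A z -> B z -> False]) -> hausdorff_space X.
Proof.
move=> h x y cxy; apply: contrapT => /h [A [B [Ax By AB]]].
by have [z [Az Bz]] := cxy _ _ Ax By; exact: (AB z).
Qed.

Lemma prod_hausdorff (X Y : topologicalType) :
  hausdorff_space X -> hausdorff_space Y -> hausdorff_space (X * Y)%type.
Proof.
move=> hX hY; apply: hausdorff_sep => -[x y] [x' y'] ne.
have [xx|xx] := pselect (x = x').
  have /hausdorff_separate : y <> y' by move=> yy; apply: ne; rewrite xx yy.
  case/(_ hY) => A [B [oA oB Ay By AB]].
  exists (setT `*` A), (setT `*` B); split.
  - by exists (setT, A) => //; split=> /=; [exact: filterT|exact: open_nbhs_nbhs].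
  - by exists (setT, B) => //; split=> /=; [exact: filterT|exact: open_nbhs_nbhs].
  - by move=> [z w] [_ Aw] [_ Bw]; exact: (AB w).
have [A [B [oA oB Ay By AB]]] := hausdorff_separate hX xx.
exists (A `*` setT), (B `*` setT); split.
- by exists (A, setT) => //; split=> /=; [exact: open_nbhs_nbhs|exact: filterT].
- by exists (B, setT) => //; split=> /=; [exact: open_nbhs_nbhs|exact: filterT].
- by move=> [z w] [Aw _] [Bw _]; exact: (AB z).
Qed.

(** The tube lemma applied to the complement of the diagonal, which is open in a Hausdorff space. *)
Lemma compact_separate (X : topologicalType) (A B : set X) :
  hausdorff_space X -> compact A -> compact B -> A `&` B = set0 ->
  exists A' B', [/\ open A', open B', A `<=` A', B `<=` B' & A' `&` B' = set0].
Proof.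
move=> hX cA cB AB0.
have oO : open [set p : X * X | p.1 <> p.2].
  rewrite openE => -[x y] /= /(hausdorff_separate hX) [P [Q [oP oQ Px Qy PQ]]].
  exists (P, Q); first by split; exact: open_nbhs_nbhs.
  by move=> [z w] /= [Pz Qw] zw; apply: (PQ z) => //; rewrite zw.
have [|A' [B' [oA' oB' AA' BB' ABO]]] := compact_tube cA cB oO.
  move=> [x y] /= [Ax By] xy.
  by have : (A `&` B) x; [split=> //; rewrite xy|rewrite AB0].
exists A', B'; split => //; rewrite -subset0 => x [A'x B'x].
exact: (ABO (x, x)).
Qed.

(** * Exhaustions of k_omega-spaces by compact sets *)

(** Separating [P] from the part of [K] outside [A] yields a compact relative neighbourhood inside
    [K]. The open set [P1] witnesses the neighbourhood property, so that increasing unions of such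
    sets can later be recognized as open. *)
Lemma compact_shrink (X : topologicalType) (K P A : set X) :
  hausdorff_space X -> compact K -> compact P -> open A -> P `<=` A ->
  exists P1 P', [/\ open P1, compact P', P `<=` P1, P1 `&` K `<=` P' &
    P' `<=` A `&` K].
Proof.
move=> hX cK cP oA PA.
have cKA : compact (K `&` ~` A).
  by apply: compact_closedI => //; exact: open_closedC.
have [|P1 [P2 [oP1 oP2 PP1 KP2 P120]]] := compact_separate hX cP cKA.
  by rewrite -subset0 => x [Px [_ Ax]]; exact/Ax/PA.
exists P1, (K `&` ~` P2); split => //.
- by apply: compact_closedI => //; exact: open_closedC.
- move=> x [P1x Kx]; split=> // P2x.
  by have : (P1 `&` P2) x by []; rewrite P120.
- by move=> x [Kx P2x]; split=> //; apply: contrapT => Ax; exact/P2x/KP2.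
Qed.

(** The direct limit form of a k_omega-space: openness is tested along one increasing sequence of
    compact sets, relative openness in [C n] being expressed pointwise. *)
Definition k_exhaustion (X : topologicalType) (C : nat -> set X) : Prop :=
  [/\ hausdorff_space X, (forall n, compact (C n)), (forall n, C n `<=` C n.+1),
    (forall x, exists n, C n x) &
    forall A : set X, (forall n x, A x -> C n x ->
      \forall y \near x, C n y -> A y) -> open A].

Lemma k_exhaustion_mono (X : topologicalType) (C : nat -> set X) m n :
  k_exhaustion C -> (m <= n)%N -> C m `<=` C n.
Proof.
move=> [_ _ CS _ _] /subnK<-; elim: (n - m)%N => // k IH x /IH; rewrite addSn.
exact: CS.
Qed.

(** Hemicompactness places every compact set in some [C n], so the test for closedness over all
    compact sets follows from openness relative to the [C n]. *)
Lemma k_omega_kexh (X : topologicalType) :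
  k_omega X -> exists C : nat -> set X, k_exhaustion C.
Proof.
move=> [hX [[C [cC CS CT Chemi]] clX]]; exists C; split => //.
  by move=> x; have : setT x by []; rewrite -CT => -[n _ Cx]; exists n.
move=> A hA; rewrite -[A]setCK; apply: closed_openC; apply/clX => B cB.
have [n Bn] := Chemi _ cB.
exists (~` [set y | C n y -> A y]°); first exact/open_closedC/open_interior.
rewrite predeqE => x; split => -[Ax Bx]; split=> //.
  by move/interior_subset => /(_ (Bn _ Bx)).
by move=> A'x; apply: Ax; apply: hA => //; exact: Bn.
Qed.

(** Dropping finitely many terms puts a given point into the initial compact set, where the
    inductive construction of tubes starts. *)
Lemma k_exhaustion_shift (X : topologicalType) (C : nat -> set X) k :
  k_exhaustion C -> k_exhaustion (fun n => C (n + k)%N).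
Proof.
move=> hC; have [hX cC CS CT oX] := hC; split => //.
  move=> x; have [n Cnx] := CT x; exists n.
  by apply: (k_exhaustion_mono hC) Cnx; exact: leq_addr.
move=> A hA; apply: oX => n x Ax Cx.
have := hA n x Ax (k_exhaustion_mono hC (leq_addr k n) Cx).
by apply: filterS => y h Cy; apply: h; exact: (k_exhaustion_mono hC (leq_addr k n)).
Qed.

Section Tube.
Variables (X F : topologicalType) (C : nat -> set X) (D : nat -> set F).
Hypotheses (hC : k_exhaustion C) (hD : k_exhaustion D).
Variables (Om : set X) (S : set F) (O : set (X * F)) (z0 : X).
Hypotheses (oOm : open Om) (Omz0 : Om z0) (cS : closed S) (OmS : Om `*` S `<=` O).
Hypothesis kO : forall n x y, O (x, y) -> C n x -> D n y ->
  \forall q \near (x, y), C n q.1 -> D n q.2 -> O q.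

(** By [kO] the set [O] is open only relative to each [C n] x [D n], so a compact product inside [O]
    is enlarged one stage at a time. The relation [rel] puts each set into the interior of the next
    one, relative to stage [n.+1]. *)
Let inv (n : nat) (s : set X * set F) :=
  [/\ compact s.1 /\ compact s.2, s.1 z0, s.1 `<=` Om `&` C n,
    S `&` D n `<=` s.2 /\ s.2 `<=` D n & s.1 `*` s.2 `<=` O].

Let rel (n : nat) (s s' : set X * set F) :=
  (exists P1, [/\ open P1, s.1 `<=` P1 & P1 `&` C n.+1 `<=` s'.1]) /\
  (exists P1, [/\ open P1, s.2 `<=` P1 & P1 `&` D n.+1 `<=` s'.2]).

Let tube_step n s : inv n s -> exists s', inv n.+1 s' /\ rel n s s'.
Proof.
case: s => P V [/= [cP cV] Pz0 POm [SV VD] PVO].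
have [hX cC CS CT oX] := hC; have [hF cD DS DT oF] := hD.
(* [S] need not be compact, so its points in [D n.+1] are added at this stage. As [P] stays inside
   [Om], the product of [P] and [B] still lies in [O]. *)
pose B := V `|` (D n.+1 `&` S).
have cB : compact B by apply: compactU => //; exact: compact_closedI.
have BD : B `<=` D n.+1 by move=> y [/VD/DS|[]].
have PC : P `<=` C n.+1 by move=> x /POm[_ /CS].
pose Os := [set q : X * F | C n.+1 q.1 -> D n.+1 q.2 -> O q]°.
have PBO : P `*` B `<=` Os.
  move=> [x y] [/= Px By]; apply: kO; [|exact: PC|exact: BD].
  case: By => [Vy|[_ Sy]]; first exact: PVO.
  by apply: OmS; split=> //=; case: (POm _ Px).
have [A' [B' [oA' oB' PA' BB' ABO]]] :=
  compact_tube cP cB (@open_interior _ _) PBO.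
have [|P1 [P' [oP1 cP' PP1 P1C P'A]]] :=
    compact_shrink hX (cC n.+1) cP (openI oA' oOm).
  by move=> x Px; split; [exact: PA'|case: (POm _ Px)].
have [V1 [V' [oV1 cV' BV1 V1D V'B]]] := compact_shrink hF (cD n.+1) cB oB' BB'.
exists (P', V'); split; last first.
  split; first by exists P1.
  by exists V1; split=> // y Vy; apply: BV1; left.
split => //=.
- by apply: P1C; split; [exact: PP1|exact: PC].
- by move=> x /P'A[[]].
- split; last by move=> y /V'B[].
  by move=> y [Sy Dy]; apply: V1D; split=> //; apply: BV1; right.
- move=> [x y] [/= /P'A[[A'x _] Cx] /V'B[B'y Dy]].
  by have /interior_subset := ABO (x, y) (conj A'x B'y); apply.
Qed.

Lemma k_exhaustion_tube0 : C 0%N z0 ->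
  exists P V, [/\ open P, open V, P z0, S `<=` V & P `*` V `<=` O].
Proof.
move=> C0z0; have [hX cC CS CT oX] := hC; have [hF cD DS DT oF] := hD.
(* Totalized for the choice: where the invariant fails, the pair is repeated and nothing is
   claimed. *)
have /choice[f fP] : forall ns : nat * (set X * set F), exists s',
    inv ns.1 ns.2 -> inv ns.1.+1 s' /\ rel ns.1 ns.2 s'.
  move=> [n s]; have [/tube_step[s' h]|h] := pselect (inv n s).
    by exists s' => _.
  by exists s => /h.
pose s := fix s n := if n is m.+1 then f (m, s m) else ([set z0], S `&` D 0%N).
have invs n : inv n (s n).
  elim: n => [|n IH]; last by have [] := fP (n, s n) IH.
  split => //=.
  - split; first exact: compact_set1.
    by rewrite setIC; exact: compact_closedI.
  - by move=> _ ->.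
  - by split=> // y [].
  - by move=> [x y] [/= -> [Sy _]]; exact: OmS.
have rels n : rel n (s n) (s n.+1) by have [] := fP (n, s n) (invs n).
have s1S n : (s n).1 `<=` (s n.+1).1.
  move=> x sx; have [[P1 [_ sP1 P1s]] _] := rels n; apply: P1s; split.
    exact: sP1.
  by have [_ _ /(_ x sx)[_ /CS sxC] _ _] := invs n.
have s2S n : (s n).2 `<=` (s n.+1).2.
  move=> x sx; have [_ [P1 [_ sP1 P1s]]] := rels n; apply: P1s; split.
    exact: sP1.
  by have [_ _ _ [_ /(_ x sx)/DS sxD] _] := invs n.
have s1M m n : (m <= n)%N -> (s m).1 `<=` (s n).1.
  by move=> /subnK<-; elim: (n - m)%N => // k IH x /IH; exact: s1S.
have s2M m n : (m <= n)%N -> (s m).2 `<=` (s n).2.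
  by move=> /subnK<-; elim: (n - m)%N => // k IH x /IH; exact: s2S.
exists (\bigcup_n (s n).1), (\bigcup_n (s n).2); split.
(* Openness is tested on [C n]: by [rel], points of [C n] near [x] lie in the set number [N.+1],
   where [N] dominates both [m] and [n]. *)
- apply: oX => n x [m _ smx] Cx; pose N := maxn m n.
  have [[P1 [oP1 sP1 P1s]] _] := rels N.
  have : nbhs x P1.
    by apply: open_nbhs_nbhs; split=> //; apply/sP1/(s1M m); rewrite ?leq_maxl.
  apply: filterS => y P1y Cy; exists N.+1 => //; apply: P1s; split=> //.
  by apply: (k_exhaustion_mono hC) Cy; rewrite (leq_trans (leq_maxr m n)).
- apply: oF => n x [m _ smx] Cx; pose N := maxn m n.
  have [_ [P1 [oP1 sP1 P1s]]] := rels N.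
  have : nbhs x P1.
    by apply: open_nbhs_nbhs; split=> //; apply/sP1/(s2M m); rewrite ?leq_maxl.
  apply: filterS => y P1y Cy; exists N.+1 => //; apply: P1s; split=> //.
  by apply: (k_exhaustion_mono hD) Cy; rewrite (leq_trans (leq_maxr m n)).
- by exists 0%N.
- move=> y Sy; have [n Dy] := DT y; exists n => //.
  by have [_ _ _ [SD _] _] := invs n; exact: SD.
- move=> [x y] [/= [m _ mx] [n _ ny]].
  have [_ _ _ _ sO] := invs (maxn m n); apply: sO; split=> /=.
    by apply: s1M mx; exact: leq_maxl.
  by apply: s2M ny; exact: leq_maxr.
Qed.

End Tube.

Lemma k_exhaustion_tube (X F : topologicalType) (C : nat -> set X) (D : nat ->
  set F)
    (Om : set X) (S : set F) (O : set (X * F)) (z0 : X) :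
  k_exhaustion C -> k_exhaustion D -> open Om -> Om z0 -> closed S -> Om `*` S
    `<=` O ->
  (forall n x y, O (x, y) -> C n x -> D n y ->
    \forall q \near (x, y), C n q.1 -> D n q.2 -> O q) ->
  exists P V, [/\ open P, open V, P z0, S `<=` V & P `*` V `<=` O].
Proof.
move=> hC hD oOm Omz0 cS OmS kO; have [_ _ _ /(_ z0)[k Ck] _] := hC.
apply: (k_exhaustion_tube0 (k_exhaustion_shift k hC) (k_exhaustion_shift k hD)
  oOm Omz0 cS OmS _ Ck).
by move=> n x y; exact: kO.
Qed.

(** Only the last clause is substantial: relative openness on all [C n] x [D n] has to produce
    product neighbourhoods. The slice of [O] at height [y] is open in [X], and a tube around the
    singleton of [y] over this slice provides one. *)
Lemma k_exhaustion_prod (X F : topologicalType) (C : nat -> set X) (D : nat ->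
  set F) :
  k_exhaustion C -> k_exhaustion D -> k_exhaustion (fun n => C n `*` D n).
Proof.
move=> hC hD; have [hX cC CS CT oX] := hC; have [hF cD DS DT oF] := hD; split.
- exact: prod_hausdorff.
- by move=> n; exact: compact_setX.
- by move=> n [x y] [/= /CS ? /DS].
- move=> [x y]; have [n Cx] := CT x; have [m Dy] := DT y; exists (maxn n m).
  split=> /=; first by apply: (k_exhaustion_mono hC) Cx; exact: leq_maxl.
  by apply: (k_exhaustion_mono hD) Dy; exact: leq_maxr.
move=> O hO; rewrite openE => -[x y] Oxy.
have oOy : open [set x' | O (x', y)].
  apply: oX => n x' Ox' Cx'; have [m Dy] := DT y.
  have Cx2 : C (maxn n m) x' by apply: (k_exhaustion_mono hC) Cx'; exact: leq_maxl.
  have Dy2 : D (maxn n m) y by apply: (k_exhaustion_mono hD) Dy; exact: leq_maxr.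
  have [[P Q] /= [Px' Qy] PQ] := hO _ _ Ox' (conj Cx2 Dy2).
  apply: filterS Px' => x'' Px'' Cx''; apply: (PQ (x'', y)).
    by split=> //=; exact: nbhs_singleton.
  by split=> //=; apply: (k_exhaustion_mono hC) Cx''; exact: leq_maxl.
have cy : closed [set y] by apply: (compact_closed hF); exact: compact_set1.
have [|n x' y' Oxy' Cx' Dy'|P [V [oP oV Px Vy PVO]]] :=
    @k_exhaustion_tube _ _ _ _ _ [set y] O x hC hD oOy Oxy cy.
- by move=> [a b] [/= Oa ->].
- have := hO n (x', y') Oxy' (conj Cx' Dy').
  by apply: filterS => q h Cq Dq; apply: h.
exists (P, V); first by split; apply: open_nbhs_nbhs; split=> //; exact: Vy.
exact: PVO.
Qed.

(** The [n]-th compact set takes only the summands with code below [n], finitely many by injectivity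
    of [code], and from each of them the [n]-th compact set. *)
Lemma k_exhaustion_sigT (I : choiceType) (F : I -> topologicalType)
    (D : forall i, nat -> set (F i)) :
  countable [set: I] -> (forall i, k_exhaustion (D i)) -> exists C,
    @k_exhaustion {i & F i} C.
Proof.
move=> /countable_injP[code code_inj] hD.
have {}code_inj i j : code i = code j -> i = j.
  by move=> ij; apply: code_inj => //; rewrite inE.
pose E n m := [set s : {i & F i} | (code (projT1 s) < m)%N /\
   D (projT1 s) n (projT2 s)].
have cE n m : compact (E n m).
  elim: m => [|m IH].
    rewrite (_ : E n 0%N = set0); first exact: compact0.
    by rewrite -subset0 => s [].
  have [[i ci]|h] := pselect (exists i, code i = m).
    rewrite (_ : E n m.+1 = E n m `|` existT F i @` D i n).
      apply: compactU => //; apply: continuous_compact; last by case: (hD i).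
      by apply: continuous_subspaceT; exact: existT_continuous.
    rewrite predeqE => s; split=> [|[[cj Ds]|[y' Dy' <-]]].
    - case: s => j y [/=].
      rewrite ltnS leq_eqVlt => /orP[/eqP|] cj Dy; last by left.
      right; have ji : i = j by apply: code_inj; rewrite cj.
      by subst j; exists y.
    - by split=> //=; exact: ltnW.
    - by split=> //=; rewrite ci.
  rewrite (_ : E n m.+1 = E n m)// predeqE => -[j y]; split=> -[/=].
    rewrite ltnS leq_eqVlt => /orP[/eqP cj|cj Dy]; last by split.
    by exfalso; apply: h; exists j.
  by move=> cj Dy; split=> //=; exact: ltnW.
exists (fun n => E n n); split => //.
- by apply: sigT_hausdorff => i; case: (hD i).
- move=> n [i y] [/= ci Dy]; split=> /=; first exact: ltnW.
  by apply: (k_exhaustion_mono (hD i)) Dy.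
- move=> [i y]; have [_ _ _ /(_ y)[n Dy] _] := hD i.
  exists (maxn n (code i).+1); split=> /=; first by rewrite leq_maxr.
  by apply: (k_exhaustion_mono (hD i)) Dy; exact: leq_maxl.
- move=> A hA; apply/sigT_openP => i; have [_ _ _ _ oF] := hD i.
  apply: oF => n x /= Ax Dx; pose N := maxn n (code i).+1.
  have EN y : D i n y -> E N N (existT _ i y).
    move=> Dy; split=> /=; first by rewrite leq_maxr.
    by apply: (k_exhaustion_mono (hD i)) Dy; exact: leq_maxl.
  have h0 : nbhs x (existT _ i @^-1` [set y | E N N y -> A y]).
    by apply: (@existT_continuous _ F i x); apply: hA => //; exact: EN.
  by apply: filterS h0 => y h /EN; exact: h.
Qed.

Definition k_exhaustible (X : topologicalType) := exists C : nat -> set X,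
  k_exhaustion C.

Lemma k_exhaustible_prod (X Y : topologicalType) : k_exhaustible X ->
  k_exhaustible Y -> k_exhaustible (X * Y)%type.
Proof. by move=> [C hC] [D hD]; eexists; exact: k_exhaustion_prod hC hD. Qed.

Lemma k_exhaustible_family_tube (Z : topologicalType) (I : Type)
    (F : I -> topologicalType) (p : forall i, F i) (Om : set Z)
    (O : forall i, set (Z * F i)) (z0 : Z) :
  k_exhaustible Z -> countable [set: I] -> (forall i, k_exhaustible (F i)) ->
  open Om -> Om z0 -> (forall i z, Om z -> nbhs (z, p i) (O i)) ->
  exists2 P, nbhs z0 P & forall i, exists2 V, nbhs (p i) V &
    forall z v, P z -> V v -> O i (z, v).
Proof.
move=> [C hC] cI kF oOm Omz0 hO.
pose D i := projT1 (cid (kF i)).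
have hD i : k_exhaustion (D i) by exact: projT2 (cid (kF i)).
(* The index type is a bare type; [classic] equips it with the choice structure required for the
   disjoint union. *)
have [E hE] := @k_exhaustion_sigT {classic I} F D cI hD.
pose OO := [set q : Z * {i : {classic I} & F i} |
  (O (projT1 q.2))° (q.1, projT2 q.2)].
pose S := [set s : {i : {classic I} & F i} | projT2 s = p (projT1 s)].
have oOO : open OO.
  rewrite openE => -[z [i v]]; rewrite /OO /= => Ozv.
  have [[A B] /= [Az Bv] AB] := nbhs_interior Ozv.
  exists (A, existT _ i @` B) => /=; first by split=> //; exact: existT_nbhs.
  by move=> [z' s] [/= Az' [v' Bv' <-]]; apply: (AB (z', v')).
have cS : closed S.
  rewrite -[S]setCK; apply: open_closedC; apply/sigT_openP => i.
  have -> : existT _ i @^-1` (~` S) = ~` [set p i] by [].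
  have [hF _ _ _ _] := hD i.
  by apply: closed_openC; apply: (compact_closed hF); exact: compact_set1.
have [||P [V [oP oV Pz0 SV PVO]]] := @k_exhaustion_tube _ _ _ _ Om S OO z0 hC
  hE oOm Omz0 cS.
- move=> [z [i v]] [/= Omz Sv]; rewrite /S /= in Sv; rewrite /OO /= Sv.
  exact: hO.
- move=> n z s Ozs _ _; have : nbhs (z, s) OO by apply: open_nbhs_nbhs.
  by apply: filterS => q Oq _ _.
exists P; first by apply: open_nbhs_nbhs.
move=> i; exists (existT _ i @^-1` V).
  by apply: open_nbhs_nbhs; split; [move/sigT_openP: oV; exact|exact: SV].
move=> z v Pz Vv.
by have /interior_subset := PVO (z, existT _ i v) (conj Pz Vv).
Qed.

(** The compact set around [z0] is fixed before the index [i]: regularity of a uniform space keeps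
    it inside [Om], and its compactness yields a separate [V] for each [i]. *)
Lemma lc_family_tube (Z : uniformType) (I : Type)
    (F : I -> topologicalType) (p : forall i, F i) (Om K : set Z)
    (O : forall i, set (Z * F i)) (z0 : Z) :
  compact K -> nbhs z0 K ->
  open Om -> Om z0 -> (forall i z, Om z -> nbhs (z, p i) (O i)) ->
  exists2 P, nbhs z0 P & forall i, exists2 V, nbhs (p i) V &
    forall z v, P z -> V v -> O i (z, v).
Proof.
move=> cK Kz0 oOm Omz0 hO.
have [A Az0 AOm] : filter_from (nbhs z0) closure Om.
  by apply: uniform_regular; exact: open_nbhs_nbhs.
have cKA : compact (K `&` closure A).
  by apply: compact_closedI => //; exact: closed_closure.
exists (K `&` closure A).
  by apply: filterI => //; apply: filterS Az0; exact: subset_closure.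
move=> i; have /compact_near_coveringP cov := cKA.
have h : \forall v \near p i, (K `&` closure A) `<=` (fun z => O i (z, v)).
  apply: (cov _ (nbhs (p i)) (fun v z => O i (z, v))).
  by move=> z [Kz /AOm Omz]; apply: filterS (hO i z Omz) => -[].
by exists [set v | (K `&` closure A) `<=` (fun z => O i (z, v))] => // z v KAz;
  exact.
Qed.

(** * Local compactness of finite-dimensional spaces *)

Lemma min_pos (K : numDomainType) (d e : K) : 0 < d -> 0 < e ->
  exists m : K, [/\ 0 < m, m <= d & m <= e].
Proof.
move=> d0 e0; have [de|ed] := real_leP (gtr0_real d0) (gtr0_real e0).
  by exists d.
by exists e; split=> //; exact: ltW.
Qed.

Lemma nbhs0_ball (K : numFieldType) (A : set K^o) : nbhs (0 : K^o) A ->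
  exists2 d : K, 0 < d & forall a, `|a| < d -> A a.
Proof.
rewrite -nbhs_ballE => -[d /= d0 dA]; exists d => // a ad.
by apply: dA; rewrite -ball_normE /= sub0r normrN.
Qed.

Lemma tvs_cvgD (K : numDomainType) (V : tvsType K) (T : Type)
    (Fl : set_system T) (FF : Filter Fl) (f g : T -> V) (a b : V) :
  f @ Fl --> a -> g @ Fl --> b -> (fun t => f t + g t) @ Fl --> a + b.
Proof.
move=> fa gb; apply: (@continuous2_cvg _ _ _ _ _ _ f g (fun u v : V => u + v) a
  b) => //.
exact: (@add_continuous V (a, b)).
Qed.

Lemma tvs_cvgZ (K : numFieldType) (V : tvsType K) (T : Type)
    (Fl : set_system T) (FF : Filter Fl) (c : T -> K) (g : T -> V) (a : K) (b : V) :
  c @ Fl --> (a : K^o) -> g @ Fl --> b -> (fun t => c t *: g t) @ Fl --> a *: b.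
Proof.
move=> fa gb.
apply: (@continuous2_cvg _ _ _ _ _ _ (c : T -> K^o) g (fun (u : K^o) (v : V) =>
  u *: v) a b) => //.
exact: (@scale_continuous _ V (a, b)).
Qed.

Lemma tvs_cvg_sum (K : numDomainType) (V : tvsType K) (T J : Type)
    (Fl : set_system T) (FF : Filter Fl) (s : seq J) (f : J -> T -> V) (a : J
      -> V) :
  (forall j, f j @ Fl --> a j) ->
  (fun t => \sum_(j <- s) f j t) @ Fl --> \sum_(j <- s) a j.
Proof.
move=> fa; elim: s => [|j s IH].
  by rewrite big_nil; under eq_fun do rewrite big_nil; exact: cvg_cst.
by rewrite big_cons; under eq_fun do rewrite big_cons; exact: tvs_cvgD.
Qed.

Lemma fd_minimal (K : fieldType) (X : lmodType K) : finite_dimensional X ->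
  exists n (b : 'I_n -> X),
    (forall x, exists a : 'I_n -> K, x = \sum_(k < n) a k *: b k) /\
    (forall a : 'I_n -> K, \sum_(k < n) a k *: b k = 0 -> forall k, a k = 0).
Proof.
move=> [n [b sb]]; elim: n b sb => [|n IH] b sb.
  by exists 0%N, b; split => // a _ [].
have [h|/existsNP[a /not_implyP[a0 /existsNP[j /eqP aj]]]] :=
    pselect (forall a : 'I_n.+1 -> K, \sum_k a k *: b k = 0 -> forall k, a k = 0).
  by exists n.+1, b.
apply: (IH (fun k => b (lift j k))) => x; have [c ->] := sb x.
exists (fun k => c (lift j k) - c j * (a j)^-1 * a (lift j k)).
have bj : b j = - (a j)^-1 *: \sum_(k < n) a (lift j k) *: b (lift j k).
  move: a0; rewrite (bigD1_ord j)//= => /eqP; rewrite addr_eq0 => /eqP h.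
  by rewrite scaleNr -scalerN -h scalerA mulVf// scale1r.
rewrite (bigD1_ord j)//= {1}bj scalerA scaler_sumr -big_split /=.
apply: eq_bigr => k _; rewrite scalerA -scalerDl; congr (_ *: _).
by rewrite addrC mulrN mulNr.
Qed.

(** Coordinates have to be bounded near 0. The image [Sph] of the boundary of the unit cube is
    compact and, by linear independence, misses 0; a vector close to 0 with a large coordinate would
    be scaled by a small factor onto [Sph]. *)
Lemma real_fd_locally_compact (R : realType) (X : tvsType R) :
  hausdorff_space X -> finite_dimensional X ->
  exists2 C : set X, compact C & nbhs 0 C.
Proof.
move=> hX /fd_minimal[[|n] [b [sb ib]]].
  exists [set 0]; first exact: compact_set1.
  apply: filterS filterT => x _ /=; have [a ->] := sb x.
  by rewrite big_ord0.
pose phi (a : 'rV[R]_n.+1) := \sum_k a 0 k *: b k.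
have cphi : continuous phi.
  move=> a; apply: (@tvs_cvg_sum _ _ _ _ (nbhs a) (nbhs_filter a)) => k.
  apply: (@tvs_cvgZ _ _ _ (nbhs a) (nbhs_filter a)); last exact: cvg_cst.
  exact: coord_continuous.
have ccube (r : 'I_n.+1 -> R) (s : 'I_n.+1 -> R) :
    compact (phi @` [set v : 'rV[R]_n.+1 | forall i, `[r i, s i]%classic (v
      ord0 i)]).
  apply: continuous_compact; first exact: continuous_subspaceT.
  by apply: (@rV_compact R _ (fun i => `[r i, s i]%classic)) => i;
    exact: segment_compact.
(* The image of the face of the cube on which coordinate [i] equals [(-1) ^+ e]. *)
pose side (i : 'I_n.+1) (e : bool) := phi @` [set v : 'rV[R]_n.+1 |
  forall j, `[if j == i then (-1) ^+ e else -1, if j == i then (-1) ^+ e else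
    1]%classic (v ord0 j)].
pose Sph := \big[setU/set0]_(p : 'I_n.+1 * bool) side p.1 p.2.
have cSph : compact Sph by apply: bigsetU_compact => p _; exact: ccube.
have nSph : nbhs 0 (~` Sph).
  apply: open_nbhs_nbhs; split.
    by apply: closed_openC; exact: compact_closed.
  rewrite /Sph /= => Sph0.
  have : exists p : 'I_n.+1 * bool, side p.1 p.2 0.
    move: Sph0; elim/big_ind : _ => // [A B hA hB [/hA|/hB]|p _ sp]//.
    by exists p.
  move=> [[i e] /= [v hv /ib v0]]; have := hv i; rewrite eqxx /= in_itv /=.
  by rewrite v0; case: e {hv} => /=; rewrite ?expr0 ?expr1 ?lerN10 ?ler10
    ?oppr_ge0 ?ler10 ?andbF.
have [[A B] /= [A0 B0] AB] : nbhs ((0, 0) : R^o * X) [set p | (~` Sph) (p.1 *: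
  p.2)].
  by apply: (@scale_continuous _ X (0, 0)); rewrite /= scale0r.
have [d d0 dA] := nbhs0_ball A0.
(* If the largest coordinate exceeds [2 / d] in absolute value, its inverse is below [d] and hence a
   scaling factor in [A]. *)
exists (phi @` [set v : 'rV[R]_n.+1 | forall i, `[- (2 / d), 2 / d]%classic (v
  ord0 i)]).
  exact: (ccube (fun=> _) (fun=> _)).
apply: filterS B0 => x Bx; have [a xa] := sb x.
pose v : 'rV[R]_n.+1 := \row_k a k.
have pv : phi v = x by rewrite xa /phi; apply: eq_bigr => k _; rewrite mxE.
exists v => // i; rewrite /= in_itv /= -ler_norml leNgt; apply/negP => vi.
have dd : 0 < 2 / d by rewrite divr_gt0.
pose j := [arg max_(k > i) `|v 0 k|]%O.
have [vj vm] : 2 / d < `|v 0 j| /\ forall k, `|v 0 k| <= `|v 0 j|.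
  rewrite /j; case: arg_maxP => // j0 _ hj; split; last by move=> k; exact: hj.
  by apply: lt_le_trans vi _; exact: hj.
have vj0 : 0 < `|v 0 j| by exact: lt_trans vj.
have At : A (`|v 0 j|^-1).
  apply: dA; rewrite normrV ?unitfE ?gt_eqF// normr_id invf_plt ?posrE//.
  apply: lt_trans vj; rewrite -[ltLHS]mul1r ltr_pM2r ?invr_gt0//.
  by rewrite ltr1n.
apply: (AB (`|v 0 j|^-1, x) (conj At Bx)) => /=.
have sv : side j (v 0 j < 0) (`|v 0 j|^-1 *: x).
  exists (`|v 0 j|^-1 *: v).
    move=> k; rewrite /= in_itv /= [(_ *: v) _ _]mxE.
    have [->|_] := eqVneq k j.
      have -> : `|v 0 j|^-1 * v 0 j = (-1) ^+ (v 0 j < 0)%R.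
        by rewrite [in LHS](numEsign (v 0 j)) normrM normr_sign mul1r normr_id
          mulrCA mulVf ?gt_eqF// mulr1.
      by rewrite lexx.
    by rewrite -ler_norml normrM normfV normr_id ler_pdivrMl// mulr1.
  rewrite -pv /phi scaler_sumr; apply: eq_bigr => k _.
  by rewrite !mxE scalerA.
rewrite /Sph (bigD1 (j, v 0 j < 0))//=; left; exact: sv.
Qed.


(** The complex case becomes real by restriction of scalars through the pair [RC]: the vectors [b k]
    together with their multiples by the imaginary unit span over the reals. *)
Lemma fd_locally_compact (R : realType) (KL : scalars)
    (X : tvsType (baseK R KL)) :
  hausdorff_space X -> finite_dimensional X ->
  exists2 C : set X, compact C & nbhs 0 C.
Proof.
case: KL X => /= X; [exact: real_fd_locally_compact..|].
move=> hX [n [b sb]].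
pose V : tvsType (baseL R RC) := X.
pose W : tvsType (baseK R RC) := restr R RC V.
suff fdX : finite_dimensional W.
  by have [C cC C0] := @real_fd_locally_compact R W hX fdX; exists C.
pose b' (k : 'I_(n + n)) : W :=
  match fintype.split k with inl i => b i | inr i => ('i)%C *: b i end.
exists (n + n)%N, b' => x; have [a ->] := sb x.
exists (fun k => match fintype.split k with
  inl i => complex.Re (a i) | inr i => complex.Im (a i) end).
rewrite big_split_ord /= -big_split /=; apply: eq_bigr => k _.
rewrite /b' /lshift /rshift.
have -> : fintype.split (lshift n k) = inl k by rewrite -[lshift n k]/(unsplit
  (inl k)) unsplitK.
have -> : fintype.split (rshift n k) = inr k by rewrite -[rshift n k]/(unsplit
  (inr k)) unsplitK.
rewrite [a k in LHS]complexE mulrC scalerDl -scalerA.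
by [].
Qed.

(** * Mean value theorem and difference quotients *)

(** The average slope over an interval is a convex combination of the average slopes over its parts.
    Hence the set [S] of times up to which the average slope lies in [C] contains its supremum and
    extends beyond it unless the supremum is 1. *)
Lemma slope_mvt (R : realType) (H : lmodType R) (g : R -> H) (C : set H) :
  (forall (x y : H) (a : R), 0 <= a -> a <= 1 -> C x -> C y ->
    C (a *: x + (1 - a) *: y)) ->
  (forall t, 0 <= t <= 1 -> exists2 d, 0 < d &
    forall h, h != 0 -> `|h| < d -> C (h^-1 *: (g (h + t) - g t))) ->
  C (g 1 - g 0).
Proof.
move=> Cc loc.
(* At time 0 there is no average slope, so 0 is put into [S] by decree. *)
pose S := [set t | 0 <= t <= 1 /\ (t = 0 \/ C (t^-1 *: (g t - g 0)))].
have ext s s' : S s -> s < s' -> s' <= 1 ->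
    C ((s' - s)^-1 *: (g s' - g s)) -> S s'.
  move=> [/andP[s0 s1] hs] ss' s'1 Cs; have s'0 : 0 < s' by exact: le_lt_trans ss'.
  split; first by rewrite (ltW s'0).
  right; case: hs => [s00|Cs0]; first by move: Cs; rewrite s00 subr0.
  have [s00|sn0] := eqVneq s 0; first by move: Cs; rewrite s00 subr0.
  have := Cc _ _ (s / s') _ _ Cs0 Cs.
  have -> : (s / s') *: (s^-1 *: (g s - g 0)) + (1 - s / s') *: ((s' - s)^-1 *:
    (g s' - g s)) =
      s'^-1 *: (g s' - g 0).
    have s's : s' - s != 0 by rewrite subr_eq0 gt_eqF.
    rewrite !scalerA mulrAC mulfV// mul1r.
    have -> : (1 - s / s') / (s' - s) = s'^-1.
      rewrite -[1](@mulfV _ s') ?gt_eqF// -mulrBl mulrAC mulfV// ?mul1r//.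
    by rewrite -scalerDr addrC addrA subrK.
  by apply; [rewrite divr_ge0// ltW|rewrite ler_pdivrMr// mul1r ltW].
have S0 : S 0 by split; [rewrite lexx ler01|left].
have hS : has_sup S by split; [exists 0|exists 1 => t [/andP[]]].
have T01 : 0 <= sup S <= 1.
  by rewrite ub_le_sup//=; [apply: ge_sup; [exists 0|move=> t [/andP[]]]|case: hS].
have [d d0 dC] := loc _ T01; have /andP[T0 T1] := T01.
have ST : S (sup S).
  have [t St tT] := sup_adherent d0 hS.
  have : t <= sup S by apply: ub_le_sup => //; case: hS.
  rewrite le_eqVlt => /orP[/eqP<-//|tltT].
  apply: (ext t) => //; have tT0 : t - sup S != 0 by rewrite subr_eq0 lt_eqF.
  have := dC (t - sup S) tT0; rewrite subrK ltr0_norm ?subr_lt0// opprB.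
  rewrite ltrBlDr -ltrBlDl => /(_ tT); congr C.
  by rewrite -[t - _]opprB -[g t - _]opprB invrN scaleNr scalerN opprK.
move: T1; rewrite le_eqVlt => /orP[/eqP TE|T1].
  move: ST; rewrite TE => -[_ [/eqP|]]; first by rewrite oner_eq0.
  by rewrite invr1 scale1r.
pose h := Num.min (d / 2) (1 - sup S).
have h0 : 0 < h by rewrite lt_min subr_gt0 T1 divr_gt0.
have hd : h < d.
  by rewrite gt_min ltr_pdivrMr// ltr_pMr// ltr1n.
have : S (h + sup S).
  apply: (ext (sup S)) => //; first by rewrite ltrDr.
    by rewrite -lerBrDr ge_min lexx orbT.
  by rewrite addrK; apply: dC; rewrite ?gt_eqF// gtr0_norm.
move=> /(ub_le_sup (proj2 hS)); rewrite gerDr => hle0.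
by move: h0; rewrite ltNge hle0.
Qed.

Lemma is_dirderP (K : numFieldType) (X H : tvsType K) (f : X -> H) x v l :
  is_dirder f x v l <-> forall A, nbhs l A -> exists2 d : K, 0 < d &
    forall h, h != 0 -> `|h| < d -> A (h^-1 *: (f (h *: v + x) - f x)).
Proof.
split=> [hf A Al|hf A Al].
  have : (0 : K^o)^' [set h | A (h^-1 *: (f (h *: v + x) - f x))] by exact: hf.
  rewrite /dnbhs /within /= -nbhs_ballE => -[d /= d0 dA]; exists d => // h h0 hd.
  by apply: dA => //; rewrite -ball_normE /= sub0r normrN.
have [d d0 dA] := hf A Al.
change ((0 : K^o)^' [set h | A (h^-1 *: (f (h *: v + x) - f x))]).
rewrite /dnbhs /within /= -nbhs_ballE; exists d => // h.
by rewrite -ball_normE /= sub0r normrN => hd h0; exact: dA.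
Qed.

Section Calculus.
Variables (R : realType) (KL : scalars).
Local Notation K := (baseK R KL).

Lemma seg_mvt (X H : tvsType K) (f : X -> H) (x w : X) (C : set H) :
  open C -> convex_set C ->
  (forall t : K, 0 <= t -> t <= 1 -> exists2 l, is_dirder f (t *: w + x) w l &
    C l) ->
  C (f (w + x) - f x).
Proof.
move=> oC /convex_setP Cc hf.
have hf2 t : 0 <= t -> t <= 1 -> exists2 d : K, 0 < d &
    forall h, h != 0 -> `|h| < d -> C (h^-1 *: (f ((h + t) *: w + x) - f (t *:
      w + x))).
  move=> t0 t1; have [l /is_dirderP hl Cl] := hf _ t0 t1.
  have [d d0 dC] := hl C (open_nbhs_nbhs (conj oC Cl)); exists d => // h h0 hd.
  by have := dC h h0 hd; rewrite addrA -scalerDl.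
clear hf; case: KL X H f x w C oC Cc hf2 => /= X H f x w C oC Cc hf2.
- have := @slope_mvt R H (fun t => f (t *: w + x)) C Cc.
  rewrite scale1r scale0r add0r; apply => t /andP[t0 t1]; exact: hf2.
- have := @slope_mvt R H (fun t => f (t *: w + x)) C Cc.
  rewrite scale1r scale0r add0r; apply => t /andP[t0 t1]; exact: hf2.
(* Over the complex numbers the target is regarded as a real space, and the segment is run through
   with real times. *)
- pose V : tvsType (baseL R RC) := H.
  pose W : tvsType (baseK R RC) := restr R RC V.
  have := @slope_mvt R W (fun t => f (t%:C%C *: w + x)) C.
  rewrite scale1r scale0r add0r; apply.
    move=> a b t t0 t1 Ca Cb.
    have := Cc a b t%:C%C; rewrite !lecR => /(_ t0 t1 Ca Cb).
    by rewrite -[1 in X in X -> _]/(1%:C%C) -rmorphB.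
  move=> t /andP[t0 t1].
  have [||d d0 dC] := hf2 t%:C%C; [by rewrite lecR..|].
  have d0' : 0 < complex.Re d by move: d0; rewrite ltcE /= => /andP[].
  exists (complex.Re d) => // h h0 hd.
  have := dC h%:C%C; rewrite -rmorphD -fmorphV /=; apply.
    by rewrite fmorph_eq0.
  rewrite ltcE /= ?normc_def /= expr0n addr0 sqrtr_sqr hd andbT.
  by move: d0; rewrite ltcE /= => /andP[].
Qed.

(** By the mean value theorem a difference quotient lies in any convex open set containing the
    derivatives along the segment, which gives convergence uniformly in base point and direction.
    The chain rule and additivity in the direction depend on this uniformity. *)
Lemma dq_unif (X H : tvsType K) (f : X -> H) (df : X -> X -> H) (U : set X) x v :
  nbhs x U -> (forall y w, U y -> is_dirder f y w (df y w)) ->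
  {for (x, v), continuous (fun p : X * X => df p.1 p.2)} ->
  forall A, nbhs (df x v) A -> exists N N' (d : K),
    [/\ nbhs x N, nbhs v N', 0 < d &
    forall y w h, N y -> N' w -> h != 0 -> `|h| < d ->
      A (h^-1 *: (f (h *: w + y) - f y))].
Proof.
move=> Ux hf cdf A Al.
have [B Bconv [Bo Bb]] := @locally_convex _ H.
have [C [BC Cl] CA] := Bb _ _ Al.
have oC : open C by exact: Bo.
have cC : convex_set C by apply: Bconv; exact: mem_set.
have [[N0 N1] /= [N0x N1v] NC] : nbhs (x, v) [set p : X * X | C (df p.1 p.2)].
  by apply: cdf; exact: open_nbhs_nbhs.
have [[P N2] /= [Pa N2x] PN] : nbhs ((0 *: v, x) : X * X) [set p | (N0 `&` U)
  (p.1 + p.2)].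
  apply: (@add_continuous X (_, _)); rewrite /= scale0r add0r; exact: filterI.
have [[Q N3] /= [Q0 N3v] QP] : nbhs ((0, v) : K^o * X) [set p | P (p.1 *: p.2)].
  exact: (@scale_continuous _ X (0, v)).
have [d d0 dQ] := nbhs0_ball Q0.
exists N2, (N1 `&` N3), d; split => //; first exact: filterI.
move=> y w h N2y [N1w N3w] h0 hd; apply: CA.
rewrite scalerBr.
(* The factor [h^-1] in front of [f] cancels the [h] in the direction, so the derivative along the
   segment is again [df] in direction [w]. *)
apply: (@seg_mvt _ _ (fun z => h^-1 *: f z) y (h *: w) C) => //.
move=> t t0 t1; rewrite scalerA.
have [N0z Uz] : (N0 `&` U) ((t * h) *: w + y).
  apply: (PN (_, y)); split=> //=; apply: (QP (_, w)); split=> //=.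
  apply: dQ; rewrite normrM; apply: le_lt_trans hd.
  by rewrite ler_piMl// ger0_norm.
exists (df ((t * h) *: w + y) w); last exact: (NC (_, w)).
apply/is_dirderP => A' A'l.
have /is_dirderP/(_ _ A'l)[e e0 eA'] := hf _ w Uz.
exists (e / `|h|); first by rewrite divr_gt0// normr_gt0.
move=> k k0 ke; have := eA' (k * h); rewrite mulf_neq0// => /(_ isT).
rewrite normrM -ltr_pdivlMr ?normr_gt0// => /(_ ke); congr A'.
by rewrite invfM scalerA -scalerBr !scalerA.
Qed.
End Calculus.

(** * Maps of class C^n through their tangent maps *)

Lemma continuous_near_eq (X Y : topologicalType) (f g : X -> Y) (x : X) :
  (\forall y \near x, f y = g y) -> {for x, continuous f} -> {for x, continuous g}.
Proof.
move=> fg cf A; rewrite -(nbhs_singleton fg) => Afx.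
have := cf A Afx; rewrite /= !nbhs_simpl /=.
by move: fg; apply: filterS2 => y /= ->.
Qed.

Lemma continuous_pair_at (X Y Z : topologicalType) (f : X -> Y) (g : X -> Z) x :
  {for x, continuous f} -> {for x, continuous g} ->
  {for x, continuous (fun x => (f x, g x))}.
Proof. by move=> cf cg; apply: cvg_pair. Qed.

Lemma openX (X Y : topologicalType) (A : set X) (B : set Y) :
  open A -> open B -> open (A `*` B).
Proof.
move=> oA oB; rewrite openE => -[x y] [/= Ax By].
by exists (A, B) => //=; split; apply: open_nbhs_nbhs.
Qed.

Section Ctan.
Variables (R : realType) (KL : scalars).
Local Notation K := (baseK R KL).

Lemma near_line (X : tvsType K) (U : set X) x v : nbhs x U ->
  exists2 d : K, 0 < d & forall h, `|h| < d -> U (h *: v + x).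
Proof.
move=> Ux.
have [[P Q] /= [Pa Qx] PQ] : nbhs ((0 *: v, x) : X * X) [set p | U (p.1 + p.2)].
  by apply: (@add_continuous X (_, _)); rewrite /= scale0r add0r.
have : nbhs (0 : K^o) [set a | P (a *: v)].
  have := @scale_continuous _ X (0, v) _ Pa; case=> -[A B] /= [A0 Bv] AB.
  apply: filterS A0 => a Aa; apply: (AB (a, v)); split=> //=.
  exact: nbhs_singleton.
move=> /nbhs0_ball[d d0 dA]; exists d => // a ad.
by apply: (PQ (_, x)); split; [exact: dA|exact: nbhs_singleton].
Qed.

Lemma is_dirder_near (X H : tvsType K) (f g : X -> H) x v l :
  (\forall y \near x, f y = g y) -> is_dirder f x v l -> is_dirder g x v l.
Proof.
move=> fg /is_dirderP hf; apply/is_dirderP => A /hf[d d0 dA].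
have [e e0 eU] := near_line v fg.
have [m [m0 md me]] := min_pos d0 e0.
exists m => // h h0 hm; rewrite -(eU h) ?(lt_le_trans hm)//.
by rewrite -(nbhs_singleton fg); apply: dA => //; exact: lt_le_trans md.
Qed.

Lemma dirder_near (X H : tvsType K) (f g : X -> H) x v :
  (\forall y \near x, f y = g y) -> dirder v f x = dirder v g x.
Proof.
move=> fg; rewrite /dirder; congr xget; rewrite predeqE => l; split.
  exact: is_dirder_near.
by apply: is_dirder_near; apply: filterS fg => y ->.
Qed.

Lemma is_dirder_unique (X H : tvsType K) (f : X -> H) x v l l' :
  hausdorff_space H -> is_dirder f x v l -> is_dirder f x v l' -> l = l'.
Proof.
move=> hH /is_dirderP hl /is_dirderP hl'; apply: contrapT => ll'.
have [A [B [oA oB Al Bl' AB]]] := hausdorff_separate hH ll'.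
have [d d0 dA] := hl A (open_nbhs_nbhs (conj oA Al)).
have [e e0 eB] := hl' B (open_nbhs_nbhs (conj oB Bl')).
have [m [m0 md me]] := min_pos d0 e0.
have m2 : 0 < m / 2 by rewrite divr_gt0.
have m2m : `|m / 2| < m by rewrite gtr0_norm// ltr_pdivrMr// ltr_pMr// ltr1n.
apply: (AB ((m / 2)^-1 *: (f ((m / 2) *: v + x) - f x))).
  by apply: dA; rewrite ?gt_eqF//; exact: lt_le_trans md.
by apply: eB; rewrite ?gt_eqF//; exact: lt_le_trans me.
Qed.

Lemma dirderE (X H : tvsType K) (f : X -> H) x v l :
  hausdorff_space H -> is_dirder f x v l -> dirder v f x = l.
Proof.
move=> hH hl; rewrite /dirder; apply: xget_unique => // l' hl'.
exact: is_dirder_unique hl' hl.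
Qed.

Lemma is_dirder_dirder (X H : tvsType K) (f : X -> H) x v :
  (exists l, is_dirder f x v l) -> is_dirder f x v (dirder v f x).
Proof. by move=> h; rewrite /dirder; exact: (xgetPex 0 h). Qed.

(* Recursive description of [C^n]-maps through the tangent map [df]; unlike the
   iterated directional derivatives, it is compatible with induction on [n]. *)
Fixpoint Ctan n (X H : tvsType K) (U : set X) (f : X -> H) : Prop :=
  (forall x, U x -> {for x, continuous f}) /\
  if n is m.+1 then
    (forall x v, U x -> exists l, is_dirder f x v l) /\
    @Ctan m (X * X)%type H (U `*` setT) (fun p => dirder p.2 f p.1)
  else True.

Lemma Ctan_cont n (X H : tvsType K) (U : set X) (f : X -> H) x :
  Ctan n U f -> U x -> {for x, continuous f}.
Proof. by case: n => [|n] [cf _]; exact: cf. Qed.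

Lemma Ctan_sub n (X H : tvsType K) (U V : set X) (f : X -> H) :
  V `<=` U -> Ctan n U f -> Ctan n V f.
Proof.
elim: n X U V f => [|n IH] X U V f VU [cf df]; split => //.
- by move=> x /VU; exact: cf.
- by move=> x /VU; exact: cf.
- case: df => df cdf; split; first by move=> x v /VU; exact: df.
  by apply: IH cdf => -[x y] [/VU Ux _].
Qed.

Lemma Ctan_local n (X H : tvsType K) (U : set X) (f : X -> H) :
  (forall x, U x -> exists2 V, V x & Ctan n V f) -> Ctan n U f.
Proof.
elim: n X U f => [|n IH] X U f h; split => //.
- by move=> x /h[V Vx [cf _]]; exact: cf.
- by move=> x /h[V Vx [cf _]]; exact: cf.
- split; first by move=> x v /h[V Vx [_ [df _]]]; exact: df.
  apply: IH => -[x v] [/= /h[V Vx [_ [_ cdf]]] _].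
  by exists (V `*` setT).
Qed.

Lemma Ctan_pred n (X H : tvsType K) (U : set X) (f : X -> H) :
  Ctan n.+1 U f -> Ctan n U f.
Proof.
elim: n X U f => [|n IH] X U f [cf df]; split => //.
by case: df => df cdf; split=> //; exact: IH.
Qed.

Lemma Ctan_ext n (X H : tvsType K) (U : set X) (f g : X -> H) :
  open U -> (forall x, U x -> f x = g x) -> Ctan n U f -> Ctan n U g.
Proof.
elim: n X U f g => [|n IH] X U f g oU fg [cf df].
  split=> // x Ux; apply: continuous_near_eq (cf _ Ux).
  by apply: filterS (open_nbhs_nbhs (conj oU Ux)) => y; exact: fg.
have nfg x : U x -> \forall y \near x, f y = g y.
  by move=> Ux; apply: filterS (open_nbhs_nbhs (conj oU Ux)) => y; exact: fg.
split; first by move=> x Ux; apply: continuous_near_eq (nfg _ Ux) (cf _ Ux).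
case: df => df cdf; split.
  move=> x v Ux; have [l hl] := df _ v Ux; exists l.
  exact: is_dirder_near (nfg _ Ux) hl.
apply: IH cdf; first by apply: openX => //; exact: openT.
by move=> [x v] [/= Ux _]; apply: dirder_near; exact: nfg.
Qed.

Lemma is_dirder_lin (X Y : tvsType K) (A : X -> Y) x v :
  linear A -> is_dirder A x v (A v).
Proof.
move=> lA; apply/is_dirderP => B BAv; exists 1 => // h h0 _.
by rewrite lA addrK scalerA mulVf// scale1r; exact: nbhs_singleton.
Qed.

Lemma Ctan_lin n (X Y : tvsType K) (A : X -> Y) : hausdorff_space Y ->
  linear A -> continuous A -> Ctan n setT A.
Proof.
elim: n X A => [|n IH] X A hY lA cA; split => //; first by move=> x _; exact: cA.
  by move=> x _; exact: cA.
split; first by move=> x v _; exists (A v); exact: is_dirder_lin.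
rewrite (_ : (fun p : X * X => _) = (A \o snd)).
  apply: Ctan_sub (IH _ (A \o snd) hY _ _) => //.
    by move=> a u v /=; rewrite lA.
  by move=> p; apply: continuous_comp; [exact: cvg_snd|exact: cA].
by apply: funext => -[x v] /=; apply: dirderE => //; exact: is_dirder_lin.
Qed.

Lemma is_dirder_pair (X Y Z : tvsType K) (f : X -> Y) (g : X -> Z) x v l m :
  is_dirder f x v l -> is_dirder g x v m ->
  is_dirder (fun x => (f x, g x)) x v (l, m).
Proof.
move=> /is_dirderP hf /is_dirderP hg; apply/is_dirderP => A [[P Q] /= [Pl Qm] PQ].
have [d d0 dA] := hf _ Pl; have [e e0 eB] := hg _ Qm.
have [k [k0 kd ke]] := min_pos d0 e0.
exists k => // h h0 hk; apply: PQ; split=> /=.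
  by apply: dA => //; exact: lt_le_trans kd.
by apply: eB => //; exact: lt_le_trans ke.
Qed.

Lemma Ctan_pair n (X Y Z : tvsType K) (U : set X) (f : X -> Y) (g : X -> Z) :
  hausdorff_space Y -> hausdorff_space Z -> open U ->
  Ctan n U f -> Ctan n U g -> Ctan n U (fun x => (f x, g x)).
Proof.
move=> hY hZ; elim: n X U f g => [|n IH] X U f g oU [cf df] [cg dg].
  by split=> // x Ux; apply: continuous_pair_at; [exact: cf|exact: cg].
split; first by move=> x Ux; apply: continuous_pair_at; [exact: cf|exact: cg].
case: df => df cdf; case: dg => dg cdg.
have h x v : U x -> is_dirder (fun x => (f x, g x)) x v (dirder v f x, dirder v
  g x).
  by move=> Ux; apply: is_dirder_pair; apply: is_dirder_dirder;
    [exact: df|exact: dg].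
split; first by move=> x v /h hx; eexists; exact: hx.
have oUT : open (U `*` [set: X]) by apply: openX => //; exact: openT.
apply: Ctan_ext (IH _ _ _ _ oUT cdf cdg) => // -[x v] [/= Ux _].
by apply/esym/dirderE; [exact: prod_hausdorff|exact: h].
Qed.

Lemma is_dirder_comp (X Y H : tvsType K) (f : X -> Y) (g : Y -> H)
    (V : set Y) x v l :
  nbhs (f x) V -> is_dirder f x v l ->
  (forall y w, V y -> exists m, is_dirder g y w m) ->
  {for (f x, l), continuous (fun p : Y * Y => dirder p.2 g p.1)} ->
  is_dirder (g \o f) x v (dirder l g (f x)).
Proof.
move=> Vfx /is_dirderP hf hg cdg; apply/is_dirderP => A Al.
have [|N [N' [d [Nx N'l d0 dA]]]] :=
    @dq_unif _ _ _ _ g (fun y w => dirder w g y) V (f x) l Vfx _ cdg A Al.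
  by move=> y w Vy; apply: is_dirder_dirder; exact: hg.
have [e e0 eN] := hf _ N'l.
have [k [k0 kd ke]] := min_pos d0 e0.
exists k => // h h0 hk /=.
(* The increment of [f] is [h] times its difference quotient, so [g] is differentiated at [f x] in a
   moving direction that tends to [l]. *)
have := dA (f x) (h^-1 *: (f (h *: v + x) - f x)) h (nbhs_singleton Nx) _ h0 _.
rewrite scalerA mulfV// scale1r subrK; apply; last exact: lt_le_trans kd.
by apply: eN => //; exact: lt_le_trans ke.
Qed.

Lemma Ctan_comp n (X Y H : tvsType K) (U : set X) (V : set Y)
    (f : X -> Y) (g : Y -> H) :
  hausdorff_space X -> hausdorff_space Y -> hausdorff_space H ->
  open U -> open V -> (forall x, U x -> V (f x)) ->
  Ctan n U f -> Ctan n V g -> Ctan n U (g \o f).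
Proof.
elim: n X Y H U V f g => [|n IH] X Y H U V f g hX hY hH oU oV UV.
  move=> [cf _] [cg _]; split=> // x Ux.
  by apply: continuous_comp; [exact: cf|apply: cg; exact: UV].
move=> ccf ccg; have [cf [df cdf]] := ccf; have [cg [dg cdg]] := ccg.
split; first by move=> x Ux; apply: continuous_comp; [exact: cf|apply: cg;
  exact: UV].
have h x v : U x -> is_dirder (g \o f) x v (dirder (dirder v f x) g (f x)).
  move=> Ux; apply: (@is_dirder_comp _ _ _ _ _ V).
  - by apply: open_nbhs_nbhs; split=> //; exact: UV.
  - by apply: is_dirder_dirder; exact: df.
  - by move=> y w Vy; exact: dg.
  - by apply: (Ctan_cont cdg); split=> //=; exact: UV.
split; first by move=> x v /h hx; eexists; exact: hx.
have oUT : open (U `*` [set: X]) by apply: openX => //; exact: openT.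
have oVT : open (V `*` [set: Y]) by apply: openX => //; exact: openT.
(* The tangent map of the composite is that of [g] after the pair of [f \o fst] and the tangent map
   of [f]; the first component is itself a composite, covered by the induction hypothesis. *)
have ccff : Ctan n (U `*` [set: X]) (f \o fst).
  apply: (IH _ _ _ (U `*` [set: X]) U fst f) => //; first exact: prod_hausdorff.
  - by move=> -[x v] [].
  - apply: Ctan_sub (@Ctan_lin n (X * X)%type X fst hX _ _) => //.
    by move=> x; exact: cvg_fst.
  - exact: Ctan_pred.
have ccp : Ctan n (U `*` [set: X]) (fun p => (f p.1, dirder p.2 f p.1)).
  exact: Ctan_pair.
have UVT (p : X * X) : (U `*` setT) p -> (V `*` setT) (f p.1, dirder p.2 f p.1).
  by move=> [/UV].
have := IH _ _ _ _ _ _ (fun q : Y * Y => dirder q.2 g q.1)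
  (prod_hausdorff hX hX) (prod_hausdorff hY hY) hH oUT oVT UVT ccp cdg.
apply: Ctan_ext => // -[x v] [/= Ux _].
by apply/esym/dirderE => //; exact: h.
Qed.

End Ctan.

(** * Comparison with iterated directional derivatives *)

Section Terms.
Variable A : Type.
Implicit Types (rs : seq (A * A)).

(* The lists of directions produced by differentiating [df (x, y)] successively
   in the directions of [rev rs], besides [y :: rev (unzip1 rs)]. *)
Fixpoint terms rs : seq (seq A) :=
  if rs is (a, b) :: rs' then
    (b :: rev (unzip1 rs')) :: [seq rcons t a | t <- terms rs']
  else [::].

Lemma terms_size rs : all (fun t => size t == size rs) (terms rs).
Proof.
elim: rs => //= -[a b] rs IH /=; rewrite size_rev size_map eqxx /= all_map.
by apply: sub_all IH => t /= /eqP; rewrite size_rcons => ->.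
Qed.

Lemma terms_all (Q : pred A) rs : all Q (unzip1 rs) -> all Q (unzip2 rs) ->
  all (all Q) (terms rs).
Proof.
elim: rs => //= -[a b] rs IH /= /andP[Qa Q1] /andP[-> Q2] /=.
rewrite all_rev Q1 /= all_map; apply: sub_all (IH Q1 Q2) => t /=.
by rewrite all_rcons Qa.
Qed.

End Terms.

Lemma terms_map (A B : Type) (g : A -> B) (rs : seq (A * A)) :
  terms [seq (g p.1, g p.2) | p <- rs] = [seq [seq g u | u <- t] | t <- terms rs].
Proof.
elim: rs => //= -[a b] rs /= ->; congr (_ :: _).
  by rewrite map_rev /unzip1 -!map_comp.
by rewrite -!map_comp; apply: eq_map => t /=; rewrite map_rcons.
Qed.

Section Cfin.
Variables (R : realType) (KL : scalars).
Local Notation K := (baseK R KL).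

Lemma iter_dirder_rcons (X H : tvsType K) (f : X -> H) s a :
  iter_dirder f (rcons s a) = dirder a (iter_dirder f s).
Proof. by elim: s f => //= y s IH f; rewrite IH. Qed.

Definition all_continuous (P : topologicalType) (X : topologicalType) (p : P)
  (s : seq (P -> X)) :=
  all (fun g => `[< {for p, continuous g} >]) s.

(** Continuity is required along arbitrary continuous families of base points and directions. Unlike
    the row vectors in [is_Cfin], lists of directions can then be rearranged, extended and paired
    freely. *)
Definition Cseq n (X H : tvsType K) (U : set X) (f : X -> H) : Prop :=
  (forall s x v, (size s < n)%N -> U x ->
    exists l, is_dirder (iter_dirder f s) x v l) /\
  forall (P : topologicalType) (p : P) (xx : P -> X) (s : seq (P -> X)),
    (size s <= n)%N -> all_continuous p s -> {for p, continuous xx} -> U (xx p) ->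
    {for p, continuous (fun q => iter_dirder f [seq g q | g <- s] (xx q))}.

Lemma coord_cont (X : topologicalType) j (y : 'rV[X]_j) k :
  {for y, continuous (fun y : 'rV[X]_j => y 0 k)}.
Proof.
move=> A Ak; exists (fun _ l => if l == k then A else setT).
  move=> i l; rewrite (ord1 i); have [->//|_] := eqVneq l k; exact: filterT.
by move=> z /(_ 0 k); rewrite eqxx.
Qed.

Lemma Cseq_Cfin n (X H : tvsType K) (U : set X) (f : X -> H) :
  Cseq n U f -> is_Cfin n U f.
Proof.
move=> [df cf]; split=> [x Ux|j /andP[j0 jn]].
  have := cf X x id [::] isT isT; apply => //; exact: cvg_id.
split=> [x s v Ux sj|x y Ux]; first by apply: df => //; rewrite sj.
pose s : seq (X * 'rV[X]_j -> X) := [seq (fun p : X * 'rV[X]_j => p.2 0 k) | k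
  <- enum 'I_j].
have := cf _ (x, y) fst s; rewrite size_map size_enum_ord => /(_ jn).
have -> : (fun q : X * 'rV[X]_j => iter_dirder f [seq g q | g <- s] q.1) =
  (fun p : X * 'rV[X]_j => iter_dirder f [seq p.2 0 k | k <- enum 'I_j] p.1).
  by apply: funext => q; rewrite /s -map_comp.
apply => //; last exact: cvg_fst.
rewrite /all_continuous /s all_map; apply/allP => k _ /=; apply/asboolP.
by apply: (@continuous_comp _ _ _ snd (fun y : 'rV[X]_j => y 0 k));
  [exact: cvg_snd|exact: coord_cont].
Qed.

Lemma Cfin_Cseq n (X H : tvsType K) (U : set X) (f : X -> H) :
  is_Cfin n U f -> Cseq n U f.
Proof.
move=> [cf hf]; split=> [s x v sn Ux|P p xx s sn cs cxx Ux].
  by have [d _] := hf (size s).+1 sn; exact: d.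
case: s sn cs => [|g0 s0] sn cs.
  by apply: continuous_comp => //; exact: cf.
set s := g0 :: s0 in sn cs *; have [_ c] := hf (size s) sn.
pose yy q : 'rV[X]_(size s) := \row_k nth g0 s k q.
have E q : [seq g q | g <- s] = [seq yy q 0 k | k <- enum 'I_(size s)].
  apply: (@eq_from_nth _ (g0 q)); first by rewrite 2!size_map size_enum_ord.
  move=> k; rewrite size_map => ks.
  rewrite (nth_map g0)// (nth_map (Ordinal ks)) ?size_enum_ord// mxE.
  by rewrite nth_enum_ord.
have -> : (fun q => iter_dirder f [seq g q | g <- s] (xx q)) =
    (fun r : X * 'rV[X]_(size s) => iter_dirder f [seq r.2 0 k | k <- enum
      'I_(size s)] r.1)
    \o (fun q => (xx q, yy q)).
  by apply: funext => q; rewrite E.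
apply: continuous_comp; last exact: c.
apply: continuous_pair_at => // A [B hB BA].
have : \forall q \near p, forall k : 'I_(size s), B 0 k (yy q 0 k).
  apply: filter_forall => k.
  have /asboolP ck : `[< {for p, continuous (nth g0 s k)} >].
    by move/all_nthP: cs => /(_ g0 k (ltn_ord k)).
  have Bk : nbhs (nth g0 s k p) (B 0 k) by have := hB 0 k; rewrite mxE.
  have ckB : nbhs p (nth g0 s k @^-1` B 0 k) by exact: ck.
  by apply: filterS ckB => q; rewrite mxE.
move=> hp; have {}hp : nbhs p [set q | forall k, B 0 k (yy q 0 k)] by exact: hp.
apply: filterS hp => q hq; apply: BA => i k.
by rewrite (ord1 i).
Qed.

Lemma is_dirder_fst (X Y H : tvsType K) (F : X * Y -> H) x y a l :
  is_dirder F (x, y) (a, 0) l <-> is_dirder (fun x => F (x, y)) x a l.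
Proof.
have e h : h *: ((a, 0) : X * Y) + (x, y) = (h *: a + x, y).
  by congr pair; rewrite /= scaler0 add0r.
split=> /is_dirderP hf; apply/is_dirderP => A /hf[d d0 dA]; exists d => // h h0 hd.
  by rewrite -e; exact: dA.
by rewrite e; exact: dA.
Qed.

Lemma dirder_fst (X Y H : tvsType K) (F : X * Y -> H) x y a :
  dirder (a, 0) F (x, y) = dirder a (fun x => F (x, y)) x.
Proof.
rewrite /dirder; congr xget; rewrite predeqE => l.
exact: is_dirder_fst.
Qed.

Lemma iter_dirder_fst (X Y H : tvsType K) (F : X * Y -> H) s y :
  (fun x => iter_dirder F [seq (a, 0) | a <- s] (x, y)) =
  iter_dirder (fun x => F (x, y)) s.
Proof.
elim: s F => // a s IH F /=; rewrite IH; congr iter_dirder.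
by apply: funext => x; exact: dirder_fst.
Qed.

(** Differentiating the tangent map in directions [(a, 0)] leaves its second argument fixed, so the
    iterated derivatives of [f] with first direction [y] are iterated derivatives of the tangent map
    at [(x, y)]. *)
Lemma Ctan_Cseq n (X H : tvsType K) (U : set X) (f : X -> H) :
  open U -> Ctan n U f -> Cseq n U f.
Proof.
elim: n X U f => [|n IH] X U f oU ccf.
  split=> // P p xx [|//] _ _ cxx Uxx; apply: continuous_comp => //.
  exact: (Ctan_cont ccf).
have [cf [df cdf]] := ccf.
have oUT : open (U `*` [set: X]) by apply: openX => //; exact: openT.
have [ddf ccdf] := IH _ _ _ oUT cdf.
split=> [[|y s] x v sn Ux|P p xx [|g s] sn cs cxx Ux]; first exact: df.
- rewrite /= -(iter_dirder_fst (fun p : X * X => dirder p.2 f p.1)).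
  have [||l hl] := ddf [seq (a, 0) | a <- s] (x, y) (v, 0) => //.
    by rewrite size_map.
  by exists l; apply/is_dirder_fst.
- by apply: continuous_comp => //; exact: cf.
- have -> : (fun q => iter_dirder f [seq g q | g <- g :: s] (xx q)) =
    (fun q => iter_dirder (fun p : X * X => dirder p.2 f p.1)
      [seq g q | g <- [seq (fun q => (h q, 0)) | h <- s]] (xx q, g q)).
    apply: funext => q; rewrite /= -map_comp.
    have := iter_dirder_fst (fun p : X * X => dirder p.2 f p.1) [seq h q | h <-
      s] (g q).
    move=> /(congr1 (fun u => u (xx q))) /= <-.
    by rewrite -map_comp.
  move: cs => /= /andP[/asboolP cg cs].
  apply: ccdf; rewrite ?size_map//.
    rewrite /all_continuous all_map; apply: sub_all cs => h /= /asboolP ch;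
      apply/asboolP.
    by apply: continuous_pair_at => //; exact: cvg_cst.
  exact: continuous_pair_at.
Qed.

Lemma is_dirder_scale (X H : tvsType K) (f : X -> H) x v l c :
  is_dirder f x v l -> is_dirder f x (c *: v) (c *: l).
Proof.
move=> /is_dirderP hf; apply/is_dirderP => A Al; move: Al; have [->|c0] :=
  eqVneq c 0 => Al.
  exists 1 => // h h0 _; rewrite scale0r scaler0 add0r subrr scaler0.
  by rewrite scale0r in Al; exact: nbhs_singleton.
have cA : nbhs l [set y | A (c *: y)].
  apply: (@tvs_cvgZ _ _ _ (nbhs l) _ (fun=> c) id c l) => //; exact: cvg_cst.
have [d d0 dA] := hf _ cA; exists (d / `|c|); first by rewrite divr_gt0// normr_gt0.
move=> h h0; rewrite ltr_pdivlMr ?normr_gt0// -normrM => hc.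
have := dA (h * c); rewrite mulf_neq0// => /(_ isT hc) /=; congr A.
by rewrite !scalerA invfM mulrCA mulfV// mulr1.
Qed.

Lemma is_dirderD (X H : tvsType K) (f g : X -> H) x v l m :
  is_dirder f x v l -> is_dirder g x v m ->
  is_dirder (fun x => f x + g x) x v (l + m).
Proof.
move=> hf hg; have := tvs_cvgD _ hf hg.
have -> : (fun t => t^-1 *: (f (t *: v + x) - f x) + t^-1 *: (g (t *: v + x) - g x))
  = (fun t => t^-1 *: (f (t *: v + x) + g (t *: v + x) - (f x + g x))).
  by apply: funext => t; rewrite -scalerDr opprD addrACA.
by apply.
Qed.

Lemma is_dirderZ (X H : tvsType K) (f : X -> H) x v l c :
  is_dirder f x v l -> is_dirder (fun x => c *: f x) x v (c *: l).
Proof.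
move=> hf; have := tvs_cvgZ _ (cvg_cst (c : K^o)) hf.
have -> : (fun t => c *: (t^-1 *: (f (t *: v + x) - f x)))
  = (fun t => t^-1 *: (c *: f (t *: v + x) - c *: f x)).
  by apply: funext => t; rewrite -scalerBr !scalerA mulrC.
by apply.
Qed.

Lemma is_dirder_cst (X H : tvsType K) (c : H) (x v : X) :
  is_dirder (fun=> c) x v 0.
Proof.
apply/is_dirderP => B B0; exists 1 => // h h0 _.
by rewrite subrr scaler0; exact: nbhs_singleton.
Qed.

Lemma is_dirder_sum (J : Type) (r : seq J) (X H : tvsType K) (f : J -> X -> H) x v l
    (Q : pred J) : all Q r ->
  (forall j, Q j -> is_dirder (f j) x v (l j)) ->
  is_dirder (fun x => \sum_(j <- r) f j x) x v (\sum_(j <- r) l j).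
Proof.
move=> + hf; elim: r => [_|j r IH /= /andP[Qj Qr]].
  rewrite big_nil (_ : (fun x => _) = (fun=> 0)); first exact: is_dirder_cst.
  by apply: funext => z; rewrite big_nil.
rewrite big_cons (_ : (fun x => _) = (fun x => f j x + \sum_(j <- r) f j x)).
  exact: is_dirderD (hf j Qj) (IH Qr).
by apply: funext => z; rewrite big_cons.
Qed.

Lemma is_dirderD_dir (X H : tvsType K) (f : X -> H) (U : set X) x v w :
  nbhs x U -> (forall y u, U y -> exists l, is_dirder f y u l) ->
  {for (x, w), continuous (fun p : X * X => dirder p.2 f p.1)} ->
  is_dirder f x (v + w) (dirder v f x + dirder w f x).
Proof.
move=> Ux hf cdf; apply/is_dirderP => A.
move=> /(@add_continuous H (dirder v f x, dirder w f x))[[P Q] /= [Pl Qm] PQ].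
have hv : is_dirder f x v (dirder v f x).
  by apply: is_dirder_dirder; apply: hf; exact: nbhs_singleton.
move/is_dirderP: hv => /(_ _ Pl)[d d0 dP].
have [|N [N' [e [Nx N'w e0 eQ]]]] :=
    @dq_unif _ _ _ _ f (fun y u => dirder u f y) U x w Ux _ cdf Q Qm.
  by move=> y u Uy; apply: is_dirder_dirder; exact: hf.
have [k k0 kN] := near_line v Nx.
have [m [m0 md me]] := min_pos d0 e0.
have [d1 [d10 d1m d1k]] := min_pos m0 k0.
exists d1 => // h h0 hd.
(* The increment is split at [h *: v + x]; the second quotient has a moving base point, whence the
   uniform estimate. *)
have -> : h^-1 *: (f (h *: (v + w) + x) - f x) = h^-1 *: (f (h *: v + x) - f x) +
    h^-1 *: (f (h *: w + (h *: v + x)) - f (h *: v + x)).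
  have E (a b c : H) : (b - a) + (c - b) = c - a by rewrite addrC addrA subrK.
  by rewrite -scalerDr E (scalerDr h v) (addrC (h *: v) (h *: w)) addrA.
apply: (PQ (_, _)).
split=> /=; first by apply: dP => //; exact: lt_le_trans (le_trans d1m md).
apply: eQ => //; last exact: lt_le_trans (le_trans d1m me).
  by apply: kN; exact: lt_le_trans d1k.
exact: nbhs_singleton.
Qed.

(** * Iterated derivatives of the tangent map *)

Section Tangent.
Variables (n : nat) (X H : tvsType K) (U : set X) (f : X -> H).
Hypotheses (hH : hausdorff_space H) (oU : open U) (cf : Cseq n.+1 U f).

Let nU x : U x -> nbhs x U. Proof. by move=> Ux; exact: open_nbhs_nbhs. Qed.

(** Only the direction differentiated first needs the analytic argument; each later direction
    differentiates an identity that holds on a whole neighbourhood. *)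
Lemma iter_dirder_lin s c y z x : (size s <= n)%N -> U x ->
  iter_dirder f (c *: y + z :: s) x =
  c *: iter_dirder f (y :: s) x + iter_dirder f (z :: s) x.
Proof.
elim/last_ind: s x => [|s a IH] x sn Ux.
  have hf y' u : U y' -> exists l, is_dirder f y' u l.
    exact: (cf.1 [::]).
  rewrite /=; apply: dirderE => //.
  have -> : c *: dirder y f x = dirder (c *: y) f x.
    by apply/esym/dirderE => //; apply: is_dirder_scale;
      apply: is_dirder_dirder; exact: hf.
  apply: (is_dirderD_dir (nU Ux)) => //.
  have := cf.2 (X * X)%type (x, z) fst [:: snd] isT _ _ Ux; apply.
    by rewrite /all_continuous /= andbT; apply/asboolP; exact: cvg_snd.
  exact: cvg_fst.
rewrite -!rcons_cons !iter_dirder_rcons.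
rewrite size_rcons in sn.
rewrite (@dirder_near _ _ _ _ _ (fun x => c *: iter_dirder f (y :: s) x +
  iter_dirder f (z :: s) x)).
  apply: dirderE => //; apply: is_dirderD.
    by apply: is_dirderZ; apply: is_dirder_dirder; exact: cf.1.
  by apply: is_dirder_dirder; exact: cf.1.
by apply: filterS (nU Ux) => x' Ux'; apply: IH => //; exact: ltnW.
Qed.

(** The closed form of the iterated derivatives of the tangent map. By linearity in [y], a further
    direction [(a, b)] differentiates every term along [a] and adds one term with [b] in place of
    [y]. The list [rs] is in reverse order, its head being the newest direction. *)
Let Phi (rs : seq (X * X)) (p : X * X) : H :=
  iter_dirder f (p.2 :: rev (unzip1 rs)) p.1 +
  \sum_(t <- terms rs) iter_dirder f t p.1.

Let Phi_dir rs x y a b : (size rs < n)%N -> U x ->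
  is_dirder (Phi rs) (x, y) (a, b) (Phi ((a, b) :: rs) (x, y)).
Proof.
move=> sn Ux; rewrite {2}/Phi /= big_cons big_map addrA.
pose s := rev (unzip1 rs).
have ss : size s = size rs by rewrite size_rev size_map.
apply: is_dirderD; last first.
  apply/is_dirderP => A Al.
  have /is_dirderP/(_ _ Al)[d d0 dA] : is_dirder (fun x => \sum_(t <- terms rs)
    iter_dirder f t x) x a
      (\sum_(t <- terms rs) iter_dirder f (rcons t a) x).
    apply: is_dirder_sum (terms_size rs) _ => t /eqP tn.
    by rewrite iter_dirder_rcons; apply: is_dirder_dirder; apply: cf.1;
      rewrite ?tn// ltnW.
  by exists d => // h h0 hd; exact: dA.
apply/is_dirderP => A.
move=> /(@add_continuous H (_, _))[[P Q] /= [Pl Qm] PQ].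
have hy : is_dirder (iter_dirder f (y :: s)) x a (iter_dirder f (rcons (y :: s)
  a) x).
  by rewrite iter_dirder_rcons; apply: is_dirder_dirder; apply: cf.1;
    rewrite //= ss.
have {Pl}Pl : nbhs (iter_dirder f (rcons (y :: s) a) x) P by rewrite /s
  rev_cons in Pl *.
move/is_dirderP: hy => /(_ _ Pl)[d d0 dP].
have cb : {for x, continuous (iter_dirder f (b :: s))}.
  have := cf.2 X x id [seq (fun=> u) | u <- b :: s].
  have -> : (fun q => iter_dirder f [seq g q | g <- [seq (fun=> u) | u <- b ::
    s]] (id q))
      = iter_dirder f (b :: s).
    by apply: funext => q; rewrite -map_comp map_id.
  have s1 : (size ([seq (fun=> u) | u <- b :: s] : seq (X -> X)) <= n.+1)%N.
    by rewrite size_map /= ss ltnS ltnW.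
  have s2 : all_continuous x ([seq (fun=> u) | u <- b :: s] : seq (X -> X)).
    by rewrite /all_continuous all_map; apply/allP => u _; apply/asboolP;
      exact: cvg_cst.
  have s3 : {for x, continuous (@id X)} by exact: cvg_id.
  by move=> hc; exact: hc s1 s2 s3 Ux.
have cbQ : nbhs x [set x' | Q (iter_dirder f (b :: s) x')] by exact: cb.
have [e e0 eQ] := near_line a (filterI cbQ (nU Ux)).
have [m [m0 md me]] := min_pos d0 e0.
exists m => // h h0 hm; have [Qh Uh] := eQ h (lt_le_trans hm me).
(* Linearity in the first direction splits off [h *: b]. What remains is a difference quotient at
   fixed [y] and a term that converges by continuity. *)
have -> : h^-1 *: (iter_dirder f (((h *: ((a, b) : X * X) + (x, y)).2) :: s) (h
  *: ((a, b) : X * X) + (x, y)).1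
    - iter_dirder f (y :: s) x) =
    h^-1 *: (iter_dirder f (y :: s) (h *: a + x) - iter_dirder f (y :: s) x) +
    iter_dirder f (b :: s) (h *: a + x).
  rewrite iter_dirder_lin ?ss ?(ltnW sn)// -addrA scalerDr scalerA mulVf// scale1r.
  by rewrite [LHS]addrC.
by apply: (PQ (_, _)); split=> //=; apply: dP => //; exact: lt_le_trans hm md.
Qed.

Lemma iter_dirder_tangent rs x y : (size rs <= n)%N -> U x ->
  iter_dirder (fun p : X * X => dirder p.2 f p.1) (rev rs) (x, y) = Phi rs (x, y).
Proof.
elim: rs x y => [|[a b] rs IH] x y sn Ux; first by rewrite /Phi /= big_nil addr0.
rewrite rev_cons iter_dirder_rcons.
rewrite (@dirder_near _ _ _ _ _ (Phi rs)).
  by apply: dirderE => //; exact: Phi_dir.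
have : nbhs (x, y) (U `*` [set: X]).
  by apply: open_nbhs_nbhs; split=> //; apply: openX => //; exact: openT.
by apply: filterS => -[x' y'] [/= Ux' _]; apply: IH => //; exact: ltnW.
Qed.

Lemma Cseq_tangent :
  Cseq n (U `*` [set: X]) (fun p : X * X => dirder p.2 f p.1).
Proof.
have nUT (x y : X) : U x -> nbhs (x, y) (U `*` [set: X]).
  by move=> Ux; apply: open_nbhs_nbhs; split=> //; apply: openX => //; exact: openT.
split=> [s [x y] [a b] sn [/= Ux _]|P p xx s sn cs cxx [/= Ux _]].
  exists (Phi ((a, b) :: rev s) (x, y)).
  have sn' : (size (rev s) < n)%N by rewrite size_rev.
  apply: (is_dirder_near _ (Phi_dir sn' Ux)).
  apply: filterS (nUT x y Ux) => -[x' y'] [/= Ux' _].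
  by rewrite -iter_dirder_tangent ?size_rev ?(ltnW sn)// revK.
pose rs : seq ((P -> X) * (P -> X)) := rev [seq (fst \o g, snd \o g) | g <- s].
have srs : size rs = size s by rewrite size_rev size_map.
have rsE q : [seq (u.1 q, u.2 q) | u <- rs] = rev [seq g q | g <- s].
  rewrite map_rev -map_comp; congr rev; apply: eq_map => g /=.
  by case: (g q).
have c1 : all_continuous p (unzip1 rs).
  rewrite /all_continuous /unzip1 map_rev all_rev -map_comp all_map.
  apply: sub_all cs => g /asboolP cg; apply/asboolP.
  by apply: continuous_comp => //; exact: cvg_fst.
have c2 : all_continuous p (unzip2 rs).
  rewrite /all_continuous /unzip2 map_rev all_rev -map_comp all_map.
  apply: sub_all cs => g /asboolP cg; apply/asboolP.
  by apply: continuous_comp => //; exact: cvg_snd.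
have cx1 : {for p, continuous (fst \o xx)} by apply: continuous_comp => //;
  exact: cvg_fst.
have cx2 : {for p, continuous (snd \o xx)} by apply: continuous_comp => //;
  exact: cvg_snd.
(* The closed form with the continuous families substituted; its continuity can be checked term by
   term. *)
pose G q := iter_dirder f [seq g q | g <- (snd \o xx) :: rev (unzip1 rs)] ((fst
  \o xx) q) +
   \sum_(t <- terms rs) iter_dirder f [seq g q | g <- t] ((fst \o xx) q).
apply: (@continuous_near_eq _ _ G).
  have : nbhs p ((fst \o xx) @^-1` U) by apply: cx1; exact: nU.
  apply: filterS => q /= Uq.
  have -> : [seq g q | g <- s] = rev [seq (u.1 q, u.2 q) | u <- rs] by
    rewrite rsE revK.
  rewrite [xx q]surjective_pairing iter_dirder_tangent ?size_map ?srs//.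
  rewrite /G /Phi /=; congr (_ + _).
    by rewrite map_rev /unzip1 -!map_comp.
  rewrite (terms_map (fun g : P -> X => g q)) big_map.
  by apply: eq_bigr.
rewrite /G; apply: tvs_cvgD.
  apply: cf.2 => //; first by rewrite /= size_rev size_map srs.
  by rewrite /all_continuous /= all_rev; apply/andP; split;
    [apply/asboolP|exact: c1].
have hts : all (fun t => all_continuous p t && (size t <= n.+1)%N) (terms rs).
  have := terms_size rs; have := terms_all c1 c2.
  rewrite /all_continuous; elim: (terms rs) => //= t ts IH /andP[-> /IH h]
    /andP[/eqP-> /h ->].
  by rewrite srs (leq_trans sn).
elim: (terms rs) hts => [_|t ts IH /= /andP[/andP[ct tn] /IH hts]].
  rewrite big_nil (_ : (fun q => _) = (fun=> 0)); first exact: cvg_cst.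
  by apply: funext => q; rewrite big_nil.
rewrite big_cons (_ : (fun q => _) = (fun q => iter_dirder f [seq g q | g <- t]
  ((fst \o xx) q) +
   \sum_(t <- ts) iter_dirder f [seq g q | g <- t] ((fst \o xx) q))).
  by apply: tvs_cvgD hts; exact: cf.2.
by apply: funext => q; rewrite big_cons.
Qed.
End Tangent.

Lemma Cseq_Cn n (X H : tvsType K) (U : set X) (f : X -> H) :
  hausdorff_space H -> open U -> Cseq n U f -> Ctan n U f.
Proof.
elim: n X U f => [|n IH] X U f hH oU cf.
  split=> // x Ux; apply: (cf.2 X x id [::]) => //; exact: cvg_id.
split.
  by move=> x Ux; apply: (cf.2 X x id [::]) => //; exact: cvg_id.
split; first by move=> x v Ux; exact: (cf.1 [::]).
apply: IH => //; first by apply: openX => //; exact: openT.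
exact: Cseq_tangent.
Qed.

Lemma CfinE n (X H : tvsType K) (U : set X) (f : X -> H) :
  hausdorff_space H -> open U -> is_Cfin n U f <-> Ctan n U f.
Proof.
move=> hH oU; split; first by move/Cfin_Cseq; exact: Cseq_Cn.
by move=> cf; apply/Cseq_Cfin/Ctan_Cseq.
Qed.
End Cfin.

(** * Maps between locally convex direct sums *)

Lemma linear_fun0 (K : pzRingType) (V W : lmodType K) (f : V -> W) :
  linear f -> f 0 = 0.
Proof. by move=> lf; have := lf (-1) 0 0; rewrite scaler0 addr0 scaleN1r addNr. Qed.

Lemma linear_funD (K : pzRingType) (V W : lmodType K) (f : V -> W) u v :
  linear f -> f (u + v) = f u + f v.
Proof. by move=> lf; have := lf 1 u v; rewrite !scale1r. Qed.

Lemma linear_funZ (K : pzRingType) (V W : lmodType K) (f : V -> W) a u :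
  linear f -> f (a *: u) = a *: f u.
Proof. by move=> lf; have := lf a u 0; rewrite (linear_fun0 lf) !addr0. Qed.

Lemma linear_funB (K : pzRingType) (V W : lmodType K) (f : V -> W) u v :
  linear f -> f (u - v) = f u - f v.
Proof.
by move=> lf; rewrite -scaleN1r (linear_funD _ _ lf) (linear_funZ _ _ lf) scaleN1r.
Qed.

Lemma abs_convex_nbhs (K : numFieldType) (V : tvsType K) (U : set V) :
  nbhs 0 U -> exists2 W, nbhs 0 W /\ abs_convex W & W `<=` U.
Proof.
move=> U0; have [B Bconv [Bo Bb]] := @locally_convex _ V.
have [C [BC C0] CU] := Bb _ _ U0.
have oC : open C by exact: Bo.
have /convex_setP Cc : convex_set C by apply: Bconv; exact: mem_set.
(* The balanced core of [C]: a neighbourhood of 0 by continuity of the scaling, and absolutely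
   convex by [main]. *)
pose W := [set x | forall a : K, `|a| <= 1 -> C (a *: x)].
exists W; last by move=> x /(_ 1); rewrite normr1 scale1r => /(_ (lexx _)) /CU.
split.
  have : nbhs ((0, 0) : K^o * V) [set p | C (p.1 *: p.2)].
    apply: (@scale_continuous _ V (0, 0)); rewrite /= scale0r.
    exact: open_nbhs_nbhs.
  case=> -[P Q] /= [P0 Q0] PQ.
  have [d d0 dP] := nbhs0_ball P0.
  have d2 : d / 2 != 0 by rewrite gt_eqF// divr_gt0.
  apply: filterS (nbhs0Z d2 Q0) => _ [y Qy <-] a a1; rewrite scalerA.
  apply: (PQ (_, y)); split=> //=; apply: dP; rewrite normrM.
  rewrite (@le_lt_trans _ _ (d / 2))//.
    by rewrite (gtr0_norm (divr_gt0 d0 _))// ler_piMl// divr_ge0// ltW.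
  by rewrite ltr_pdivrMr// ltr_pMr// ltr1n.
split; first by move=> a _; rewrite scaler0.
have main (x y : V) (a b : K) : `|a| + `|b| <= 1 -> W x -> W y -> C (a *: x + b
  *: y).
  move=> ab Wx Wy.
  have a1 : `|a| <= 1 by apply: le_trans ab; rewrite lerDl.
  have b1 : `|b| <= 1 by apply: le_trans ab; rewrite lerDr.
  have [->|a0] := eqVneq a 0; first by rewrite scale0r add0r; exact: Wy.
  have na0 : `|a| != 0 by rewrite normr_eq0.
  have na1 : 0 <= 1 - `|a| by rewrite subr_ge0.
  have [a1E|na1E] := eqVneq (1 - `|a|) 0.
    have : `|b| <= 0.
      by move: ab; rewrite -(subr0_eq a1E) gerDl.
    by rewrite normr_le0 => /eqP->; rewrite scale0r addr0; exact: Wx.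
  (* A convex combination with weights [|a|] and [1 - |a|]; the phase of [a] and the quotient of [b]
     by [1 - |a|] are absorbed by balancedness. *)
  have := Cc ((a / `|a|) *: x) ((b / (1 - `|a|)) *: y) `|a| (normr_ge0 _) a1.
  rewrite !scalerA mulrCA mulfV// mulr1 mulrCA mulfV// mulr1; apply.
    by apply: Wx; rewrite normrM normfV normr_id mulfV.
  apply: Wy; rewrite normrM normfV (ger0_norm na1) ler_pdivrMr ?mul1r.
    by rewrite lerBrDl.
  by rewrite lt_neqAle eq_sym na1E.
move=> x y a b ab Wx Wy c c1; rewrite scalerDr !scalerA; apply: main => //.
by rewrite !normrM -mulrDr (le_trans _ ab)// ler_piMl// addr_ge0.
Qed.

Section DMap.
Variables (K : pzRingType) (I : eqType).
Implicit Types V W : I -> lmodType K.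

Definition dmap V W (f : forall i, V i -> W i) (v : dsum V) : dsum W :=
  mk_dsum (fun i => f i (v i)).

Lemma dmap_finite V W (f : forall i, V i -> W i) (v : dsum V) :
  (forall i, linear (f i)) -> finite_set [set i | f i (v i) != 0].
Proof.
move=> lf; apply: sub_finite_set (dval_finite v) => i /=.
by apply: contra => /eqP->; rewrite (linear_fun0 (lf i)).
Qed.

Lemma dmapE V W (f : forall i, V i -> W i) (v : dsum V) i :
  (forall i, linear (f i)) -> dmap f v i = f i (v i).
Proof. by move=> lf; apply: mk_dsumE; exact: dmap_finite. Qed.

Lemma dmap_linear V W (f : forall i, V i -> W i) :
  (forall i, linear (f i)) -> linear (dmap f).
Proof.
move=> lf a u v; apply: dsum_eq => i.
by rewrite !(dsumDE, dsumZE, dmapE)// lf.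
Qed.

Lemma dmap_inj V W (f : forall i, V i -> W i) i (x : V i) :
  (forall i, linear (f i)) -> dmap f (dsum_inj V i x) = dsum_inj W i (f i x).
Proof.
move=> lf; apply: dsum_eq => j; rewrite dmapE//.
have [ij|ij] := eqVneq i j; first by subst j; rewrite !dsum_injE.
by rewrite !dsum_inj_neq// (linear_fun0 (lf j)).
Qed.

Lemma dsum_inj_linear V i : linear (dsum_inj V i).
Proof. by move=> a x y; rewrite dsum_injP. Qed.

Lemma dsum_expand V (u : dsum V) (s : seq I) : uniq s ->
  (forall i, i \notin s -> u i = 0) -> u = \sum_(i <- s) dsum_inj V i (u i).
Proof.
elim: s u => [|i s IH] u /= => [_|/andP[si us]] hu.
  by rewrite big_nil; apply: dsum_eq => i; rewrite hu.
rewrite big_cons.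
have -> : \sum_(j <- s) dsum_inj V j (u j) =
    \sum_(j <- s) dsum_inj V j ((u - dsum_inj V i (u i)) j).
  apply: eq_big_seq => j js; rewrite dsumDE dsumNE dsum_inj_neq ?subr0//.
  by apply: contraNneq si => ->.
rewrite -IH//; first by rewrite addrC subrK.
move=> j js; rewrite dsumDE dsumNE.
have [<-|ij] := eqVneq i j; first by rewrite dsum_injE subrr.
by rewrite dsum_inj_neq// subr0 hu// inE negb_or eq_sym ij.
Qed.

End DMap.

(** * Continuity and separation in locally convex direct sums *)

Section DsumTopology.
Variables (L : numFieldType) (I : eqType).
Implicit Types F H : I -> tvsType L.

Lemma dsum_nbhsE F (x : dsum F) (A : set (dsum F)) :
  nbhs x A <-> exists2 W, dsum_nbhs0 W & forall w, W w -> A (x + w).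
Proof. by []. Qed.

(** The universal property of the direct sum: the preimage of an absolutely convex neighbourhood is
    absolutely convex, so only its traces on the summands matter. *)
Lemma dsum_linear_continuous F (H : tvsType L) (T : dsum F -> H) : linear T ->
  (forall i, continuous (fun x : F i => T (dsum_inj F i x))) -> continuous T.
Proof.
move=> lT cT x A Ax.
have [W [W0 Wc] WA] : exists2 W, nbhs 0 W /\ abs_convex W &
    W `<=` [set h | A (T x + h)].
  apply: abs_convex_nbhs.
  have [[P Q] /= [Px Q0] PQ] : nbhs ((T x, 0) : H * H) [set p | A (p.1 + p.2)].
    by apply: (@add_continuous H (_, _)); rewrite /= addr0.
  by apply: filterS Q0 => h Qh; apply: (PQ (_, h)); split=> //=;
    exact: nbhs_singleton.
apply/dsum_nbhsE; exists (T @^-1` W).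
  case: Wc => Wc0 Wc; split; first split.
  - by rewrite /= (linear_fun0 lT).
  - move=> u v a b ab Wu Wv /=; rewrite (linear_funD _ _ lT) !(linear_funZ _ _ lT).
    exact: Wc.
  - by move=> i; apply: cT; rewrite /= (dsum_inj0 F i) (linear_fun0 lT).
by move=> w /WA /=; rewrite -(linear_funD _ _ lT).
Qed.

Lemma dsum_inj_continuous F i : continuous (dsum_inj F i : F i -> dsum F).
Proof.
move=> x A /dsum_nbhsE[W [Wc Wn] WA].
have := Wn i => Wi.
have [[P Q] /= [Px Q0] PQ] : nbhs ((x, - x) : F i * F i)
    [set p | (dsum_inj F i @^-1` W) (p.1 + p.2)].
  by apply: (@add_continuous (F i) (_, _)); rewrite /= subrr.
apply: filterS Px => y Py /=.
have := PQ (y, - x) (conj Py (nbhs_singleton Q0)) => /= /WA.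
by rewrite -(linear_funD _ _ (@dsum_inj_linear _ _ F i)) addrC subrK.
Qed.

Lemma dproj_continuous F j : continuous (fun v : dsum F => v j).
Proof.
apply: dsum_linear_continuous => [a u v//|i].
have [ij|ij] := eqVneq i j.
  subst j; under eq_fun do rewrite dsum_injE.
  by move=> x; exact: cvg_id.
under eq_fun do rewrite dsum_inj_neq//.
by move=> x; exact: cvg_cst.
Qed.

Lemma dsum_hausdorff F :
  (forall i, hausdorff_space (F i)) -> hausdorff_space (dsum F).
Proof.
move=> hF; apply: hausdorff_sep => u v uv.
have [i ui] : exists i, u i <> v i.
  by apply/existsNP => h; apply: uv; exact: dsum_eq.
have [A [B [oA oB Au Bv AB]]] := hausdorff_separate (hF i) ui.
exists ((fun v : dsum F => v i) @^-1` A), ((fun v : dsum F => v i) @^-1` B).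
split; last by move=> z; exact: AB.
  by apply: dproj_continuous; exact: open_nbhs_nbhs.
by apply: dproj_continuous; exact: open_nbhs_nbhs.
Qed.

Lemma dmap_continuous F H (f : forall i, F i -> H i) :
  (forall i, linear (f i)) -> (forall i, continuous (f i)) ->
  continuous (dmap f : dsum F -> dsum H).
Proof.
move=> lf cf; apply: dsum_linear_continuous => [|i]; first exact: dmap_linear.
under eq_fun do rewrite dmap_inj//.
by move=> x; apply: continuous_comp; [exact: cf|exact: dsum_inj_continuous].
Qed.

End DsumTopology.

(** * Direct sums of families of fibrewise linear maps *)

Section Param.
Variables (R : realType) (KL : scalars).
Local Notation K := (baseK R KL).
Local Notation L := (baseL R KL).
Local Notation "V ^r" := (restr R KL V) (at level 2, format "V ^r").

(** The two cases of the theorem in a form that survives the induction: both alternatives pass from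
    [Z] and [F] to their squares. *)
Definition admissible (Z : topologicalType) (I : Type) (F : I -> topologicalType) :=
  (forall z : Z, exists2 C, compact C & nbhs z C) \/
  [/\ countable [set: I], (forall i, k_exhaustible (F i)) & k_exhaustible Z].

Lemma param_ok_square (Z : topologicalType) (I : Type) (F : I -> topologicalType) :
  admissible Z F -> admissible (Z * Z)%type (fun i => (F i * F i)%type).
Proof.
case=> [cZ|[cI kF kZ]]; last by right; split=> // [i|]; exact: k_exhaustible_prod.
left=> -[z z']; have [C cC Cz] := cZ z; have [D cD Dz] := cZ z'.
by exists (C `*` D); [exact: compact_setX|exists (C, D)].
Qed.

Lemma param_tube (Z : tvsType K) (I : Type) (F : I -> topologicalType)
    (p : forall i, F i) (Om : set Z) (O : forall i, set (Z * F i)) (z0 : Z) :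
  admissible Z F -> open Om -> Om z0 ->
  (forall i z, Om z -> nbhs (z, p i) (O i)) ->
  exists2 P, nbhs z0 P & forall i, exists2 V, nbhs (p i) V &
    forall z v, P z -> V v -> O i (z, v).
Proof.
case=> [cZ|[cI kF kZ]] oOm Omz0 hO; last exact: k_exhaustible_family_tube hO.
have [C cC Cz] := cZ z0; exact: (lc_family_tube cC Cz oOm Omz0 hO).
Qed.

Section Continuity.
Variables (Z : tvsType K) (I : eqType) (F H : I -> tvsType L) (Om : set Z).
Variable f : forall i, Z -> F i -> H i.
Hypotheses (oOm : open Om) (pOm : admissible Z F).
Hypothesis lf : forall z, Om z -> forall i, linear (f (i := i) z).
Hypothesis cf : forall i z v, Om z ->
  {for (z, v), continuous (fun p : Z * F i => f p.1 p.2)}.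

Let nOm z : Om z -> nbhs z Om. Proof. by move=> Omz; exact: open_nbhs_nbhs
  (conj oOm Omz). Qed.

(** As [v] has finite support, finitely many neighbourhoods of [z0] suffice; each summand costs one
    halving of [W]. *)
Let near_cst z0 (v : dsum F) W : Om z0 -> dsum_nbhs0 W ->
  nbhs z0 [set z | W (dmap (fun i => f (i := i) z) v - dmap (fun i => f (i :=
    i) z0) v)].
Proof.
move=> Omz0; elim/(@dsum_ind _ _ F): v W => [|i x v IH] W hW.
  apply: filterS (nOm Omz0) => z Omz /=.
  rewrite (linear_fun0 (dmap_linear (lf Omz))) (linear_fun0 (dmap_linear (lf
    Omz0))) subrr.
  by case: hW => -[].
have hW2 := dsum_nbhs0Z 2 hW.
have hx : nbhs z0 [set z | W (2 *: dsum_inj H i (f z x - f z0 x))].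
  have c1 : {for z0, continuous (fun z : Z => f z x - f z0 x)}.
    apply: tvs_cvgD; last exact: cvg_cst.
    apply: (@continuous_comp _ _ _ (fun z : Z => (z, x)) (fun p : Z * F i => f
      p.1 p.2)).
      by apply: continuous_pair_at; [exact: cvg_id|exact: cvg_cst].
    exact: cf.
  have := c1 (dsum_inj H i @^-1` [set w | W (2 *: w)]); apply.
  by rewrite subrr; exact: hW2.2.
have hI := IH _ hW2.
near=> z => /=; have Omz : Om z by near: z; exact: nOm.
rewrite (linear_funD _ _ (dmap_linear (lf Omz))) (linear_funD _ _ (dmap_linear
  (lf Omz0))).
rewrite (dmap_inj _ (lf Omz)) (dmap_inj _ (lf Omz0)).
rewrite opprD addrACA -(linear_funB _ _ (@dsum_inj_linear _ _ H i)).
apply: (dsum_nbhs0_half hW).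
  by near: z; exact: hx.
by near: z; exact: hI.
Unshelve. all: by end_near. Qed.

Lemma dmap_param_continuous z0 (v0 : dsum F) : Om z0 ->
  {for (z0, v0), continuous
    (fun p : Z * dsum F => dmap (fun i => f (i := i) p.1) p.2 : dsum H)}.
Proof.
move=> Omz0 A /dsum_nbhsE[W hW WA].
have hW2 := dsum_nbhs0Z 2 hW.
have [|P Pz0 PV] := @param_tube Z I F (fun=> 0) Om
  (fun i => [set p | Om p.1 -> W (2 *: dsum_inj H i (f p.1 p.2))]) z0 pOm oOm Omz0.
  move=> i z Omz; have : nbhs (z, 0 : F i) [set p : Z * F i |
      W (2 *: dsum_inj H i (f p.1 p.2))].
    apply: (@cf i z 0 Omz (dsum_inj H i @^-1` [set w | W (2 *: w)])).
    by rewrite /= (linear_fun0 (@lf z Omz i)); exact: hW2.2.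
  by apply: filterS => p Wp _.
(* Absolutely convex by linearity, so only its traces on the summands matter. *)
pose V := [set w : dsum F | forall z, P z -> Om z -> W (2 *: dmap (fun i => f
  (i := i) z) w)].
have hV : dsum_nbhs0 V.
  split; first split.
  - move=> z Pz Omz; rewrite (linear_fun0 (dmap_linear (lf Omz))) scaler0.
    by case: hW => -[].
  - move=> u v a b ab Vu Vv z Pz Omz.
    rewrite (linear_funD _ _ (dmap_linear (lf Omz))) !(linear_funZ _ _
      (dmap_linear (lf Omz))).
    by apply: (hW2.1.2 _ _ _ _ ab); [exact: Vu|exact: Vv].
  - move=> i; have [Q Q0 PQ] := PV i; apply: filterS Q0 => x Qx z Pz Omz.
    by rewrite (dmap_inj _ (lf Omz)); exact: PQ.
have hc := near_cst v0 Omz0 hW2.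
exists ([set z | [/\ P z, Om z & W (2 *: (dmap (fun i => f (i := i) z) v0 -
  dmap (fun i => f (i := i) z0) v0))]],
   [set v0 + w | w in V]).
  split => /=; last by apply/dsum_nbhsE; exists V => // w Vw; exists w.
  by near=> z; split; near: z; [exact: Pz0|exact: nOm|exact: hc].
move=> [z _] [/= [Pz Omz Wz] [w Vw <-]].
rewrite (linear_funD _ _ (dmap_linear (lf Omz))).
set a := dmap _ v0; set b := dmap _ v0 in Wz *.
(* The deviation from the value at [(z0, v0)] is the variation in [z] at fixed [v0] plus the image
   of [w], each in half of [W]. *)
rewrite -[a](subrK (dmap (fun i => f (i := i) z0) v0)) addrAC [_ + dmap _ v0]addrC.
by apply: WA; apply: (dsum_nbhs0_half hW) => //; exact: Vw.
Unshelve. all: by end_near. Qed.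
End Continuity.

(** A directional derivative only sees values on a short piece of a line, so the map may be
    exchanged for one on a different space, such as a curve on [K^o]. *)
Lemma is_dirder_line (X X' H : tvsType K) (f : X -> H) (g : X' -> H) x v x' v' l :
  (exists2 d : K, 0 < d & forall h : K, `|h| < d -> f (h *: v + x) = g (h *: v'
    + x')) ->
  is_dirder g x' v' l -> is_dirder f x v l.
Proof.
move=> [d d0 fg] /is_dirderP hg; apply/is_dirderP => A /hg[e e0 eA].
have [m [m0 md me]] := min_pos d0 e0; exists m => // h h0 hm.
have := fg 0; rewrite normr0 !scale0r !add0r => /(_ d0) ->.
by rewrite fg; [apply: eA => //; exact: lt_le_trans me|exact: lt_le_trans md].
Qed.

Lemma is_dirder_clin (X Y H : tvsType K) (f : X -> Y) (A : Y -> H) x v l :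
  linear A -> continuous A -> is_dirder f x v l -> is_dirder (A \o f) x v (A l).
Proof.
move=> lA cA /is_dirderP hf; apply/is_dirderP => B Bl.
have [d d0 dB] := hf _ (cA _ _ Bl); exists d => // h h0 hd.
by have := dB h h0 hd; rewrite /= (linear_funZ _ _ lA) (linear_funB _ _ lA).
Qed.

Section Family.
Variables (Z : tvsType K) (I : eqType) (F H : I -> tvsType L) (Om : set Z).
Variable f : forall i, Z -> F i -> H i.
Hypotheses (oOm : open Om) (hH : forall i, hausdorff_space (H i)).
Hypothesis lf : forall z, Om z -> forall i, linear (f (i := i) z).

Definition fam_map i (p : Z * (F i)^r) : (H i)^r := f p.1 p.2.

Definition fam_sum (p : Z * (dsum F)^r) : (dsum H)^r :=
  dmap (fun i => f (i := i) p.1) p.2.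

(* The tangent map of [f i] with its arguments regrouped, so that it is again
   linear in the last one. *)
Definition fam_tangent i (q : Z * Z) (u : F i * F i) : H i :=
  dirder (q.2, u.2 : (F i)^r) (@fam_map i) (q.1, u.1 : (F i)^r).

Hypothesis df : forall i z (v : F i) (w : Z * (F i)^r), Om z ->
  exists l, is_dirder (@fam_map i) (z, v : (F i)^r) w l.

Let hdf i z (v : F i) y (w : F i) : Om z ->
  is_dirder (@fam_map i) (z, v : (F i)^r) (y, w : (F i)^r)
    (fam_tangent (z, y) (v, w) : (H i)^r).
Proof. by move=> Omz; apply: is_dirder_dirder; exact: df. Qed.

Let nOm z : Om z -> nbhs z Om. Proof. by move=> Omz; exact: open_nbhs_nbhs. Qed.

(** For small [h] the point [h *: y + z] stays in [Om], and the difference quotient is then linear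
    in [(v, w)] over the larger field, as the scalars commute. The limit inherits this. *)
Lemma fam_tangent_linear q : Om q.1 -> forall i, linear (@fam_tangent i q).
Proof.
case: q => z y /= Omz i c [v w] [v' w'].
apply: (@dirderE R KL (Z * (F i)^r)%type ((H i)^r)); first exact: hH.
apply/is_dirderP => A Al.
have [[P Q] /= [Pl Qm] PQ] : nbhs ((fam_tangent (z, y) (v, w), fam_tangent (z,
  y) (v', w')) : H i * H i)
    [set p | A (c *: p.1 + p.2)].
  have cc : {for (fam_tangent (z, y) (v, w), fam_tangent (z, y) (v', w')),
      continuous (fun p : H i * H i => c *: p.1 + p.2)}.
    apply: tvs_cvgD; last exact: cvg_snd.
    by apply: tvs_cvgZ; [exact: cvg_cst|exact: cvg_fst].
  exact: cc.
have /is_dirderP/(_ P Pl)[d d0 dP] := @hdf i z v y w Omz.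
have /is_dirderP/(_ Q Qm)[e e0 eQ] := @hdf i z v' y w' Omz.
have [k k0 kO] := near_line y (nOm Omz).
have [m1 [m10 m1d m1e]] := min_pos d0 e0.
have [m [m0 mm1 mk]] := min_pos m10 k0.
exists m => // h h0 hm.
have Omh : Om (h *: y + z) by apply: kO; exact: lt_le_trans mk.
have hm1 : `|h| < m1 by exact: lt_le_trans mm1.
have := PQ (_, _) (conj (dP h h0 (lt_le_trans hm1 m1d)) (eQ h h0 (lt_le_trans
  hm1 m1e))).
rewrite /fam_map /=; congr A.
pose eh := scal_emb h^-1.
pose a := f (h *: y + z) ((scal_emb h) *: w + v); pose a' := f (h *: y + z)
  ((scal_emb h) *: w' + v').
rewrite -[LHS]/(c *: (eh *: (a - f z v)) + eh *: (a' - f z v')).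
rewrite -[RHS]/(eh *: (f (h *: y + z) (scal_emb h *: (c *: w + w') + (c *: v +
  v')) - f z (c *: v + v'))).
have -> : scal_emb h *: (c *: w + w') + (c *: v + v') =
    c *: (scal_emb h *: w + v) + (scal_emb h *: w' + v').
  by rewrite !scalerDr !scalerA addrACA [c * _]mulrC.
rewrite (lf Omh) (lf Omz) opprD addrACA -scalerBr [RHS]scalerDr !scalerA.
by rewrite [c * _]mulrC.
Qed.

Lemma dpair_finite (V W : I -> lmodType L) (v : dsum V) (w : dsum W) :
  finite_set [set i | ((v i, w i) : V i * W i) != 0].
Proof.
apply: (@sub_finite_set _ _ ([set i | v i != 0] `|` [set i | w i != 0])).
  move=> i /=; have [->|v0 _] := eqVneq (v i) 0; last by left.
  have [->|w0 _] := eqVneq (w i) 0; last by right.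
  by rewrite eqxx.
by rewrite finite_setU; split; exact: dval_finite.
Qed.

Definition dpair (v w : dsum F) : dsum (fun i => (F i * F i)%type) :=
  DSum (dpair_finite v w).

(** Along one line only the common finite support [s] of [v] and [w] is involved, so [fam_sum]
    becomes the finite sum of curves [g], differentiated term by term. *)
Lemma fam_sum_dirder z (v : dsum F) y (w : dsum F) : Om z ->
  is_dirder fam_sum (z, v : (dsum F)^r) (y, w : (dsum F)^r)
    (dmap (fun i => @fam_tangent i (z, y)) (dpair v w) : (dsum H)^r).
Proof.
move=> Omz.
have /finite_seqP[s0 sE] := dpair_finite v w.
pose s := undup s0.
have vs i : i \notin s -> v i = 0 /\ w i = 0.
  rewrite mem_undup => si; apply: contrapT => vw.
  have : [set i | ((v i, w i) : F i * F i) != 0] i.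
    by apply/eqP => -[v0 w0]; apply: vw.
  by rewrite sE /= (negPf si).
pose g (h : K^o) : (dsum H)^r := \sum_(i <- s)
  (dsum_inj H i \o @fam_map i \o (fun h : K^o => h *: ((y, w i : (F i)^r) : Z *
    (F i)^r) + (z, v i : (F i)^r))) h.
have [d d0 dO] := near_line y (nOm Omz).
have lT := fam_tangent_linear (q := (z, y)) Omz.
apply: (@is_dirder_line _ K^o _ _ g _ _ 0 1).
  exists d => // h hd.
  have Omh : Om (h *: y + z) by exact: dO.
  rewrite /g /fam_sum /=.
  have /(_ _) := @dsum_expand _ _ H (dmap (fun i => f (i := i) (h *: y + z)) (h
    *: (w : (dsum F)^r) + v)) s (undup_uniq _).
  move=> -> //; last first.
    move=> i /vs[v0 w0]; rewrite (dmapE _ _ (lf Omh)).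
    apply: etrans (linear_fun0 (@lf _ Omh i)); congr (f _).
    by rewrite -[LHS]/(scal_emb h *: w i + v i) v0 w0 scaler0 addr0.
  apply: eq_bigr => i _; rewrite (dmapE _ _ (lf Omh)).
  by rewrite /fam_map /= addr0 [h *: 1]mulr1.
have /(_ _) := @dsum_expand _ _ H (dmap (fun i => @fam_tangent i (z, y)) (dpair
  v w)) s (undup_uniq _).
move=> -> //; last first.
  move=> i /vs[v0 w0]; rewrite (dmapE _ _ lT) /= v0 w0.
  exact: (linear_fun0 (lT i)).
apply: (@is_dirder_sum R KL I s K^o ((dsum H)^r) _ _ _ _ predT).
  by rewrite all_predT.
move=> i _; apply: (@is_dirder_clin _ ((H i)^r) ((dsum H)^r) _ (dsum_inj H i)).
- by move=> c a b; exact: (@dsum_inj_linear _ _ H i).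
- exact: (@dsum_inj_continuous L I H i).
rewrite (dmapE _ _ lT) /=.
apply: (is_dirder_line _ (@hdf i z (v i) y (w i) Omz)).
by exists 1 => // h _ /=; rewrite addr0 [h *: 1]mulr1.
Qed.
End Family.

Lemma Ctan_dmap n (Z : tvsType K) (I : eqType) (F H : I -> tvsType L) (Om : set Z)
    (f : forall i, Z -> F i -> H i) :
  hausdorff_space Z -> (forall i, hausdorff_space (F i)) ->
  (forall i, hausdorff_space (H i)) -> open Om -> admissible Z F ->
  (forall z, Om z -> forall i, linear (f i z)) ->
  (forall i, Ctan n (Om `*` setT) (@fam_map Z I F H f i)) ->
  Ctan n (Om `*` setT) (@fam_sum Z I F H f).
Proof.
elim: n Z F Om f => [|n IH] Z F Om f hZ hF hH oOm pOm lf cf.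
  split=> // -[z v] [/= Omz _]. 
  apply: (@dmap_param_continuous Z I F H Om f oOm pOm lf _ z v Omz) => i z' v' Omz'.
  exact: (Ctan_cont (x := (z', v' : (F i)^r)) (cf i)).
have hrH : hausdorff_space (dsum H) by exact: dsum_hausdorff.
have hrF : hausdorff_space (dsum F) by exact: dsum_hausdorff.
have hFF i : hausdorff_space (F i * F i)%type by exact: prod_hausdorff.
have df i z (v : F i) (w : Z * (F i)^r) : Om z ->
    exists l, is_dirder (@fam_map Z I F H f i) (z, v : (F i)^r) w l.
  by move=> Omz; have [_ [d _]] := cf i; exact: d.
have dsumf z (v : dsum F) (y : Z) (w : dsum F) (Omz : Om z) :=
  @fam_sum_dirder Z I F H Om f oOm hH lf df z v y w Omz.
split.
  move=> [z v] [/= Omz _].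
  apply: (@dmap_param_continuous Z I F H Om f oOm pOm lf _ z v Omz) => i z' v' Omz'.
  exact: (Ctan_cont (x := (z', v' : (F i)^r)) (cf i)).
split; first by move=> [z v] [y w] [/= Omz _]; eexists; exact: dsumf.
have oOm2 : open (Om `*` [set: Z]) by apply: openX => //; exact: openT.
pose g i (q : Z * Z) (u : F i * F i) := fam_tangent f q u.
have lg q : (Om `*` [set: Z]) q -> forall i, linear (g i q).
  by move=> [Omq _] i; exact: (fam_tangent_linear oOm hH lf df).
have cg i : Ctan n ((Om `*` [set: Z]) `*` setT) (fam_map g (i := i)).
  have [_ [_ cdf]] := cf i.
  (* The linear regrouping of base and fibre components through which [g i] is the tangent map of
     [f i]. *)
  pose tau (p : (Z * Z) * (F i * F i)%type^r) : (Z * (F i)^r) * (Z * (F i)^r) :=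
    ((p.1.1, p.2.1), (p.1.2, p.2.2)).
  have ltau : linear tau by [].
  have ctau : continuous tau.
    move=> p; apply: continuous_pair_at; apply: continuous_pair_at.
    - apply: (@continuous_comp _ _ _ fst fst); [exact: cvg_fst|exact: cvg_fst].
    - apply: (@continuous_comp _ _ _ snd (fst : F i * F i -> F i));
      [exact: cvg_snd|exact: cvg_fst].
    - apply: (@continuous_comp _ _ _ fst snd); [exact: cvg_fst|exact: cvg_snd].
    - apply: (@continuous_comp _ _ _ snd (snd : F i * F i -> F i));
      [exact: cvg_snd|exact: cvg_snd].
  have hZF : hausdorff_space (Z * (F i)^r)%type by apply: prod_hausdorff => //;
    exact: hF.
  have hZFF : hausdorff_space ((Z * Z) * (F i * F i)%type^r)%type.
    by apply: prod_hausdorff; [exact: prod_hausdorff|exact: hFF].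
  have otau : open ((Om `*` [set: Z]) `*` [set: (F i * F i)%type^r]).
    by apply: openX => //; exact: openT.
  apply: (@Ctan_comp R KL n _ _ ((H i)^r) _ ((Om `*` [set: (F i)^r]) `*` setT) tau
    (fun p => dirder p.2 (@fam_map Z I F H f i) p.1)) => //.
  - exact: prod_hausdorff.
  - exact: hH.
  - by do 2 (apply: openX; last exact: openT).
  - have h := Ctan_lin n (prod_hausdorff hZF hZF) ltau ctau.
    by apply: Ctan_sub h.
have cfs := IH _ _ _ _ (prod_hausdorff hZ hZ) hFF hH oOm2 (param_ok_square pOm)
  lg cg.
pose FF i := (F i * F i)%type : tvsType L.
(* The opposite regrouping for the sums, where in addition a pair of elements of the direct sum is
   read in the direct sum of the squares. *)
pose sig (p : (Z * (dsum F)^r) * (Z * (dsum F)^r)) : (Z * Z) * (dsum FF)^r :=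
  ((p.1.1, p.2.1), dpair p.1.2 p.2.2).
have lsig : linear sig.
  move=> a [[z v] [y w]] [[z' v'] [y' w']]; congr pair; exact: dsum_eq.
have cdp : continuous (fun p : dsum F * dsum F => dpair p.1 p.2 : dsum FF).
  (* The continuity criterion concerns linear maps out of one direct sum, so [dpair] is written as a
     sum of such maps, one for each argument. *)
  pose T1 (v : dsum F) : dsum FF := dmap (fun i (x : F i) => (x, 0) : F i * F i) v.
  pose T2 (v : dsum F) : dsum FF := dmap (fun i (x : F i) => (0, x) : F i * F i) v.
  have l1 i : linear (fun x : F i => (x, 0) : F i * F i).
    by move=> a x y; congr pair; rewrite /= scaler0 addr0.
  have l2 i : linear (fun x : F i => (0, x) : F i * F i).
    by move=> a x y; congr pair; rewrite /= scaler0 addr0.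
  have -> : (fun p : dsum F * dsum F => dpair p.1 p.2 : dsum FF) = (fun p => T1
    p.1 + T2 p.2).
    apply: funext => p; apply: dsum_eq => i; rewrite dsumDE /T1 /T2 (dmapE _ _
      l1) (dmapE _ _ l2).
    by congr pair; rewrite /= ?addr0 ?add0r.
  move=> p; apply: tvs_cvgD.
    apply: (@continuous_comp _ _ _ fst T1); first exact: cvg_fst.
    apply: dmap_continuous => // i x; apply: continuous_pair_at;
      [exact: cvg_id|exact: cvg_cst].
  apply: (@continuous_comp _ _ _ snd T2); first exact: cvg_snd.
  apply: dmap_continuous => // i x; apply: continuous_pair_at;
    [exact: cvg_cst|exact: cvg_id].
have csig : continuous sig.
  move=> p.
  apply: (@continuous_pair_at _ (Z * Z)%type (dsum FF)
    (fun p : (Z * (dsum F)^r) * (Z * (dsum F)^r) => (p.1.1, p.2.1)) (fun p =>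
      dpair p.1.2 p.2.2)).
    apply: continuous_pair_at.
    - apply: (@continuous_comp _ _ _ fst fst); [exact: cvg_fst|exact: cvg_fst].
    - apply: (@continuous_comp _ _ _ snd fst); [exact: cvg_snd|exact: cvg_fst].
  apply: (@continuous_comp _ _ _ (fun p : (Z * (dsum F)^r) * (Z * (dsum F)^r)
    => (p.1.2, p.2.2) : dsum F * dsum F)
    (fun p : dsum F * dsum F => dpair p.1 p.2 : dsum FF)); last exact: cdp.
  apply: continuous_pair_at.
  - apply: (@continuous_comp _ _ _ fst (snd : Z * (dsum F)^r -> _));
    [exact: cvg_fst|exact: cvg_snd].
  - apply: (@continuous_comp _ _ _ snd (snd : Z * (dsum F)^r -> _));
    [exact: cvg_snd|exact: cvg_snd].
have hZD : hausdorff_space (Z * (dsum F)^r)%type by exact: prod_hausdorff.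
have hZFF : hausdorff_space ((Z * Z) * (dsum FF)^r)%type.
  by apply: prod_hausdorff; [exact: prod_hausdorff|exact: dsum_hausdorff].
have oU : open ((Om `*` [set: (dsum F)^r]) `*` [set: Z * (dsum F)^r]).
  by do 2 (apply: openX; last exact: openT).
have := @Ctan_comp R KL n _ _ ((dsum H)^r) ((Om `*` [set: (dsum F)^r]) `*` setT)
   ((Om `*` [set: Z]) `*` [set: (dsum FF)^r]) sig _ (prod_hausdorff hZD hZD)
     hZFF hrH oU _ _ _ cfs.
move=> hcomp; apply: (Ctan_ext oU _ (hcomp _ _ _)).
- by move=> [[z v] [y w]] [[/= Omz _] _]; apply/esym/dirderE => //; exact: dsumf.
- by apply: openX; last exact: openT.
- by move=> [[z v] [y w]] [[/= Omz _] _].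
- have h := Ctan_lin n hZFF lsig csig.
  by apply: Ctan_sub h.
Qed.
End Param.

(** * Germs of C^r maps and charts *)

Section Germs.
Variables (R : realType) (KL : scalars) (r : smoothness).
Local Notation K := (baseK R KL).

(* The finite orders of differentiability that suffice to test class [C^r]. *)
Definition class_order (n : nat) : Prop :=
  match r with Cfin m => n = m | Cinfty => True | Comega => False end.

Definition Cr_on (X H : tvsType K) (U : set X) (f : X -> H) : Prop :=
  forall n, class_order n -> Ctan n U f.

(** Working with germs spares the bookkeeping of domains in compositions and changes of charts. *)
Definition Cr_at (X H : tvsType K) (f : X -> H) (x : X) : Prop :=
  exists U, [/\ open U, U x & Cr_on U f].

Hypothesis hr : r <> Comega.

Lemma rn_ex : exists n, class_order n.
Proof. by rewrite /class_order; case: r hr => [n| |//] _; [exists n|exists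
  0%N]. Qed.

Lemma is_CE (X H : tvsType K) (U : set X) (f : X -> H) :
  hausdorff_space H -> open U -> is_C r U f <-> Cr_on U f.
Proof.
move=> hH oU; rewrite /Cr_on /class_order; case: r hr => [n| |//] _ /=.
  by split=> [h _ ->|h]; apply/(CfinE _ _ hH oU) => //; exact: h.
by split=> [h n _|h n]; apply/(CfinE _ _ hH oU) => //; exact: h.
Qed.

Lemma Cr_on_cont (X H : tvsType K) (U : set X) (f : X -> H) x :
  Cr_on U f -> U x -> {for x, continuous f}.
Proof. by have [n hn] := rn_ex; move=> /(_ n hn) cf; exact: (Ctan_cont cf). Qed.

Lemma Cr_at_CnR (X H : tvsType K) (U : set X) (f : X -> H) :
  (forall x, U x -> Cr_at f x) -> Cr_on U f.
Proof.
move=> h n hn; apply: Ctan_local => x /h[V [oV Vx cf]].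
by exists V => //; exact: cf.
Qed.

Lemma Cr_at_near (X H : tvsType K) (f g : X -> H) x :
  (\forall y \near x, f y = g y) -> Cr_at f x -> Cr_at g x.
Proof.
rewrite /prop_near1 nbhsE => -[V [oV Vx] Vfg] [U [oU Ux cf]].
exists (U `&` V); split => //; first exact: openI.
move=> n hn; apply: (@Ctan_ext _ _ n _ _ (U `&` V) f); first exact: openI.
  by move=> y [_ /Vfg].
by apply: Ctan_sub (cf n hn) => y [].
Qed.

Lemma Cr_at_cont (X H : tvsType K) (f : X -> H) x :
  Cr_at f x -> {for x, continuous f}.
Proof. by move=> [U [oU Ux cf]]; exact: Cr_on_cont Ux. Qed.

Lemma Cr_at_comp (X Y H : tvsType K) (f : X -> Y) (g : Y -> H) x :
  hausdorff_space X -> hausdorff_space Y -> hausdorff_space H ->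
  Cr_at f x -> Cr_at g (f x) -> Cr_at (g \o f) x.
Proof.
move=> hX hY hH [U [oU Ux cf]] [V [oV Vx cg]].
pose W := U `&` f @^-1` V.
have oW : open W.
  rewrite openE => y [Uy Vy]; apply: filterI; first exact: open_nbhs_nbhs.
  by apply: (Cr_on_cont cf Uy); exact: open_nbhs_nbhs.
exists W; split => // n hn; apply: (@Ctan_comp _ _ n _ _ _ W V) => //.
  by move=> y [].
  by apply: Ctan_sub (cf n hn) => y [].
exact: cg.
Qed.

Lemma Cr_at_pair (X Y Z : tvsType K) (f : X -> Y) (g : X -> Z) x :
  hausdorff_space Y -> hausdorff_space Z ->
  Cr_at f x -> Cr_at g x -> Cr_at (fun x => (f x, g x)) x.
Proof.
move=> hY hZ [U [oU Ux cf]] [V [oV Vx cg]].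
exists (U `&` V); split => //; first exact: openI.
move=> n hn; apply: Ctan_pair => //; first exact: openI.
  by apply: Ctan_sub (cf n hn) => y [].
by apply: Ctan_sub (cg n hn) => y [].
Qed.

Lemma Cr_at_lin (X Y : tvsType K) (A : X -> Y) x : hausdorff_space Y ->
  linear A -> continuous A -> Cr_at A x.
Proof.
move=> hY lA cA; exists setT; split => //; first exact: openT.
by move=> n _; exact: Ctan_lin.
Qed.

Lemma Cr_at_fst (X Y : tvsType K) x : hausdorff_space X -> @Cr_at (X * Y)%type
  X fst x.
Proof. by move=> hX; apply: Cr_at_lin => // y; exact: cvg_fst. Qed.

Lemma Cr_at_snd (X Y : tvsType K) x : hausdorff_space Y -> @Cr_at (X * Y)%type
  Y snd x.
Proof. by move=> hY; apply: Cr_at_lin => // y; exact: cvg_snd. Qed.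

Lemma chart_near (T X : topologicalType) (c : chart T X) x (A : set T) :
  is_chart c -> chart_dom c x -> nbhs x A ->
  \forall y \near (c x), [/\ chart_dom c (chart_inv c y), c (chart_inv c y) = y &
    A (chart_inv c y)].
Proof.
move=> [odom oimg cK cc ci] cx Ax.
have icx : chart_img c (c x) by exists x.
have h1 : nbhs (c x) (chart_img c) by exact: open_nbhs_nbhs.
have h2 : nbhs (c x) (chart_inv c @^-1` A) by apply: (ci _ icx); rewrite cK.
by apply: filterS2 h1 h2 => _ [z cz <-]; rewrite /= cK.
Qed.

Lemma chart_inv_cont (T X : topologicalType) (c : chart T X) x :
  is_chart c -> chart_dom c x -> {for c x, continuous (chart_inv c)}.
Proof. by move=> [odom oimg cK cc ci] cx; apply: ci; exists x. Qed.

Lemma Cr_at_chart_comp (X1 X2 X3 : tvsType K) (T1 T2 : topologicalType) (T3 : Type)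
    (c : chart T1 X1) (d : chart T2 X2) (e : T3 -> X3)
    (f : T1 -> T2) (g : T2 -> T3) x :
  hausdorff_space X1 -> hausdorff_space X2 -> hausdorff_space X3 ->
  is_chart c -> is_chart d -> chart_dom c x -> chart_dom d (f x) ->
  {for x, continuous f} ->
  Cr_at (d \o f \o chart_inv c) (c x) -> Cr_at (e \o g \o chart_inv d) (d (f x)) ->
  Cr_at (e \o (g \o f) \o chart_inv c) (c x).
Proof.
move=> h1 h2 h3 hc hd cx dfx cf Cf Cg.
have cK : chart_inv c (c x) = x by have [_ _ + _ _] := hc; exact.
apply: (@Cr_at_near _ _ ((e \o g \o chart_inv d) \o (d \o f \o chart_inv c))).
  have dn : nbhs x (f @^-1` chart_dom d).
    by apply: cf; apply: open_nbhs_nbhs; split=> //; case: hd.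
  apply: filterS (chart_near hc cx dn) => y [_ _ /= dy].
  by have [_ _ dK _ _] := hd; rewrite dK.
by apply: Cr_at_comp => //=; rewrite cK.
Qed.

Lemma CmapP (X1 X2 : tvsType K) (T1 T2 : topologicalType)
    (A1 : set (chart T1 X1)) (A2 : set (chart T2 X2)) (O : set T1) (f : T1 -> T2) :
  hausdorff_space X2 -> open O ->
  (forall c, A1 c -> is_chart c) -> (forall d, A2 d -> is_chart d) ->
  is_Cmap r A1 A2 O f <->
  forall x, O x -> {for x, continuous f} /\
    forall c d, A1 c -> A2 d -> chart_dom c x -> chart_dom d (f x) ->
      Cr_at (d \o f \o chart_inv c) (c x).
Proof.
move=> h2 oO hA1 hA2.
have oW c d : (forall x, O x -> {for x, continuous f}) -> A1 c -> A2 d ->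
    open (c @` (chart_dom c `&` O `&` f @^-1` chart_dom d)).
  move=> cf A1c A2d; rewrite openE => _ [x [[cx Ox] dfx] <-].
  have hc := hA1 _ A1c; have [od _ _ _ _] := hA2 _ A2d.
  have nx : nbhs x (O `&` f @^-1` chart_dom d).
    apply: filterI; first exact: open_nbhs_nbhs.
    by apply: cf => //; exact: open_nbhs_nbhs.
  apply: filterS (chart_near hc cx nx) => y [cy cyK [Oy dy]].
  by exists (chart_inv c y) => //; split=> //; split.
split=> [[cf hf] x Ox|hf].
  split=> [|c d A1c A2d cx dfx]; first exact: cf.
  exists (c @` (chart_dom c `&` O `&` f @^-1` chart_dom d)); split.
  - exact: oW.
  - by exists x.
  - by apply/is_CE => //; [exact: oW|exact: hf].
have cf x : O x -> {for x, continuous f} by move=> /hf[].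
split=> // c d A1c A2d; apply/is_CE => //; first exact: oW.
apply: Cr_at_CnR => _ [x [[cx Ox] dfx] <-].
by have [_] := hf x Ox; exact.
Qed.

Lemma prod_chart_is_chart (T1 X1 T2 X2 : topologicalType)
    (c1 : chart T1 X1) (c2 : chart T2 X2) :
  is_chart c1 -> is_chart c2 -> is_chart (prod_chart c1 c2).
Proof.
move=> [o1 i1 K1 cc1 ci1] [o2 i2 K2 cc2 ci2].
have imgE : chart_img (prod_chart c1 c2) = chart_img c1 `*` chart_img c2.
  rewrite predeqE => -[y1 y2]; split=> [[[x1 x2] [/= d1 d2] [<- <-]]|].
    by split; [exists x1|exists x2].
  by move=> [[x1 d1 /= <-] [x2 d2 /= <-]]; exists (x1, x2).
split; rewrite ?imgE.
- exact: openX.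
- exact: openX.
- by move=> [x1 x2] [/= d1 d2]; rewrite K1// K2.
- move=> [x1 x2] [/= d1 d2]; apply: continuous_pair_at.
    by apply: (@continuous_comp _ _ _ fst c1); [exact: cvg_fst|exact: cc1].
  by apply: (@continuous_comp _ _ _ snd c2); [exact: cvg_snd|exact: cc2].
- move=> [x1 x2] [/= d1 d2]; apply: continuous_pair_at.
    by apply: (@continuous_comp _ _ _ fst (chart_inv c1));
      [exact: cvg_fst|exact: ci1].
  by apply: (@continuous_comp _ _ _ snd (chart_inv c2));
    [exact: cvg_snd|exact: ci2].
Qed.

Definition id_chart (X : Type) : chart X X :=
  {| chart_dom := setT; chart_fun := id; chart_inv := id |}.

Lemma id_chart_is_chart (X : topologicalType) : is_chart (id_chart X).
Proof.
split => //; [exact: openT| |by move=> x _; exact: cvg_id|by move=> x _;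
  exact: cvg_id].
rewrite (_ : chart_img _ = setT); first exact: openT.
by rewrite predeqE => x; split => // _; exists x.
Qed.

End Germs.

(** * Gluing a topology from charts *)

Section Glue.
Variables (T : Type) (X : topologicalType) (A : set (chart T X)).

Record glue_ok : Prop := GlueOk {
  glueK : forall c x, A c -> chart_dom c x -> chart_inv c (c x) = x;
  glue_img : forall c, A c -> open (chart_img c);
  glue_overlap : forall c d x, A c -> A d -> chart_dom c x -> chart_dom d x ->
    (\forall y \near c x, chart_dom d (chart_inv c y)) /\
    {for c x, continuous (d \o chart_inv c)};
}.

(** The proof [h] is a parameter of the alias, so that the topology, whose axioms depend on it, can
    be attached to the type. *)
Definition glued (h : glue_ok) : Type := T.

Variable h : glue_ok.
Local Notation GT := (glued h).

HB.instance Definition _ := gen_eqMixin GT.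
HB.instance Definition _ := gen_choiceMixin GT.

Definition glue_open (O : set GT) : Prop :=
  forall c : chart T X, A c -> open (c @` (chart_dom c `&` O)).

Lemma glue_openT : glue_open setT.
Proof. by move=> c Ac; rewrite setIT; exact: (glue_img h). Qed.

Lemma glue_openI : setI_closed glue_open.
Proof.
move=> O P oO oP c Ac.
rewrite (_ : c @` _ = c @` (chart_dom c `&` O) `&` c @` (chart_dom c `&` P)).
  by apply: openI; [exact: oO|exact: oP].
rewrite predeqE => y; split=> [[x [cx [Ox Px]] <-]|].
  by split; exists x.
move=> [[x [cx Ox] <-] [x' [cx' Px'] xx']].
have E : x' = x by rewrite -(glueK h Ac cx) -xx' (glueK h Ac cx').
by exists x => //; split=> //; split=> //; rewrite -E.
Qed.

Lemma glue_open_bigU (J : Type) (O : J -> set GT) :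
  (forall j, glue_open (O j)) -> glue_open (\bigcup_j O j).
Proof.
move=> oO c Ac; rewrite (_ : c @` _ = \bigcup_j (c @` (chart_dom c `&` O j))).
  by apply: bigcup_open => j _; exact: oO.
rewrite predeqE => y; split=> [[x [cx [j _ Ojx]] <-]|[j _ [x [cx Ojx] <-]]].
  by exists j => //; exists x.
by exists x => //; split=> //; exists j.
Qed.

HB.instance Definition _ :=
  isOpenTopological.Build GT glue_openT glue_openI glue_open_bigU.

(** The overlap condition is what makes the preimage of an open set under one chart open when read
    in every other chart. *)
Lemma glue_is_chart (c : chart T X) : A c -> @is_chart GT X c.
Proof.
move=> Ac.
have near_dom (d : chart T X) x : A d -> chart_dom d x -> \forall y \near d x,
  chart_img d y.
  by move=> Ad dx; apply: open_nbhs_nbhs; split; [exact: (glue_img h)|exists x].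
have open_pre (B : set X) : open B -> glue_open [set x | chart_dom c x /\ B (c x)].
  move=> oB d Ad; rewrite openE => _ [x [dx [cx Bcx]] <-].
  have [dc dcont] := glue_overlap h Ad Ac dx cx.
  have dB : nbhs (d x) [set y | B (c (chart_inv d y))].
    by apply: dcont; rewrite /= (glueK h Ad dx); exact: open_nbhs_nbhs.
  apply: filterS3 (near_dom d x Ad dx) dc dB => _ [z dz <-].
  move=> /=; rewrite (glueK h Ad dz) => cz Bcz.
  by exists z => //; split=> //; split.
split.
- change (glue_open (chart_dom c)).
  rewrite (_ : chart_dom c = [set x | chart_dom c x /\ setT (c x)]).
    by apply: open_pre; exact: openT.
  by rewrite predeqE => x; split=> [|[]].
- exact: (glue_img h Ac).
- by move=> x; exact: (glueK h Ac).
- move=> x cx B; rewrite nbhsE => -[B' [oB' B'cx] B'B].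
  have : nbhs (x : GT) [set x | chart_dom c x /\ B' (c x)].
    by apply: open_nbhs_nbhs; split=> //; exact: open_pre.
  by apply: filterS => z [_ /B'B].
- move=> _ [x cx <-] O; rewrite (glueK h Ac cx) nbhsE => -[O' [oO' O'x] O'O].
  have : nbhs (c x) (c @` (chart_dom c `&` O')).
    by apply: open_nbhs_nbhs; split; [exact: oO'|exists x].
  by apply: filterS => _ [z [cz O'z] <-]; rewrite /= (glueK h Ac cz); exact: O'O.
Qed.

End Glue.

(** * Local trivializations in charts *)

Lemma existT_inj (M : Type) (E : M -> Type) x (u v : E x) :
  existT E x u = existT E x v -> u = v.
Proof.
move=> /(congr1 (fun e : {x : M & E x} =>
  match pselect (projT1 e = x) with
  | left p => ecast z (E z) p (projT2 e)
  | right _ => u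
  end)) /=; case: pselect => // p.
by rewrite (Prop_irrelevance p erefl).
Qed.

Section Triv.
Variables (R : realType) (KL : scalars) (r : smoothness).
Local Notation K := (baseK R KL).
Local Notation L := (baseL R KL).
Local Notation "V ^r" := (restr R KL V) (at level 2, format "V ^r").
Hypothesis hr : r <> Comega.

Section Fibre.
Variables (M : Type) (F : tvsType L) (E : M -> lmodType L).
Variable psi : total_space E -> M * F.

Definition fib x (w : E x) : F := (psi (existT _ x w)).2.
(* Junk (namely [0]) when [v] is not attained, in particular possibly when [x]
   lies outside of the domain of the trivialization. *)
Definition fib_inv x (v : F) : E x := xget 0 [set w | fib w = v].
Definition triv_inv (p : M * F) : total_space E := existT _ p.1 (fib_inv p.1 p.2).
End Fibre.

Definition triv_chart (M : Type) (X : tvsType K) (F : tvsType L) (c : chart M X) :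
    chart (M * F^r) (X * F^r) :=
  prod_chart c (id_chart F^r).

Section Local.
Variables (X : tvsType K) (M : topologicalType) (AM : set (chart M X)).
Hypothesis hM : is_manifold r AM.
Variables (F : tvsType L) (E : M -> lmodType L) (S : total_structure E).
Hypotheses (hF : hausdorff_space F).
Hypothesis hpi : continuous (@projT1 M E : ts_space S -> M).
Hypothesis hS : @is_manifold R KL r (ts_model S) (ts_space S) (@ts_atlas _ _ _ _ S).

Section OneTriv.
Variables (U : set M) (psi : total_space E -> M * F).
Hypothesis lt : local_triv r AM S U psi.

Lemma triv_fst x (w : E x) : U x -> (psi (existT _ x w)).1 = x.
Proof.
have [_ _ h _] := lt; move=> Ux.
have : (psi @` [set e | projT1 e = x]) (psi (existT _ x w)) by exists (existT _
  x w).
by rewrite h// => -[].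
Qed.

Lemma fib_linear x : U x -> linear (fun w : E x => fib psi w).
Proof. by have [_ _ _ h] := lt; exact: h. Qed.

Let psi_inj e e' : U (projT1 e) -> U (projT1 e') -> psi e = psi e' -> e = e'.
Proof.
have [_ [g [gK _ _ _]] _ _] := lt.
by move=> /gK[_ {2}<-] /gK[_ {2}<-] ->.
Qed.

Lemma fib_inj x (w w' : E x) : U x -> fib psi w = fib psi w' -> w = w'.
Proof.
move=> Ux ww'; apply: (@existT_inj M E x); apply: psi_inj => //.
by rewrite [LHS]surjective_pairing [RHS]surjective_pairing !triv_fst//; congr pair.
Qed.

Lemma fib_invK x v : U x -> fib psi (fib_inv psi x v) = v.
Proof.
move=> Ux; suff [w wv] : exists w : E x, fib psi w = v.
  by have /(xgetPex (0 : E x)) : exists w, [set w : E x | fib psi w = v] w by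
    exists w.
have [_ _ h _] := lt.
have : ([set x] `*` [set: F]) (x, v) by [].
rewrite -h// => -[[x' w] /= xx']; subst x' => pw.
by exists w; rewrite /fib pw.
Qed.

Lemma fibK x (w : E x) : U x -> fib_inv psi x (fib psi w) = w.
Proof. by move=> Ux; apply: fib_inj => //; rewrite fib_invK. Qed.

Lemma fib_inv_linear x : U x -> linear (fib_inv psi x).
Proof.
move=> Ux a u v; apply: fib_inj => //.
by rewrite (fib_linear Ux) !fib_invK.
Qed.

Lemma triv_tinv p : U p.1 -> psi (triv_inv psi p) = p.
Proof.
case: p => x v /= Ux; rewrite [LHS]surjective_pairing triv_fst//.
by congr pair; exact: fib_invK.
Qed.

Lemma tinv_triv e : U (projT1 e) -> triv_inv psi (psi e) = e.
Proof.
case: e => x w /= Ux; apply: psi_inj => //=; first by rewrite triv_fst.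
by rewrite triv_tinv// triv_fst.
Qed.

Let hcM c : AM c -> is_chart c. Proof. by have [_ _ h _ _] := hM; exact: h. Qed.
Let hX : hausdorff_space X. Proof. by case: hM. Qed.
Let hcS a : ts_atlas a -> @is_chart (ts_space S) (ts_model S) a.
Proof. by have [_ _ h _ _] := hS; exact: h. Qed.
Let hXF : hausdorff_space (X * F^r)%type. Proof. exact: prod_hausdorff. Qed.

Let pcP : forall c, prod_atlas AM (@model_atlas F^r) c -> is_chart c.
Proof.
move=> _ [c AMc [d -> <-]]; apply: prod_chart_is_chart; first exact: hcM.
exact: id_chart_is_chart.
Qed.

Let pcA c : AM c -> prod_atlas AM (@model_atlas F^r) (triv_chart F c).
Proof. by move=> AMc; exists c => //; exists (id_chart F^r). Qed.

Let oU : open [set e : ts_space S | U (projT1 e)].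
Proof. by apply: open_comp; [move=> e _; exact: hpi|case: lt]. Qed.

Lemma triv_cont (e : ts_space S) : U (projT1 e) ->
  {for e, continuous (psi : ts_space S -> M * F^r)}.
Proof. by have [_ [g [_ _ [cf _] _]] _ _] := lt; exact: cf. Qed.

Lemma triv_Cat (a : chart (ts_space S) (ts_model S)) c (e : ts_space S) :
  ts_atlas a -> AM c -> U (projT1 e) -> chart_dom a e -> chart_dom c (projT1 e) ->
  Cr_at r (triv_chart F c \o (psi : ts_space S -> M * F^r) \o chart_inv a) (a e).
Proof.
move=> Sa AMc Ue ae ce; have [_ [g [_ _ cf _]] _ _] := lt.
have [_] := (CmapP hr _ hXF oU hcS pcP).1 cf e Ue; apply => //; first exact: pcA.
by split=> //=; case: e Ue {ae} ce => x w /= Ux; rewrite triv_fst.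
Qed.

(** Over [U] the fibrewise inverse agrees with the inverse [g] provided by the diffeomorphism, from
    which it receives its regularity. *)
Let tinvE g : (forall y, (U `*` setT) y -> U (projT1 (g y)) /\ psi (g y) = y) ->
  forall p, U p.1 -> triv_inv psi p = g p.
Proof.
move=> gK p Up; have [|Ug pg] := gK p _; first by split.
by rewrite -{1}pg tinv_triv.
Qed.

Let oUT : open (U `*` [set: F^r]).
Proof. by apply: openX; [case: lt|exact: openT]. Qed.

Lemma tinv_cont (p : M * F^r) : U p.1 ->
  {for p, continuous (triv_inv psi : M * F^r -> ts_space S)}.
Proof.
move=> Up; have [_ [g [_ gK _ [cg _]]] _ _] := lt.
apply: continuous_near_eq (cg p _); last by split.
have : nbhs p (U `*` [set: F^r]) by apply: open_nbhs_nbhs.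
by apply: filterS => q [Uq _]; rewrite (tinvE gK).
Qed.

Lemma tinv_Cat (a : chart (ts_space S) (ts_model S)) c (p : M * F^r) :
  ts_atlas a -> AM c -> U p.1 -> chart_dom c p.1 -> chart_dom a (triv_inv psi p) ->
  Cr_at r (a \o (triv_inv psi : M * F^r -> ts_space S) \o chart_inv (triv_chart
    F c)) (triv_chart F c p).
Proof.
move=> Sa AMc Up cp ap; have [_ [g [_ gK _ cg]] _ _] := lt.
have hTS : hausdorff_space (ts_model S) by case: hS.
have [|_] := (CmapP (T2 := ts_space S) hr _ hTS oUT pcP hcS).1 cg p _; first by
  split.
move=> /(_ (triv_chart F c) a (pcA AMc) Sa) h.
have pcc := pcP (pcA AMc).
have {}h := h (conj cp I); rewrite -(tinvE gK Up) in h.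
apply: Cr_at_near (h ap).
have Un : nbhs p (U `*` [set: F^r]) by apply: open_nbhs_nbhs.
apply: filterS (chart_near pcc (conj cp I) Un) => y [_ _ [/= Uy _]].
by rewrite (tinvE gK).
Qed.
End OneTriv.

Let hcM c : AM c -> is_chart c. Proof. by have [_ _ h _ _] := hM; exact: h. Qed.
Let hX : hausdorff_space X. Proof. by case: hM. Qed.
Let hcS a : ts_atlas a -> @is_chart (ts_space S) (ts_model S) a.
Proof. by have [_ _ h _ _] := hS; exact: h. Qed.
Let hXF : hausdorff_space (X * F^r)%type. Proof. exact: prod_hausdorff. Qed.
Let hTS : hausdorff_space (ts_model S). Proof. by case: hS. Qed.
Let coverS (e : total_space E) : exists2 a, ts_atlas a & chart_dom (a : chart
  (ts_space S) (ts_model S)) e.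
Proof. by have [_ _ _ h _] := hS; exact: h. Qed.

Let hFr : hausdorff_space F^r. Proof. exact: hF. Qed.

Lemma pc_is_chart c : AM c -> is_chart (triv_chart F c).
Proof.
by move=> AMc; apply: prod_chart_is_chart; [exact: hcM|exact: id_chart_is_chart].
Qed.

(** A chart of the total space at [triv_inv psi (x, v)] serves as intermediate station between the
    two trivializations. *)
Lemma trans_Cat (U U' : set M) (psi psi' : total_space E -> M * F) c x (v : F^r) :
  local_triv r AM S U psi -> local_triv r AM S U' psi' ->
  AM c -> U x -> U' x -> chart_dom c x ->
  Cr_at r (fun q : X * F^r => fib psi' (fib_inv psi (chart_inv c q.1) q.2) : F^r)
    (c x, v).
Proof.
move=> lt lt' AMc Ux U'x cx.
have [a Sa ax] := coverS (triv_inv psi (x, v)).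
have C1 := @tinv_Cat U psi lt a c (x, v) Sa AMc Ux cx ax.
have C2 := @triv_Cat U' psi' lt' a c (triv_inv psi (x, v)) Sa AMc U'x ax cx.
have C3 := Cr_at_chart_comp hr hXF hTS hXF (pc_is_chart AMc) (hcS Sa)
  (conj cx I : chart_dom (triv_chart F c) (x, v)) ax (tinv_cont lt (p := (x,
    v)) Ux) C1 C2.
exact: (Cr_at_comp hr hXF hXF hFr C3 (Cr_at_snd _ _ hFr)).
Qed.

Section Action.
Variables (Y : tvsType K) (G : preTopologicalGroupType) (AG : set (chart G Y)).
Variables (alpha : G -> M -> M) (beta : forall g x, {linear E x -> E (alpha g x)}).
Hypotheses (hY : hausdorff_space Y) (hcG : forall c, AG c -> is_chart c).
Hypothesis hbeta : @is_Cmap R KL r (Y * ts_model S)%type (ts_model S)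
  (G * ts_space S)%type (ts_space S)
  (prod_atlas AG (@ts_atlas _ _ _ _ S)) (@ts_atlas _ _ _ _ S) setT
  (fun p => total_action beta p.1 p.2).

Lemma action_Cat (U U' : set M) (psi psi' : total_space E -> M * F) k c g x (v
  : F^r) :
  local_triv r AM S U psi -> local_triv r AM S U' psi' ->
  AG k -> AM c -> chart_dom k g -> chart_dom c x -> U x -> U' (alpha g x) ->
  Cr_at r (fun q : (Y * X) * F^r => fib psi' (beta (chart_inv k q.1.1)
    (chart_inv c q.1.2)
     (fib_inv psi (chart_inv c q.1.2) q.2)) : F^r) ((k g, c x), v).
Proof.
move=> lt lt' AGk AMc kg cx Ux U'gx.
have hkk := hcG AGk.
have [a Sa ax] := coverS (triv_inv psi (x, v)).
set e := triv_inv psi (x, v) in ax *.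
have [a' Sa' a'x] := coverS (total_action beta g e).
have [c' AMc' c'x] : exists2 c', AM c' & chart_dom c' (alpha g x).
  by have [_ _ _ h _] := hM; exact: h.
have C1 := @tinv_Cat U psi lt a c (x, v) Sa AMc Ux cx ax.
have hGS : forall d, prod_atlas AG (@ts_atlas _ _ _ _ S) d -> @is_chart (G *
  ts_space S)%type (Y * ts_model S)%type d.
  by move=> _ [d1 h1 [d2 h2 <-]]; apply: prod_chart_is_chart;
    [exact: hcG|exact: hcS].
have [cact Cact] := (CmapP (T1 := (G * ts_space S)%type) (T2 := ts_space S) hr
  _ hTS openT hGS hcS).1 hbeta (g, e) I.
have ka : prod_atlas AG (@ts_atlas _ _ _ _ S) (prod_chart k a) by exists k =>
  //; exists a.
have {}Cact := Cact _ _ ka Sa' (conj kg ax) a'x.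
have C2 := @triv_Cat U' psi' lt' a' c' (total_action beta g e) Sa' AMc' U'gx
  a'x c'x.
have hYXF : hausdorff_space (Y * (X * F^r))%type by exact: prod_hausdorff.
have hYS : hausdorff_space (Y * ts_model S)%type by exact: prod_hausdorff.
pose gt (p : G * (M * F^r)) : G * ts_space S := (p.1, triv_inv psi p.2).
have kcg : chart_dom (prod_chart k (triv_chart F c)) (g, (x, v)) by [].
have hkc : is_chart (prod_chart k (triv_chart F c)).
  by apply: prod_chart_is_chart => //; exact: pc_is_chart.
have cgt : {for (g, (x, v)), continuous gt}.
  apply: continuous_pair_at; first exact: cvg_fst.
  apply: (@continuous_comp _ _ _ snd (triv_inv psi : M * F^r -> ts_space S));
    first exact: cvg_snd.
  exact: (tinv_cont lt (p := (x, v)) Ux).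
have Cgt : Cr_at r (prod_chart k a \o gt \o chart_inv (prod_chart k (triv_chart
  F c)))
    (prod_chart k (triv_chart F c) (g, (x, v))).
  apply: (@Cr_at_near _ _ _ (Y * (X * F^r))%type (Y * ts_model S)%type (fun q
    => (q.1, (a \o (triv_inv psi : M * F^r -> ts_space S) \o chart_inv
    (triv_chart F c)) q.2))).
    apply: filterS (chart_near hkc kcg filterT) => -[y q] [_ [/= ky _] _].
    by rewrite /= ky.
  apply: Cr_at_pair => //; first exact: Cr_at_fst.
  exact: (Cr_at_comp hr hYXF hXF hTS (Cr_at_snd _ _ hXF)).
have C3 := Cr_at_chart_comp hr hYXF hYS hTS hkc (prod_chart_is_chart hkk (hcS Sa))
   kcg (conj kg ax : chart_dom (prod_chart k a) (gt (g, (x, v)))) cgt Cgt Cact.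
have c3 : {for (g, (x, v)), continuous ((fun p => total_action beta p.1 p.2 :
  ts_space S) \o gt)}.
  by apply: continuous_comp; [exact: cgt|exact: cact].
have C4 := Cr_at_chart_comp (T2 := ts_space S) hr hYXF hTS hXF hkc (hcS Sa')
  kcg a'x c3 C3 C2.
have C5 := Cr_at_comp hr hYXF hXF hFr C4 (Cr_at_snd _ _ hFr).
(* The action is read on [Y * (X * F^r)], but the family of fibre maps has parameter space [Y * X];
   a linear reassociation mediates. *)
pose asc (q : (Y * X) * F^r) : Y * (X * F^r) := (q.1.1, (q.1.2, q.2)).
have Casc : Cr_at r asc ((k g, c x), v).
  apply: Cr_at_lin; [exact: hYXF|by []|move=> q].
  apply: (@continuous_pair_at _ Y (X * F^r)%type (fun q : (Y * X) * F^r =>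
    q.1.1) (fun q => (q.1.2, q.2))).
    by apply: (@continuous_comp _ _ _ fst fst); [exact: cvg_fst|exact: cvg_fst].
  apply: (@continuous_pair_at _ X F^r (fun q : (Y * X) * F^r => q.1.2) snd);
    last exact: cvg_snd.
  by apply: (@continuous_comp _ _ _ fst snd); [exact: cvg_fst|exact: cvg_snd].
have hYX : hausdorff_space ((Y * X) * F^r)%type.
  by apply: prod_hausdorff => //; exact: prod_hausdorff.
exact: (Cr_at_comp hr hYX hYXF hFr Casc C5).
Qed.
End Action.
End Local.
End Triv.

(** * The direct sum bundle *)

Lemma chart_image_open (T X : topologicalType) (c : chart T X) (A : set T) :
  is_chart c -> open A -> open (c @` (chart_dom c `&` A)).
Proof.
move=> hc oA; rewrite openE => _ [x [cx Ax] <-].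
have nA : nbhs x A by apply: open_nbhs_nbhs.
apply: filterS (chart_near hc cx nA) => y [cy cyK Ay].
by exists (chart_inv c y).
Qed.

(** For maps whose continuity is known only through a reading in charts. Nearby points must be
    mapped into the domain of [d], since elsewhere [chart_inv d] does not recover the value of
    [f]. *)
Lemma cont_via_charts (T1 T2 X1 X2 : topologicalType) (c : chart T1 X1)
    (d : chart T2 X2) (f : T1 -> T2) x :
  is_chart c -> is_chart d -> chart_dom c x ->
  (\forall x' \near x, chart_dom d (f x')) ->
  {for c x, continuous (d \o f \o chart_inv c)} -> {for x, continuous f}.
Proof.
move=> hc hd cx dfx cf; have [oc ic cK cc ci] := hc; have [od id dK cd di] := hd.
apply: (@continuous_near_eq _ _ (chart_inv d \o (d \o f \o chart_inv c) \o c)).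
  have nc : nbhs x (chart_dom c) by exact: open_nbhs_nbhs.
  by apply: filterS2 nc dfx => y cy dy /=; rewrite cK// dK.
apply: continuous_comp; first exact: cc.
apply: continuous_comp; first exact: cf.
by rewrite /= cK//; apply: chart_inv_cont => //; exact: nbhs_singleton dfx.
Qed.

Section SumBundle.
Variables (R : realType) (KL : scalars) (r : smoothness).
Local Notation K := (baseK R KL).
Local Notation L := (baseL R KL).
Local Notation "V ^r" := (restr R KL V) (at level 2, format "V ^r").
Hypothesis hr : r <> Comega.

Lemma Cr_on_dmap (Z : tvsType K) (I : eqType) (F H : I -> tvsType L) (Om : set Z)
    (f : forall i, Z -> F i -> H i) :
  hausdorff_space Z -> (forall i, hausdorff_space (F i)) ->
  (forall i, hausdorff_space (H i)) -> open Om -> admissible Z F ->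
  (forall z, Om z -> forall i, linear (f i z)) ->
  (forall i, Cr_on r (Om `*` setT) (@fam_map R KL Z I F H f i)) ->
  Cr_on r (Om `*` setT) (@fam_sum R KL Z I F H f).
Proof. by move=> hZ hF hH oOm pOm lf cf n hn; apply: Ctan_dmap => // i;
  exact: cf. Qed.

Section CommonTriv.
Variables (X : tvsType K) (M : topologicalType) (AM : set (chart M X)).
Hypothesis hM : is_manifold r AM.
Variables (F : tvsType L) (E : M -> lmodType L) (S S' : total_structure E).

Lemma vbundle_pi (T : total_structure E) : is_vbundle r AM F T ->
  continuous (@projT1 M E : ts_space T -> M).
Proof. by move=> [_ _ _ [c _] _] e; exact: c. Qed.

(** Locally the identity is a common trivialization followed by its inverse, the former being
    regular for [S] and the latter for [S']. *)
Lemma id_Cmap_of_common_trivs : is_vbundle r AM F S -> is_vbundle r AM F S' ->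
  (forall x, exists U (psi : total_space E -> M * F),
    [/\ U x, local_triv r AM S U psi & local_triv r AM S' U psi]) ->
  @is_Cmap R KL r (ts_model S) (ts_model S') (ts_space S) (ts_space S')
    (@ts_atlas _ _ _ _ S) (@ts_atlas _ _ _ _ S') setT id.
Proof.
move=> vS vS' hc; have piS := vbundle_pi vS; have piS' := vbundle_pi vS'.
have [hF mS _ _ _] := vS; have [_ mS' _ _ _] := vS'.
have [hX _ hcM cM _] := hM.
have [hXS _ hcS _ _] := mS; have [hXS' _ hcS' _ _] := mS'.
have hXF : hausdorff_space (X * F^r)%type by apply: prod_hausdorff => //; exact: hF.
apply/(CmapP (T1 := ts_space S) (T2 := ts_space S') hr _ hXS' openT hcS hcS').
move=> e _; have [U [psi [Ux lt lt']]] := hc (projT1 e).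
have [c AMc cx] := cM (projT1 e).
have eK (e' : total_space E) : U (projT1 e') -> triv_inv psi (psi e') = e'.
  by move=> Ue'; exact: (tinv_triv lt).
have nU : nbhs (e : ts_space S) [set e' | U (projT1 e')].
  by apply: piS; apply: open_nbhs_nbhs; split=> //; case: lt.
have pe : (psi e).1 = projT1 e by case: (e) Ux => x w Ux; exact: (triv_fst lt).
have Upe : U (psi e).1 by rewrite pe.
have cpsi := triv_cont lt Ux.
split.
  apply: (@continuous_near_eq (ts_space S) (ts_space S') (triv_inv psi \o psi)).
    by apply: filterS nU => e' /eK.
  apply: (@continuous_comp (ts_space S) (M * F^r)%type (ts_space S')).
    exact: cpsi.
  exact: (tinv_cont lt').
move=> a d Sa Sd ae de.
have C1 := triv_Cat hr hM hF piS mS lt Sa AMc Ux ae cx.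
have cpe : chart_dom c (psi e).1 by rewrite pe.
have dpe : chart_dom d (triv_inv psi (psi e)) by rewrite eK.
have C2 := tinv_Cat hr hM mS' lt' Sd AMc Upe cpe dpe.
have C3 := Cr_at_chart_comp (T1 := ts_space S) (T3 := ts_space S') hr hXS hXF hXS'
  (hcS _ Sa) (pc_is_chart hM F AMc) ae (conj cpe I) cpsi C1 C2.
apply: Cr_at_near C3; apply: filterS (chart_near (hcS _ Sa) ae nU) => y [_ _ Uy] /=.
by rewrite eK.
Qed.
End CommonTriv.
End SumBundle.

(** * Gluing the total space of the direct sum from its trivializations *)

Section SumStructure.
Variables (R : realType) (KL : scalars) (r : smoothness).
Local Notation K := (baseK R KL).
Local Notation L := (baseL R KL).
Local Notation "V ^r" := (restr R KL V) (at level 2, format "V ^r").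
Hypothesis hr : r <> Comega.
Variables (X : tvsType K) (M : topologicalType) (AM : set (chart M X)).
Hypothesis hM : is_manifold r AM.
Variables (I : eqType) (F : I -> tvsType L) (E : I -> M -> lmodType L).
Variable S : forall i, total_structure (E i).
Hypothesis hV : forall i, is_vbundle r AM (F i) (S i).
Hypothesis pX : admissible X F.

Local Notation D := (dsum F).
Local Notation SE := (sum_fibre E).
Local Notation trivs := (forall i, total_space (E i) -> M * F i).
Implicit Types (psi : trivs) (U : set M) (c : chart M X).

Let hX : hausdorff_space X. Proof. by case: hM. Qed.
Let hMT : hausdorff_space M. Proof. by case: hM. Qed.
Let hcM c : AM c -> is_chart c. Proof. by have [_ _ h _ _] := hM; exact: h. Qed.
Let cM x : exists2 c, AM c & chart_dom c x. Proof. by have [_ _ _ h _] := hM;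
  exact: h. Qed.
Let hF i : hausdorff_space (F i). Proof. by case: (hV i). Qed.
Let hD : hausdorff_space D. Proof. exact: dsum_hausdorff. Qed.
Let hDr : hausdorff_space D^r. Proof. exact: hD. Qed.
Let hXD : hausdorff_space (X * D^r)%type. Proof. exact: prod_hausdorff. Qed.

Definition local_trivs U psi := open U /\ forall i, local_triv r AM (S i) U (psi i).

Definition sum_triv_inv psi (p : M * D) : total_space SE :=
  existT _ p.1 (dmap (fun i => fib_inv (psi i) p.1) p.2 : SE p.1).

Lemma sum_triv_sinv U psi psi' x (v : D) :
  local_trivs U psi -> U x ->
  sum_triv psi' (sum_triv_inv psi (x, v)) =
  (x, dmap (fun i v => fib (psi' i) (fib_inv (psi i) x v)) v).
Proof.
move=> [_ lt] Ux; congr pair; rewrite /dmap; congr mk_dsum.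
apply: functional_extensionality_dep => i /=.
by rewrite (dmapE _ _ (fun i => fib_inv_linear (lt i) Ux)).
Qed.

Lemma sinvK U psi p : local_trivs U psi -> U p.1 -> sum_triv psi (sum_triv_inv
  psi p) = p.
Proof.
case: p => x v lt /= Ux; rewrite (sum_triv_sinv _ _ lt Ux); congr pair.
have idE i : (fun v => fib (psi i) (fib_inv (psi i) x v)) = id.
  by apply: funext => w; rewrite (fib_invK (lt.2 i)).
apply: dsum_eq => i; rewrite dmapE; first by rewrite (fib_invK (lt.2 i)).
by move=> j; rewrite idE.
Qed.

Lemma sum_trivK U psi e : local_trivs U psi -> U (projT1 e) ->
  sum_triv_inv psi (sum_triv psi e) = e.
Proof.
case: e => x w lt /= Ux; rewrite /sum_triv_inv /=; congr existT; apply: dsum_eq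
  => i.
rewrite (dmapE _ _ (fun i => fib_inv_linear (lt.2 i) Ux)).
rewrite (mk_dsumE (f := fun i => (psi i (existT _ x (w i))).2)); last first.
  exact: (dmap_finite w (fun i => fib_linear (lt.2 i) Ux)).
exact: (fibK (lt.2 i)).
Qed.

Definition sum_chart c U psi : chart (total_space SE) (X * D^r) :=
  {| chart_dom := [set e | U (projT1 e) /\ chart_dom c (projT1 e)];
     chart_fun := fun e => (c (projT1 e), (sum_triv psi e).2 : D^r);
     chart_inv := fun q => sum_triv_inv psi (chart_inv c q.1, q.2 : D) |}.

(** Every family of trivializations over a common open set contributes charts, so compatibility with
    all such families is built into the structure. *)
Definition sum_atlas : set (chart (total_space SE) (X * D^r)) :=
  [set C | exists c U psi, [/\ AM c, local_trivs U psi & C = sum_chart c U psi]].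

Lemma sum_trans_Cat U psi U' psi' c x (v : D^r) :
  local_trivs U psi -> local_trivs U' psi' -> AM c -> U x -> U' x ->
  chart_dom c x ->
  Cr_at r (fun q : X * D^r =>
    (sum_triv psi' (sum_triv_inv psi (chart_inv c q.1, q.2 : D))).2 : D^r) (c x, v).
Proof.
move=> lt lt' AMc Ux U'x cx.
pose Om := c @` (chart_dom c `&` (U `&` U')).
have cK y : chart_dom c y -> chart_inv c (c y) = y.
  by have [_ _ h _ _] := hcM AMc; exact: h.
have oOm : open Om by apply: chart_image_open; [exact: hcM|apply: openI; [case:
  lt|case: lt']].
pose f i z (w : F i) := fib (psi' i) (fib_inv (psi i) (chart_inv c z) w).
have lf z : Om z -> forall i, linear (f i z).
  move=> [y [cy [Uy U'y]] <-] i a u w; rewrite /f cK//.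
  by rewrite (fib_inv_linear (lt.2 i) Uy) (fib_linear (lt'.2 i) U'y).
have cf : Cr_on r (Om `*` setT) (@fam_sum R KL X I F F f).
  apply: Cr_on_dmap => // i; apply: Cr_at_CnR => -[_ w] [/= [y [cy [Uy U'y]] <-] _].
  have [_ mS _ _ _] := hV i.
  exact: (trans_Cat hr hM (@hF i) (vbundle_pi (hV i)) mS w (lt.2 i) (lt'.2 i)
    AMc Uy U'y cy).
have oOT : open (Om `*` [set: D^r]) by apply: openX => //; exact: openT.
have OmT : (Om `*` [set: D^r]) (c x, v) by split=> //; exists x.
apply: (@Cr_at_near _ _ _ _ _ (@fam_sum R KL X I F F f)).
  have : nbhs (c x, v) (Om `*` [set: D^r]) by apply: open_nbhs_nbhs.
  apply: filterS => -[_ w] [/= [y [cy [Uy U'y]] <-] _].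
  rewrite [RHS](congr1 snd (sum_triv_sinv _ (w : D) lt _)) /fam_sum /= /f ?cK//.
by exists (Om `*` setT).
Qed.

Lemma base_trans_Cat c d x : AM c -> AM d -> chart_dom c x -> chart_dom d x ->
  Cr_at r (d \o chart_inv c) (c x).
Proof.
move=> AMc AMd cx dx; have [_ _ _ _ h] := hM.
have oW : open (c @` (chart_dom c `&` chart_dom d)).
  by apply: chart_image_open; [exact: hcM|case: (hcM AMd)].
exists (c @` (chart_dom c `&` chart_dom d)); split => //; first by exists x.
by apply/is_CE => //; exact: h.
Qed.

(* All the maps below read in charts as this one: a change of charts of [M]
   together with the direct sum of the transition maps of the [E i]. *)
Lemma sum_local_Cat U psi U' psi' c d x (v : D^r) :
  local_trivs U psi -> local_trivs U' psi' -> AM c -> AM d -> U x -> U' x ->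
  chart_dom c x -> chart_dom d x ->
  Cr_at r (fun q : X * D^r => (d (chart_inv c q.1),
    (sum_triv psi' (sum_triv_inv psi (chart_inv c q.1, q.2 : D))).2 : D^r)) (c
      x, v).
Proof.
move=> lt lt' AMc AMd Ux U'x cx dx; apply: Cr_at_pair => //.
  apply: (@Cr_at_comp _ _ _ hr _ _ _ fst (d \o chart_inv c)) => //.
    exact: Cr_at_fst.
  exact: base_trans_Cat.
exact: sum_trans_Cat lt lt' _ _ _ _.
Qed.

Lemma sum_glue_ok : glue_ok sum_atlas.
Proof.
split.
- move=> _ e [c [U [psi [AMc lt ->]]]] [/= Ue ce].
  have [_ _ cK _ _] := hcM AMc; rewrite cK//.
  rewrite -[RHS](sum_trivK lt Ue); congr sum_triv_inv.
- move=> _ [c [U [psi [AMc lt ->]]]].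
  rewrite (_ : chart_img _ = (c @` (chart_dom c `&` U)) `*` [set: D^r]).
    apply: openX; last exact: openT.
    by apply: chart_image_open; [exact: hcM|case: lt].
  rewrite predeqE => -[y v]; split.
    by move=> [e [/= Ue ce] [<- _]]; split=> //; exists (projT1 e).
  move=> [/= [x [cx Ux] <-] _]; exists (sum_triv_inv psi (x, v)) => //=.
  by rewrite -[(c x, _)]/(c x, (sum_triv psi (sum_triv_inv psi (x, v))).2)
    (sinvK (p := (x, v)) lt).
- move=> _ _ e [c [U [psi [AMc lt ->]]]] [c' [U' [psi' [AMc' lt' ->]]]] [/= Ue
  ce] [/= U'e c'e].
  split.
    have nU : nbhs (projT1 e) (U' `&` chart_dom c').
      apply: filterI; apply: open_nbhs_nbhs; split=> //; first by case: lt'.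
      by case: (hcM AMc').
    have := chart_near (hcM AMc) ce nU => h.
    have h2 : nbhs ((c (projT1 e), (sum_triv psi e).2 : D^r) : X * D^r)
        (fst @^-1` [set y | (U' `&` chart_dom c') (chart_inv c y)]).
      by apply: cvg_fst; apply: filterS h => y [].
    by apply: filterS h2 => q [].
  exact: (Cr_at_cont hr (sum_local_Cat (sum_triv psi e).2 lt lt' AMc AMc' Ue
    U'e ce c'e)).
Qed.

Definition sum_space : topologicalType := glued sum_glue_ok.

Definition sum_structure : total_structure SE :=
  @TotalStructure R KL M SE (Topological.class sum_space) (X * D^r)%type sum_atlas.

Let T := sum_structure.

Lemma sum_is_chart C : sum_atlas C -> @is_chart (ts_space T) (X * D^r)%type C.
Proof. exact: glue_is_chart. Qed.

Hypothesis cov : forall x, exists U psi, U x /\ local_trivs U psi.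

Let chart_at (e : total_space SE) : exists c U psi,
  [/\ AM c, local_trivs U psi, U (projT1 e) & chart_dom c (projT1 e)].
Proof.
by have [U [psi [Ux lt]]] := cov (projT1 e); have [c AMc cx] := cM (projT1 e);
  exists c, U, psi.
Qed.

Lemma sum_pi : continuous (@projT1 M SE : ts_space T -> M).
Proof.
move=> e; have [c [U [psi [AMc lt Ue ce]]]] := chart_at e.
have SC : sum_atlas (sum_chart c U psi) by exists c, U, psi.
have hC := sum_is_chart SC; have Ce : chart_dom (sum_chart c U psi) e by [].
have [_ _ cK _ _] := hcM AMc.
have [oC _ _ cC _] := hC.
apply: (@continuous_near_eq _ _ (chart_inv c \o fst \o (sum_chart c U psi :
  ts_space T -> (X * D^r)%type))).
  have nC : nbhs (e : ts_space T) (chart_dom (sum_chart c U psi)) by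
    exact: open_nbhs_nbhs.
  by apply: filterS nC => e' [_ /= ce']; rewrite cK.
apply: continuous_comp; first exact: cC.
apply: continuous_comp; first exact: cvg_fst.
by apply: chart_inv_cont => //; exact: hcM.
Qed.

(** Distinct base points are separated in [M], while two points of one fibre lie in a common chart
    domain. *)
Lemma sum_hausdorff : hausdorff_space (ts_space T).
Proof.
apply: hausdorff_sep => e e' ee'.
have [xx|xx] := pselect (projT1 e = projT1 e'); last first.
  have [A [B [oA oB Ax Bx AB]]] := hausdorff_separate hMT xx.
  exists (@projT1 _ _ @^-1` A), (@projT1 _ _ @^-1` B); split.
  - by apply: sum_pi; exact: open_nbhs_nbhs.
  - by apply: sum_pi; exact: open_nbhs_nbhs.
  - by move=> z; exact: AB.
have [c [U [psi [AMc lt Ue ce]]]] := chart_at e.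
have SC : sum_atlas (sum_chart c U psi) by exists c, U, psi.
pose C := sum_chart c U psi.
have hC : @is_chart (ts_space T) (X * D^r)%type C := sum_is_chart SC.
have [_ _ CK cC _] := hC.
have Ce : chart_dom C e by [].
have Ce' : chart_dom C e' by rewrite /C /= -xx.
have Cne : C e <> C e' by move=> CE; apply: ee'; rewrite -(CK _ Ce) CE CK.
have [A [B [oA oB Ax Bx AB]]] := hausdorff_separate hXD Cne.
exists (C @^-1` A), (C @^-1` B); split.
- by apply: (cC _ Ce); exact: open_nbhs_nbhs.
- by apply: (cC _ Ce'); exact: open_nbhs_nbhs.
- by move=> z; exact: AB.
Qed.

Lemma sum_manifold :
  @is_manifold R KL r (X * D^r)%type (ts_space T) sum_atlas.
Proof.
split.
- exact: hXD.
- exact: sum_hausdorff.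
- exact: sum_is_chart.
- move=> e; have [c [U [psi [AMc lt Ue ce]]]] := chart_at e.
  by exists (sum_chart c U psi) => //; exists c, U, psi.
- move=> C C' SC SC'; have hC := sum_is_chart SC; have hC' := sum_is_chart SC'.
  apply/is_CE => //.
    by apply: (@chart_image_open (ts_space T)) => //; case: hC'.
  apply: Cr_at_CnR => _ [e [Ce C'e] <-]; move: SC SC' Ce C'e.
  move=> [c [U [psi [AMc lt ->]]]] [c' [U' [psi' [AMc' lt' ->]]]] [/= Ue ce]
    [/= U'e c'e].
  exact: (sum_local_Cat (sum_triv psi e).2 lt lt' AMc AMc' Ue U'e ce c'e).
Qed.

Let pc_chart c : AM c -> is_chart (triv_chart D c).
Proof. by move=> AMc; exact: (pc_is_chart hM D AMc). Qed.

Let pcP : forall k : chart (M * D^r) (X * D^r), prod_atlas AM (@model_atlas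
  D^r) k -> is_chart k.
Proof.
move=> _ [c AMc [d -> <-]]; apply: prod_chart_is_chart; first exact: hcM.
exact: id_chart_is_chart.
Qed.

Lemma sum_local_triv U psi : local_trivs U psi ->
  local_triv r AM T U (sum_triv psi).
Proof.
move=> lt; have oU := lt.1; split => //.
- exists (sum_triv_inv psi); split.
  + by move=> e Ue; split=> //; exact: (sum_trivK lt Ue).
  + by move=> p [Up _]; split=> //; exact: (sinvK lt Up).
  + have oUT : open [set e : ts_space T | U (projT1 e)].
      by apply: open_comp => // e _; exact: sum_pi.
    apply/(CmapP (T1 := ts_space T) hr _ hXD oUT sum_is_chart pcP) => e Ue.
    have main c d U' psi' : AM c -> AM d -> local_trivs U' psi' -> U' (projT1 e) ->
        chart_dom c (projT1 e) -> chart_dom d (projT1 e) ->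
        Cr_at r (triv_chart D d \o (sum_triv psi : ts_space T -> M * D^r) \o
          chart_inv (sum_chart c U' psi'))
          (sum_chart c U' psi' e).
      move=> AMc AMd lt' U'e ce de.
      exact: (sum_local_Cat (sum_triv psi' e).2 lt' lt AMc AMd U'e Ue ce de).
    split; last first.
      move=> _ _ [c [U' [psi' [AMc lt' ->]]]] [d AMd [i -> <-]] [/= U'e ce] [/=
        de _].
      exact: (main c d U' psi').
    have [c AMc ce] := cM (projT1 e).
    have SC : sum_atlas (sum_chart c U psi) by exists c, U, psi.
    have hC := sum_is_chart SC.
    (* Continuity is extracted from the regularity of the reading in charts. *)
    apply: (cont_via_charts hC (pc_chart AMc) (x := e)) => //.
      have : nbhs (e : ts_space T) (@projT1 _ _ @^-1` chart_dom c).
        by apply: sum_pi; apply: open_nbhs_nbhs; split=> //; case: (hcM AMc).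
      by apply: filterS.
    by apply: (Cr_at_cont hr); exact: main.
  + have oUT : open (U `*` [set: D^r]) by apply: openX => //; exact: openT.
    apply/(CmapP (T2 := ts_space T) hr _ hXD oUT pcP sum_is_chart) => -[x v]
      [/= Ux _].
    have main c d U' psi' : AM c -> AM d -> local_trivs U' psi' -> U' x ->
        chart_dom c x -> chart_dom d x ->
        Cr_at r (sum_chart c U' psi' \o (sum_triv_inv psi : M * D^r -> ts_space
          T) \o chart_inv (triv_chart D d))
          (triv_chart D d (x, v)).
      move=> AMc AMd lt' U'x cx dx.
      exact: (sum_local_Cat v lt lt' AMd AMc Ux U'x dx cx).
    split; last first.
      move=> _ _ [d AMd [i -> <-]] [c [U' [psi' [AMc lt' ->]]]] [/= dx _] [/=
        U'x cx].
      exact: (main c d U' psi').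
    have [c AMc cx] := cM x.
    have SC : sum_atlas (sum_chart c U psi) by exists c, U, psi.
    have hC := sum_is_chart SC.
    apply: (cont_via_charts (pc_chart AMc) hC (x := (x, v))) => //.
      have : nbhs ((x, v) : M * D^r) ((U `&` chart_dom c) `*` setT).
        apply: open_nbhs_nbhs; split=> //; apply: openX; last exact: openT.
        by apply: openI => //; case: (hcM AMc).
      by apply: filterS => q [].
    by apply: (Cr_at_cont hr); exact: main.
- move=> y Uy; rewrite predeqE => -[x v]; split.
    by move=> [e /= <- [<- _]].
  by move=> [/= -> _]; exists (sum_triv_inv psi (y, v)) => //; exact: (sinvK (p
    := (y, v)) lt).
- move=> y Uy a u w; exact: (dmap_linear (fun i => fib_linear (lt.2 i) Uy)).
Qed.

Lemma sum_vbundle : is_vbundle r AM D T.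
Proof.
split.
- exact: hD.
- exact: sum_manifold.
- by move=> x; exists (existT _ x (0 : SE x) : total_space SE).
- apply/(CmapP (T1 := ts_space T) hr _ hX openT sum_is_chart hcM) => e _.
  split; first exact: sum_pi.
  move=> _ d [c [U [psi [AMc lt ->]]]] AMd [/= Ue ce] de.
  apply: (@Cr_at_comp _ _ _ hr _ _ _ fst (d \o chart_inv c)) => //.
    exact: Cr_at_fst.
  exact: base_trans_Cat.
- move=> x; have [U [psi [Ux lt]]] := cov x.
  by exists U, (sum_triv psi); split=> //; exact: sum_local_triv.
Qed.

(** * The group action on the direct sum bundle *)

Section Action.
Variables (Y : tvsType K) (G : preTopologicalGroupType) (AG : set (chart G Y)).
Hypotheses (hY : hausdorff_space Y) (hcG : forall k, AG k -> is_chart k).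
Hypothesis coverG : forall g, exists2 k, AG k & chart_dom k g.
Variable alpha : G -> M -> M.
Hypothesis act_alpha : is_action alpha.
Hypothesis halpha : is_Cmap r (prod_atlas AG AM) AM setT (fun p : G * M =>
  alpha p.1 p.2).
Variable beta : forall i g x, {linear E i x -> E i (alpha g x)}.
Hypothesis hE : forall i, is_equivariant_vbundle r AM (F i) (S i) AG (beta i).
Hypothesis pYX : admissible (Y * X)%type F.

(** The fibres over [alpha (g * h) x] and [alpha g (alpha h x)] are only propositionally equal, so
    the action laws are compared in the total spaces of the summands. *)
Lemma existT_sum x y (u : SE x) (v : SE y) : x = y ->
  (forall i, existT (fun x => E i x : Type) x (u i) = existT _ y (v i)) ->
  existT (fun x => SE x : Type) x u = existT _ y v.
Proof.
move=> xy; subst y => uv; congr existT; apply: dsum_eq => i.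
exact: existT_inj (uv i).
Qed.

Lemma sum_is_action : is_action (total_action (sum_action beta)).
Proof.
split=> [[x w]|g h [x w]]; apply: existT_sum.
- exact: act_alpha.1.
- by move=> i; have [_ [h1 _] _] := hE i; exact: (h1 (existT _ x (w i))).
- exact: act_alpha.2.
- by move=> i; have [_ [_ h2] _] := hE i; exact: (h2 g h (existT _ x (w i))).
Qed.

Let hYX : hausdorff_space (Y * X)%type. Proof. exact: prod_hausdorff. Qed.

Let hGM k : prod_atlas AG AM k -> is_chart k.
Proof.
by move=> [k1 h1 [k2 h2 <-]]; apply: prod_chart_is_chart; [exact: hcG|exact: hcM].
Qed.

Let alphaP := (CmapP hr _ hX openT hGM hcM).1 halpha.

Lemma sum_action_Cat U psi U' psi' k c g x (v : D^r) :
  local_trivs U psi -> local_trivs U' psi' -> AG k -> AM c ->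
  chart_dom k g -> chart_dom c x -> U x -> U' (alpha g x) ->
  Cr_at r (fun q : (Y * X) * D^r => (sum_triv psi' (total_action (sum_action beta)
    (chart_inv k q.1.1) (sum_triv_inv psi (chart_inv c q.1.2, q.2 : D)))).2 : D^r)
    ((k g, c x), v).
Proof.
move=> lt lt' AGk AMc kg cx Ux U'gx.
pose kc := prod_chart k c.
have hkc : is_chart kc by apply: hGM; exists k => //; exists c.
(* Both the base point and its image lie over trivializing sets; on the image of [W] in charts the
   fibre maps are linear. *)
pose W := [set p : G * M | U p.2 /\ U' (alpha p.1 p.2)].
have oW : open W.
  apply: (@openI _ [set p : G * M | U p.2] [set p | U' (alpha p.1 p.2)]).
    by apply: open_comp; [move=> p _; exact: cvg_snd|case: lt].
  apply: (@open_comp _ _ (fun p : G * M => alpha p.1 p.2) U'); last by case: lt'.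
  by move=> p _; exact: (@alphaP p Logic.I).1.
pose Om := kc @` (chart_dom kc `&` W).
have oOm : open Om by exact: chart_image_open.
have cK y : chart_dom c y -> chart_inv c (c y) = y.
  by have [_ _ h _ _] := hcM AMc; exact: h.
have kK y : chart_dom k y -> chart_inv k (k y) = y.
  by have [_ _ h _ _] := hcG AGk; exact: h.
pose f i (z : Y * X) (w : F i) := fib (psi' i) (beta i (chart_inv k z.1)
  (chart_inv c z.2)
  (fib_inv (psi i) (chart_inv c z.2) w)).
have lf z : Om z -> forall i, linear (f i z).
  move=> [[h y] [[/= kh cy] [/= Uy U'y]] <-] i a u w; rewrite /f /= cK// kK//.
  by rewrite (fib_inv_linear (lt.2 i) Uy) linearP (fib_linear (lt'.2 i) U'y).
have cf : Cr_on r (Om `*` setT) (@fam_sum R KL (Y * X)%type I F F f).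
  apply: Cr_on_dmap => // i; apply: Cr_at_CnR => -[_ w] [/= [[h y] [[/= kh cy]
    [/= Uy U'y]] <-] _].
  have [_ mS _ _ _] := hV i; have [_ _ hb] := hE i.
  exact: (action_Cat hr hM (@hF i) (vbundle_pi (hV i)) mS hY hcG hb w (lt.2 i)
    (lt'.2 i) AGk AMc kh cy Uy U'y).
have oOT : open (Om `*` [set: D^r]) by apply: openX => //; exact: openT.
have OmT : (Om `*` [set: D^r]) ((k g, c x), v) by split=> //; exists (g, x).
apply: (@Cr_at_near _ _ _ _ _ (@fam_sum R KL (Y * X)%type I F F f)).
  have : nbhs ((k g, c x), v) (Om `*` [set: D^r]) by apply: open_nbhs_nbhs.
  apply: filterS => -[_ w] [/= [[h y] [[/= kh cy] [/= Uy U'y]] <-] _].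
  rewrite /fam_sum /dmap /=; congr mk_dsum;
    apply: functional_extensionality_dep => i.
  rewrite /f /= /fib /= cK//.
  by rewrite (dmapE _ _ (fun i => fib_inv_linear (lt.2 i) Uy)).
by exists (Om `*` setT).
Qed.

Lemma sum_action_Cmap :
  @is_Cmap R KL r (Y * (X * D^r))%type (X * D^r)%type
    (G * ts_space T)%type (ts_space T)
    (prod_atlas AG sum_atlas) sum_atlas setT
    (fun p => total_action (sum_action beta) p.1 p.2).
Proof.
have hGT (C : chart (G * ts_space T) (Y * (X * D^r))) : prod_atlas AG sum_atlas
  C -> is_chart C.
  by move=> [k1 h1 [k2 h2 <-]]; apply: prod_chart_is_chart;
    [exact: hcG|exact: sum_is_chart].
apply/(CmapP (T1 := (G * ts_space T)%type) (T2 := ts_space T) hr _ hXD openT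
  hGT sum_is_chart).
move=> [g e] _.
have main k c c' U psi U' psi' : AG k -> AM c -> AM c' -> local_trivs U psi ->
  local_trivs U' psi' ->
   chart_dom k g -> chart_dom c (projT1 e) -> chart_dom c' (alpha g (projT1 e)) ->
   U (projT1 e) -> U' (alpha g (projT1 e)) ->
   Cr_at r (sum_chart c' U' psi' \o (fun p : G * ts_space T => total_action
     (sum_action beta) p.1 p.2) \o
     chart_inv (prod_chart k (sum_chart c U psi))) (prod_chart k (sum_chart c U
       psi) (g, e)).
  move=> AGk AMc AMc' lt lt' kg ce c'e Ue U'e.
  pose v := (sum_triv psi e).2.
  (* Moves the coordinate of the base point next to that of the group element, giving the parameter
     space [Y * X]. *)
  pose asc (q : Y * (X * D^r)) : (Y * X) * D^r := ((q.1, q.2.1), q.2.2).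
  have hYXD : hausdorff_space (Y * (X * D^r))%type by exact: prod_hausdorff.
  have hYX_D : hausdorff_space ((Y * X) * D^r)%type by exact: prod_hausdorff.
  have Casc q : Cr_at r asc q.
    apply: Cr_at_lin; [exact: hYX_D|by []|move=> q'].
    apply: (@continuous_pair_at _ (Y * X)%type D^r (fun q : Y * (X * D^r) =>
      (q.1, q.2.1)) (fun q => q.2.2)).
      apply: (@continuous_pair_at _ Y X (fun q : Y * (X * D^r) => q.1) (fun q
        => q.2.1)); first exact: cvg_fst.
      by apply: (@continuous_comp _ _ _ snd fst); [exact: cvg_snd|exact: cvg_fst].
    by apply: (@continuous_comp _ _ _ snd snd); [exact: cvg_snd|exact: cvg_snd].
  have Calpha := (@alphaP (g, projT1 e) Logic.I).2 (prod_chart k c) c' _ AMc'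
    (conj kg ce) c'e.
  have {}Calpha := Calpha (ex_intro2 _ _ k AGk (ex_intro2 _ _ c AMc erefl)).
  have CA := @sum_action_Cat U psi U' psi' k c g (projT1 e) v lt lt' AGk AMc kg
    ce Ue U'e.
  have C1 : Cr_at r (fun q : (Y * X) * D^r => c' (alpha (chart_inv k q.1.1)
    (chart_inv c q.1.2)))
      ((k g, c (projT1 e)), v).
    have C0 := Cr_at_fst r ((k g, c (projT1 e)), v : D^r) hYX.
    exact: (Cr_at_comp hr hYX_D hYX hX C0 Calpha).
  have C2 := Cr_at_pair hX hDr C1 CA.
  exact: (Cr_at_comp hr hYXD hYX_D hXD (Casc (k g, (c (projT1 e), v))) C2).
(* Membership in the domain of a chart of the sum depends on base points alone, so continuity of
   [alpha] and of the projection suffices. *)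
have dual c' U' : AM c' -> open U' -> U' (alpha g (projT1 e)) -> chart_dom c'
  (alpha g (projT1 e)) ->
    \forall p \near ((g, e) : G * ts_space T), (U' `&` chart_dom c') (alpha p.1
      (projT1 p.2)).
  move=> AMc' oU' U'e c'e.
  have ca : {for ((g, e) : G * ts_space T), continuous (fun p : G * ts_space T
    => alpha p.1 (projT1 p.2))}.
    apply: (@continuous_comp _ (G * M)%type _ (fun p : G * ts_space T => (p.1,
      projT1 p.2)) (fun p : G * M => alpha p.1 p.2)).
      apply: continuous_pair_at; first exact: cvg_fst.
      by apply: (@continuous_comp _ (ts_space T) M snd (@projT1 _ _));
        [exact: cvg_snd|exact: sum_pi].
    exact: (@alphaP (g, projT1 e) Logic.I).1.
  apply: ca; apply: open_nbhs_nbhs; split=> //; apply: openI => //.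
  by case: (hcM AMc').
split; last first.
  move=> _ _ [k AGk [_ [c [U [psi [AMc lt ->]]]] <-]] [c' [U' [psi' [AMc' lt'
    ->]]]] [/= kg [Ue ce]] [/= U'e c'e].
  exact: (main k c c' U psi U' psi').
have [c [U [psi [AMc lt Ue ce]]]] := chart_at e.
have [c' [U' [psi' [AMc' lt' U'e c'e]]]] := chart_at (total_action (sum_action
  beta) g e).
have [k AGk kg] := coverG g.
have SC : sum_atlas (sum_chart c U psi) by exists c, U, psi.
have SC' : sum_atlas (sum_chart c' U' psi') by exists c', U', psi'.
have hkC := prod_chart_is_chart (hcG AGk) (sum_is_chart SC).
apply: (cont_via_charts hkC (sum_is_chart SC') (x := (g, e))) => //.
  exact: dual lt'.1 U'e c'e.
apply: (Cr_at_cont hr); exact: (main k c c' U psi U' psi').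
Qed.
End Action.
End SumStructure.

(** * Assembly under the finite-dimensional and the k_omega hypotheses *)

Lemma fd_compact_nbhs (R : realType) (KL : scalars) (X : tvsType (baseK R KL)) :
  hausdorff_space X -> finite_dimensional X ->
  forall x : X, exists2 C : set X, compact C & nbhs x C.
Proof.
move=> hX fX x; have [C cC C0] := fd_locally_compact hX fX.
exists (+%R x @` C); last exact: nbhsT.
apply: continuous_compact => //; apply: continuous_subspaceT => y.
by apply: tvs_cvgD; [exact: cvg_cst|exact: cvg_id].
Qed.

Theorem proposition8p6 (R : realType) (KL : scalars) (s r : smoothness)
  (hs : s = Cinfty \/ s = Comega) (hr : r <> Comega)
  (Y : tvsType (baseK R KL)) (G : preTopologicalGroupType)
  (AG : set (chart G Y)) (hG : is_lie_group s AG)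
  (X : tvsType (baseK R KL)) (M : topologicalType)
  (AM : set (chart M X)) (alpha : G -> M -> M)
  (hM : is_Gmanifold r AG AM alpha)
  (I : eqType) (F : I -> tvsType (baseL R KL))
  (E : I -> M -> lmodType (baseL R KL))
  (S : forall i, total_structure (E i))
  (beta : forall i g x, {linear E i x -> E i (alpha g x)})
  (hE : forall i, is_equivariant_vbundle r AM (F i) (S i) AG (beta i))
  (hab :
    (finite_dimensional Y /\ finite_dimensional X) \/
    [/\ countable [set: I], (forall i, k_omega (F i)), k_omega Y & k_omega X])
  (hc : forall x : M, exists U : set M,
    [/\ open U, U x &
      forall i, exists psi : total_space (E i) -> M * F i, local_triv r AM (S i) U psi]) :
  exists T : total_structure (sum_fibre E),
    [/\ is_equivariant_vbundle r AM (dsum F) T AG (sum_action beta),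
        sum_compatible r AM F S T &
        forall T' : total_structure (sum_fibre E),
          is_vbundle r AM (dsum F) T' -> sum_compatible r AM F S T' ->
          same_structure r T T'].
Proof.
have [mG _ _] := hG; have [hY _ hcG cG _] := mG.
have [mM act_alpha halpha] := hM; have [hX _ _ _ _] := mM.
have kwP (Z : topologicalType) : k_omega Z -> k_exhaustible Z.
  by move=> /k_omega_kexh.
have [pX pYX] : admissible X F /\ admissible (Y * X)%type F.
  case: hab => [[fY fX]|[cI kF kY kX]].
    split; left; first exact: fd_compact_nbhs.
    move=> [y x]; have [C cC Cy] := fd_compact_nbhs hY fY y.
    have [D cD Dx] := fd_compact_nbhs hX fX x.
    by exists (C `*` D); [exact: compact_setX|exists (C, D)].
  have kFw i : k_exhaustible (F i) by exact: kwP.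
  by split; right; split=> //; [exact: kwP|apply: k_exhaustible_prod; exact: kwP].
have hV i : is_vbundle r AM (F i) (S i) by case: (hE i).
have cov x : exists U (psi : forall i, total_space (E i) -> M * F i),
    U x /\ local_trivs r AM S U psi.
  have [U [oU Ux hpsi]] := hc x.
  (* The trivializations are given one index at a time; a whole family is chosen. *)
  exists U, (fun i => projT1 (cid (hpsi i))); split=> //; split=> // i.
  exact: projT2 (cid (hpsi i)).
pose T := sum_structure hr mM hV pX.
have vT : is_vbundle r AM (dsum F) T by exact: sum_vbundle.
have cT : sum_compatible r AM F S T.
  by move=> U psi oU lt; apply: sum_local_triv.
exists T; split => //.
  split => //; first exact: (sum_is_action act_alpha hE).
  exact: (sum_action_Cmap hr mM hV pX cov hY hcG cG halpha hE pYX).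
(* Uniqueness: a compatible structure [T'] shares the trivializations [sum_triv psi] with [T], so
   the identity is regular in both directions. *)
move=> T' vT' cT'; have common x : exists U (psi : total_space (sum_fibre E) ->
  M * dsum F),
    [/\ U x, local_triv r AM T U psi & local_triv r AM T' U psi].
  have [U [psi [Ux [oU lt]]]] := cov x.
  by exists U, (sum_triv psi); split=> //; [exact: cT|exact: cT'].
exists id; split => //; first exact: (id_Cmap_of_common_trivs hr mM vT vT').
apply: (id_Cmap_of_common_trivs hr mM vT' vT) => x.
by have [U [psi [Ux lt lt']]] := common x; exists U, psi.
Qed.
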